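(* For every $0 < \gamma \le 1$ and $c > 0$, there exists $\alpha > 0$ such that the following holds for all sufficiently large $n \in \mathbb{N}$ (how large depends only on $\gamma$ and $c$). For all real $\delta$ with $n^{-\alpha} < \delta \le 1 - c$, there is a set $S \subseteq [n]$ with $|S| \ge \delta n$ such that for every $A, B \subseteq \mathbb{N}$ satisfying $$\min\{|A|, |B|\} \ge \frac{(3 + \gamma) \log n}{\log (1 / \delta)},$$ we have $A + B \not\subseteq S$.
   Context: $\mathbb{N} = \{1, 2, 3, \ldots\}$ and $[n] = \{1, \ldots, n\}$. For sets $A, B$, the sumset is $A + B = \{a + b : a \in A,\ b \in B\}$. $\log$ is the natural logarithm. *)

(* Defs.v *)
From mathcomp Require Import all_boot all_order all_algebra.
From mathcomp Require Import all_classical all_reals all_analysis.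

Set Implicit Arguments.
Unset Strict Implicit.
Unset Printing Implicit Defensive.

Local Open Scope classical_set_scope.

Definition posnat : set nat := [set k | (0 < k)%N].

Definition upto (n : nat) : set nat := [set k | (1 <= k <= n)%N].

Definition sumset (A B : set nat) : set nat :=
  [set (a + b)%N | a in A & b in B].

(* Main.v *)
(* Let k be the common size of A and B. A code is a list of elements of A and B in which every
   entry is either free or derived, i.e. of the form x + z - y for earlier entries x, y, z.
   The combinatorial core (theorem [encoding]) finds, for every D and all large k, a code inside
   A and B of length o(L / log k) with at most (3 + 1/D) L / k free entries, where L >= k / 2
   is the number of sums that the listed elements determine. There are at most
   n^((3 + 1/D) L / k) 2^(L / D) such codes with given L, and a random m-subset of [n] contains
   the L sums of one of them with probability at most (m / n)^L, so for
   k >= (3 + gamma) log n / log (n / m) a union bound produces the set S.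

   If |A + B| > t k, for a small power t of k, all of A and B is listed and the number of free
   entries is bounded by Freiman's lemma: removing the two maxima loses one sum for each new
   free entry. If |A + B| <= t k, the sets are moved into a large prime field and hashed by an
   affine map into M cells. Sparse subsets of A and B still represent all the popular sums, and
   an averaging argument gives two short arcs of cells on which the sumset has at most its fair
   share of elements; Freiman's lemma generates the elements in these arcs. Popularity lets every
   element of a cell be derived from many elements of a neighbouring cell, so greedy hitting
   sets, each of logarithmic size, propagate the code around all cells and finally to the
   sparse subsets, at negligible cost in length and no further free entries. *)

Require Import Defs.
From mathcomp Require Import all_classical all_reals all_analysis.
From mathcomp Require Import all_boot all_order all_algebra.
From mathcomp Require Import zify ring lra.
Set Implicit Arguments.
Unset Strict Implicit.
Unset Printing Implicit Defensive.
Import Order.TTheory GRing.Theory Num.Theory.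

(** * Codes and Freiman's lemma *)

(** The number 3 arises as 2 + 1. With M = 10 q cells, a five-cell arc holds about k / (2 q)
    elements of A or B, but the sums of two arcs spread over ten cells and number about x / q, where
    x counts the sums determined by the sparse sets. Freiman's lemma bounds the free entries by
    roughly the quotient 2 x / k; passing to an integer costs up to 1, which is about x / k at most
    because x >= (1 - 10 / t) k. The obstacle is length: even a derived entry costs on the order of
    log k bits, so a code of all 2 k elements is affordable only if the sums outnumber k by much
    more than log k. For small sumsets Freiman's lemma must therefore run on a small part of the
    sets, without losing in the ratio of sums to elements, and all the rest must follow by
    derivations alone. The hashes of A and B share their multiplier, so a relation a + b = a' + b'
    survives hashing and links neighbouring cells to each other. The parameter t is the largest
    integer with t^100 <= k: logarithms of k are then negligible against t, and errors are measured
    in powers of t. *)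

Definition tagged := (bool * nat)%type.

(** Tags are ignored here, so an element of one set may come from one of its own kind and two of the
    other. The additive form of the equation avoids truncated subtraction. *)
Definition derivable (l : seq tagged) (v : nat) : Prop :=
  exists x y z, [/\ x \in [seq e.2 | e <- l], y \in [seq e.2 | e <- l],
    z \in [seq e.2 | e <- l] & v + y = x + z].

Inductive gen : nat -> seq tagged -> Prop :=
| gen_nil : gen 0 [::]
| gen_free r l e : gen r l -> gen r.+1 (e :: l)
| gen_der r l e : gen r l -> derivable l e.2 -> gen r (e :: l).

Definition sums (A B : seq nat) := undup [seq x + y | x <- A, y <- B].

Definition tag (A B : seq nat) : seq tagged :=
  [seq (true, x) | x <- A] ++ [seq (false, y) | y <- B].

Lemma mem_sums A B s :
  reflect (exists x y, [/\ x \in A, y \in B & s = x + y]) (s \in sums A B).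
Proof.
rewrite mem_undup; apply: (iffP allpairsP) => [[[x y] [/= ? ? ->]]|[x [y [? ? ->]]]].
  by exists x, y.
by exists (x, y).
Qed.

Lemma mem_tag A B e : (e \in tag A B) = if e.1 then e.2 \in A else e.2 \in B.
Proof.
case: e => -[] v; rewrite mem_cat /=.
  rewrite mem_map; last by move=> ? ? [].
  by rewrite orbC; case: mapP => //= -[? _ []].
rewrite [X in _ || X]mem_map; last by move=> ? ? [].
by case: mapP => //= -[? _ []].
Qed.

(** [S] stands for a set: the order in which its elements are generated is left existential, so that
    codes extend by [::]. Uniqueness later bounds the length of the code by the cardinality of
    [S]. *)
Definition genle (r : nat) (S : seq tagged) : Prop :=
  exists r' l, [/\ r' <= r, gen r' l, l =i S & uniq l].

Lemma genle_mon r s S : r <= s -> genle r S -> genle s S.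
Proof.
by move=> rs [r' [l [r'r g lS u]]]; exists r', l; split => //; apply: leq_trans rs.
Qed.

Lemma genle_nil r : genle r [::].
Proof. by exists 0, [::]; split => //; exact: gen_nil. Qed.

Lemma genle_eqi r S S' : S =i S' -> genle r S -> genle r S'.
Proof.
by move=> SS' [r' [l [? ? lS ?]]]; exists r', l; split=> // x; rewrite lS SS'.
Qed.

Lemma derivable_sub l l' v : {subset l <= l'} -> derivable l v -> derivable l' v.
Proof.
move=> ll' [x [y [z [hx hy hz e]]]]; exists x, y, z; split => //.
- by case/mapP: hx => u /ll' ul ->; apply: map_f.
- by case/mapP: hy => u /ll' ul ->; apply: map_f.
- by case/mapP: hz => u /ll' ul ->; apply: map_f.
Qed.

Lemma genle_free r S e : genle r S -> genle r.+1 (e :: S).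
Proof.
move=> [r' [l [r'r g lS u]]].
have [el|el] := boolP (e \in l).
  exists r', l; split => //; first exact: leqW.
  by move=> x; rewrite in_cons -lS; case: eqP => //= ->; rewrite el.
exists r'.+1, (e :: l); split => //=; last by rewrite el.
  exact: gen_free.
by move=> x; rewrite !in_cons lS.
Qed.

Lemma genle_der r S e : genle r S -> derivable S e.2 -> genle r (e :: S).
Proof.
move=> [r' [l [r'r g lS u]]] d.
have [el|el] := boolP (e \in l).
  exists r', l; split => //.
  by move=> x; rewrite in_cons -lS; case: eqP => //= ->; rewrite el.
exists r', (e :: l); split => //=; last by rewrite el.
  by apply: gen_der => //; apply: derivable_sub d => x; rewrite lS.
by move=> x; rewrite !in_cons lS.
Qed.

Lemma derivableT A B a a' b b' S : {subset tag A B <= S} ->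
  a' \in A -> b \in B -> b' \in B -> a + b = a' + b' -> derivable S a.
Proof.
move=> sub ha hb hb' e; exists a', b, b'; split => //.
- by apply/mapP; exists (true, a') => //; apply: sub; rewrite mem_tag.
- by apply/mapP; exists (false, b) => //; apply: sub; rewrite mem_tag.
- by apply/mapP; exists (false, b') => //; apply: sub; rewrite mem_tag.
Qed.

Lemma derivableF A B a a' b b' S : {subset tag A B <= S} ->
  a \in A -> a' \in A -> b' \in B -> a + b = a' + b' -> derivable S b.
Proof.
move=> sub ha ha' hb' e; exists a', a, b'; split; last by rewrite addnC.
- by apply/mapP; exists (true, a') => //; apply: sub; rewrite mem_tag.
- by apply/mapP; exists (true, a) => //; apply: sub; rewrite mem_tag.
- by apply/mapP; exists (false, b') => //; apply: sub; rewrite mem_tag.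
Qed.

Lemma sums_lost A B a b (N : seq nat) : uniq N ->
  (forall s, s \in N -> s \in sums (a :: A) (b :: B)) ->
  (forall s, s \in N -> s \notin sums A B) ->
  size (sums A B) + size N <= size (sums (a :: A) (b :: B)).
Proof.
move=> uN sub dis; rewrite -size_cat; apply: uniq_leq_size.
  rewrite cat_uniq undup_uniq uN andbT /=; apply/hasPn => s /dis.
  by [].
move=> s; rewrite mem_cat => /orP[/mem_sums[x [y [xA yB ->]]]|/sub //].
by apply/mem_sums; exists x, y; rewrite !in_cons xA yB !orbT.
Qed.

Section TopPair.
Variables (A B : seq nat) (a b : nat).
Hypotheses (aA : forall x, x \in A -> x < a) (bB : forall y, y \in B -> y < b).

(** The key of an element is its sum with the maximum of the other side. Irreducible keys, collected
    in [irr], are sums that disappear with the top pair. *)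
Let keys := undup ([seq x + b | x <- A] ++ [seq a + y | y <- B]).
Let irr := [seq s <- keys | s \notin sums A B].

Let level m := [:: (true, a); (false, b)] ++
  [seq e <- tag A B | m <= if e.1 then e.2 + b else a + e.2].

Let mem_level m e : (e \in level m) =
  (e == (true, a)) || (e == (false, b)) ||
  ((m <= if e.1 then e.2 + b else a + e.2) && (e \in tag A B)).
Proof. by rewrite mem_cat mem_filter !in_cons in_nil orbF. Qed.

Let key_lt s : s \in keys -> s < a + b.
Proof.
rewrite mem_undup mem_cat => /orP[/mapP[x /aA xa ->]|/mapP[y /bB yb ->]].
  by rewrite ltn_add2r.
by rewrite ltn_add2l.
Qed.

(** Elements are generated by decreasing key. If a key m equals x + y with x in A and y in B, then y
    < b and x < a give x and y larger keys, so they are already listed and the new element m - b or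
    m - a is derived. Only irreducible keys cost a free entry; the 2 pays for a and b. *)
Let gen_level i : i <= a + b ->
  genle (2 + count (fun s => a + b - i <= s) irr) (level (a + b - i)).
Proof.
elim: i => [|i IH] hi.
  rewrite subn0; apply: (@genle_mon 2); first exact: leq_addr.
  apply: (@genle_eqi _ [:: (true, a); (false, b)]); last first.
    by do 2!apply: genle_free; apply: genle_nil.
  move=> e; rewrite mem_level !in_cons in_nil orbF.
  case: (_ || _) => //=; apply/esym/negbTE; rewrite negb_and -ltnNge.
  rewrite mem_tag; case: e => -[] v /=; rewrite ?ltn_add2r ?ltn_add2l orbC -implybE;
    apply/implyP; [exact: aA|exact: bB].
set m := a + b - i.+1.
have em : a + b - i = m.+1 by rewrite /m; lia.
move: {IH}(IH (ltnW hi)); rewrite em => IH.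
have cE : count (fun s => m <= s) irr = count (fun s => m < s) irr + (m \in irr).
  have ui : uniq irr by rewrite filter_uniq // undup_uniq.
  rewrite -(count_uniq_mem m ui) -count_predUI.
  rewrite [X in _ + X](_ : _ = 0) ?addn0.
    by apply: eq_count => s /=; rewrite leq_eqVlt orbC eq_sym.
  by rewrite -(count_pred0 irr); apply: eq_count => s /=; case: eqP => [->|]; rewrite ?ltnn ?andbF.
pose new := (if (b <= m) && (m - b \in A) then [:: (true, m - b)] else [::]) ++
            (if (a <= m) && (m - a \in B) then [:: (false, m - a)] else [::]).
have lE : level m =i new ++ level m.+1.
  move=> e; rewrite [RHS]mem_cat !mem_level mem_tag [e \in new]mem_cat.
  rewrite [RHS]orbCA; congr (_ || _).
  case: e => -[] v /=.
    rewrite (_ : (_, v) \in (if _ && (_ \in B) then _ else _) = false) ?orbF; last first.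
      by case: ifP => //; rewrite in_cons in_nil.
    rewrite (leq_eqVlt m) andb_orl; congr (_ || _).
    case: ifPn => [/andP[bm mA]|]; rewrite ?inE ?in_nil.
      rewrite xpair_eqE eqxx /=; apply/andP/eqP => [[/eqP -> _]|->]; first by rewrite addnK.
      by rewrite subnK.
    by move=> h; apply/negbTE; apply: contra h => /andP[/eqP -> vA]; rewrite leq_addl addnK.
  rewrite (_ : (_, v) \in (if _ && (_ \in A) then _ else _) = false) /=; last first.
    by case: ifP => //; rewrite in_cons in_nil.
  rewrite (leq_eqVlt m) andb_orl; congr (_ || _).
  case: ifPn => [/andP[bm mA]|]; rewrite ?inE ?in_nil.
    rewrite xpair_eqE eqxx /=; apply/andP/eqP => [[/eqP -> _]|->]; first by rewrite addnC addnK.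
    by rewrite addnC subnK.
  by move=> h; apply/negbTE; apply: contra h => /andP[/eqP -> vA]; rewrite leq_addr addnC addnK.
apply: genle_eqi (fsym lE) _.
have top1 : (true, a) \in level m.+1 by rewrite mem_level eqxx.
have top2 : (false, b) \in level m.+1 by rewrite mem_level eqxx orbT.
have val_level e : e \in level m.+1 -> e.2 \in [seq e.2 | e <- level m.+1].
  by move=> h; apply: map_f.
have first e : e \in new -> (forall y, y + b = m -> y \in A -> e.2 = y -> True) ->
   genle (2 + count [eta leq m] irr) (e :: level m.+1).
  move=> en _.
  have mk : m \in keys.
    move: en; rewrite mem_undup /new !mem_cat.
    case/orP; case: ifP => // /andP[h1 h2]; rewrite inE => /eqP _; apply/orP.
      by left; apply/mapP; exists (m - b) => //; rewrite subnK.
    by right; apply/mapP; exists (m - a) => //; rewrite addnC subnK.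
  have [mS|mS] := boolP (m \in sums A B); last first.
    rewrite cE mem_filter mS mk addn1 addnS.
    exact: genle_free.
  apply: genle_der.
    by apply: genle_mon IH; rewrite leq_add2l cE leq_addr.
  case/mem_sums: mS => x [y [xA yB mxy]].
  have hx : (true, x) \in level m.+1.
    by rewrite mem_level mem_tag /= xA mxy ltn_add2l bB // orbT.
  have hy : (false, y) \in level m.+1.
    by rewrite mem_level mem_tag /= yB mxy ltn_add2r aA // orbT.
  move: en; rewrite mem_cat => /orP[]; case: ifP => // /andP[h1 h2]; rewrite inE => /eqP -> /=.
    exists x, b, y; split; [exact: (val_level _ hx)|exact: (val_level _ top2)|exact: (val_level _ hy)|].
    by rewrite subnK.
  exists x, a, y; split; [exact: (val_level _ hx)|exact: (val_level _ top1)|exact: (val_level _ hy)|].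
  by rewrite subnK.
move: first; rewrite /new; case: ifP => [/andP[h1 h2]|_]; case: ifP => [/andP[h3 h4]|_] first.
(* Both sides have an element of key m. The second is derived from the first through the top pair,
   since a + (m - a) = (m - b) + b, so one key is paid for at most once. *)
- apply: (@genle_eqi _ ((false, m - a) :: (true, m - b) :: level m.+1)).
    by move=> e; rewrite /= !in_cons orbCA.
  apply: genle_der; first by apply: first; rewrite ?inE ?eqxx.
  exists (m - b), a, b; split.
  + by rewrite /= inE eqxx.
  + by rewrite /= inE (val_level _ top1) orbT.
  + by rewrite /= inE (val_level _ top2) orbT.
  + by rewrite /= !subnK.
- by apply: first; rewrite ?inE ?eqxx.
- by apply: first; rewrite ?inE ?eqxx.
- by apply: genle_mon IH; rewrite leq_add2l cE leq_addr.
Qed.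

(* Distinct irreducible keys are sums lost together with the top pair. *)
Lemma top_pair_irr r : uniq A -> uniq B -> ~ genle r (tag (a :: A) (b :: B)) ->
  size (sums A B) + maxn r 1 <= size (sums (a :: A) (b :: B)).
Proof.
move=> uA uB ng.
have top_lost : a + b \notin sums A B.
  by apply/negP => /mem_sums[x [y [/aA xa /bB yb e]]]; move: (e); lia.
have h : size (sums A B) + size (a + b :: irr) <= size (sums (a :: A) (b :: B)).
  apply: sums_lost.
  - rewrite /= filter_uniq ?undup_uniq // andbT mem_filter negb_and.
    by rewrite orbC; apply/orP; left; apply/negP => /key_lt; rewrite ltnn.
  - move=> s; rewrite inE => /orP[/eqP ->|].
      by apply/mem_sums; exists a, b; rewrite !inE !eqxx.
    rewrite mem_filter => /andP[_]; rewrite mem_undup mem_cat.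
    case/orP=> /mapP[z zA ->]; apply/mem_sums.
      by exists z, b; rewrite !inE zA eqxx orbT.
    by exists a, z; rewrite !inE zA eqxx orbT.
  - by move=> s; rewrite inE => /orP[/eqP -> //|]; rewrite mem_filter => /andP[].
apply: leq_trans h; rewrite leq_add2l /= geq_max andbT leqNgt; apply/negP => h.
apply: ng; have := gen_level (leqnn _); rewrite subnn => g.
apply: (genle_eqi _ (genle_mon _ g)); last first.
  by rewrite (eq_count (a2 := predT)) ?count_predT //; lia.
move=> e; rewrite mem_level /= !mem_tag; case: e => -[] v /=; rewrite !inE !xpair_eqE /=.
  by rewrite orbF.
by [].
Qed.

(** If a cannot be derived, then no a + y is a sum of the smaller pair, so all of them and a + b are
    lost on removal; likewise for b against [a :: A]. If both fail, the two lost families are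
    disjoint. The boolean factor makes the middle bound valid whichever family is lost: it claims
    more than one sum only for equal sizes. *)
Lemma top_pair_cases r : uniq A -> uniq B ->
  genle r (tag A B) ->
  [\/ genle r (tag (a :: A) (b :: B)),
      genle r.+1 (tag (a :: A) (b :: B)) /\
        size (sums A B) + (maxn (size A) (size B) * (size A == size B)).+1
           <= size (sums (a :: A) (b :: B))
    | genle r.+2 (tag (a :: A) (b :: B)) /\
        size (sums A B) + (size A + size B).+1 <= size (sums (a :: A) (b :: B)) ].
Proof.
move=> uA uB g.
have top_lost : a + b \notin sums A B.
  by apply/negP => /mem_sums[x [y [/aA xa /bB yb e]]]; move: (e); lia.
have dT : derivable (tag A B) a \/
    (forall y, y \in B -> a + y \notin sums A B).
  have [h|h] := EM (exists2 y, y \in B & a + y \in sums A B).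
    case: h => y yB /mem_sums[x [z [xA zB e]]]; left.
    exact: (derivableT (fun _ h => h) xA yB zB e).
  by right => y yB; apply/negP => yS; apply: h; exists y.
have dF : derivable (tag (a :: A) B) b \/
    (forall x, x \in a :: A -> x + b \notin sums (a :: A) B).
  have [h|h] := EM (exists2 x, x \in a :: A & x + b \in sums (a :: A) B).
    case: h => x xA /mem_sums[z [y [zA yB e]]]; left.
    exact: (derivableF (fun _ h => h) xA zA yB e).
  by right => x xA; apply/negP => xS; apply: h; exists x.
have consT : (true, a) :: tag A B =i tag (a :: A) B by [].
have consF : (false, b) :: tag (a :: A) B =i tag (a :: A) (b :: B).
  by move=> e; rewrite inE !mem_tag; case: e => -[] v; rewrite /= ?inE ?xpair_eqE.
have subA : {subset sums A B <= sums (a :: A) B}.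
  move=> s /mem_sums[x [y [xA yB ->]]]; apply/mem_sums; exists x, y.
  by rewrite inE xA orbT.
have lostT : (forall y, y \in B -> a + y \notin sums A B) ->
   size (sums A B) + (size B).+1 <= size (sums (a :: A) (b :: B)).
  move=> h; have -> : (size B).+1 = size (a + b :: [seq a + y | y <- B]) by rewrite /= size_map.
  apply: (@sums_lost _ _ _ _ (a + b :: [seq a + y | y <- B])).
  - rewrite /= map_inj_uniq ?uB ?andbT; last exact: addnI.
    by apply/mapP => -[y /bB yb /addnI e]; rewrite e ltnn in yb.
  - move=> s; rewrite inE => /orP[/eqP ->|/mapP[y yB ->]]; apply/mem_sums.
      by exists a, b; rewrite !inE !eqxx.
    by exists a, y; rewrite !inE eqxx yB orbT.
  - by move=> s; rewrite inE => /orP[/eqP -> //|/mapP[y yB ->]]; apply: h.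
have injb : injective (addn^~ b) by exact: addIn.
have uaA : uniq (a :: A).
  by rewrite /= uA andbT; apply/negP => /aA; rewrite ltnn.
have lostF : (forall x, x \in a :: A -> x + b \notin sums (a :: A) B) ->
   size (sums A B) + (size A).+1 <= size (sums (a :: A) (b :: B)).
  move=> h; have -> : (size A).+1 = size [seq x + b | x <- a :: A] by rewrite size_map.
  apply: sums_lost.
  - by rewrite map_inj_uniq.
  - move=> s /mapP[x xA ->]; apply/mem_sums; exists x, b.
    by rewrite xA inE eqxx.
  - by move=> s /mapP[x xA ->]; apply: contra (h _ xA) => /subA.
have lostB : (forall y, y \in B -> a + y \notin sums A B) ->
   (forall x, x \in a :: A -> x + b \notin sums (a :: A) B) ->
   size (sums A B) + (size A + size B).+1 <= size (sums (a :: A) (b :: B)).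
  move=> h1 h2.
  have -> : (size A + size B).+1 = size ([seq x + b | x <- a :: A] ++ [seq a + y | y <- B]).
    by rewrite size_cat !size_map.
  apply: sums_lost.
  - rewrite cat_uniq !map_inj_uniq ?uB ?uaA ?andbT //; last exact: addnI.
    rewrite andTb; apply/hasPn => s /mapP[y yB ->]; apply/negP => /mapP[x xA e].
    move/negP: (h2 _ xA); apply; rewrite -e; apply/mem_sums; exists a, y.
    by rewrite inE eqxx.
  - move=> s; rewrite mem_cat => /orP[] /mapP[x xA ->]; apply/mem_sums.
      by exists x, b; rewrite xA inE eqxx.
    by exists a, x; rewrite !inE xA eqxx orbT.
  - move=> s; rewrite mem_cat => /orP[] /mapP[x xA ->]; last exact: h1.
    by apply: contra (h2 _ xA) => /subA.
case: dT => [dT|nT]; case: dF => [dF|nF].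
- constructor 1; apply: genle_eqi consF _; apply: genle_der => //.
  by apply: genle_eqi consT _; apply: genle_der.
- constructor 2; split.
    apply: genle_eqi consF _; apply: genle_free.
    by apply: genle_eqi consT _; apply: genle_der.
  apply: leq_trans (lostF nF); rewrite leq_add2l ltnS.
  by case: eqP => [->|]; rewrite ?maxnn ?muln1 ?muln0.
- constructor 2; split.
    apply: genle_eqi consF _; apply: genle_der => //.
    by apply: genle_eqi consT _; apply: genle_free.
  apply: leq_trans (lostT nT); rewrite leq_add2l ltnS.
  by case: eqP => [->|]; rewrite ?maxnn ?muln1 ?muln0.
- constructor 3; split; last exact: lostB.
  apply: genle_eqi consF _; apply: genle_free.
  by apply: genle_eqi consT _; apply: genle_free.
Qed.

End TopPair.

Lemma genle_all A B : genle (size A + size B) (tag A B).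
Proof.
have h l : genle (size l) l by elim: l => [|e l IH]; [exact: genle_nil|exact: genle_free].
by have := h (tag A B); rewrite size_cat !size_map.
Qed.

(** Induction by removing both maxima, leaving sizes j. Either r free entries are still too few, and
    at least max(r, 1) sums are lost by [top_pair_irr]; or r drops by one or two, and j + 1 or 2 j +
    1 sums are lost as well. The second bound is the analogue of Freiman's lemma, strong for r small
    against j. The first, which averages both kinds of loss, stays useful for r of the order of
    j. *)
Lemma freiman_gen j A B r : sorted gtn A -> sorted gtn B -> size A = j -> size B = j ->
  ~ genle r (tag A B) ->
  j * r.+1 <= 2 * size (sums A B) /\ 2 * r * j <= 2 * size (sums A B) + r * r.-1.
Proof.
elim: j A B r => [|j IH] [|a A] [|b B] r //=.
  by move=> _ _ _ _ []; apply: genle_nil.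
move=> sA sB [zA] [zB] ng.
have gt_trans : transitive gtn by move=> x y z /= h1 h2; apply: ltn_trans h2 h1.
have aA x : x \in A -> x < a by move: x; apply/allP; exact: order_path_min sA.
have bB x : x \in B -> x < b by move: x; apply/allP; exact: order_path_min sB.
have {}sA := path_sorted sA; have {}sB := path_sorted sB.
have uA : uniq A by apply: sorted_uniq sA => // x; rewrite /= ltnn.
have uB : uniq B by apply: sorted_uniq sB => // x; rewrite /= ltnn.
have irr := top_pair_irr aA bB uA uB ng.
have rj : r < 2 * j.+1.
  rewrite ltnNge; apply/negP => h; apply: ng; apply: genle_mon (genle_all _ _).
  by move: h; rewrite /= zA zB; lia.
move: irr; set L' := size (sums (a :: A) (b :: B)); set L := size (sums A B) => irr.
have [g|ng'] := EM (genle r (tag A B)); last first.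
  by have [] := IH A B r sA sB zA zB ng'; rewrite -/L; split; nia.
case: r ng rj irr g => [|r1] ng rj irr g.
  have := @top_pair_cases A B a b aA bB 0 uA uB g.
  by rewrite -/L -/L' zA zB eqxx muln1 maxnn => -[//|[_]|[_]]; nia.
have [g1|ng1] := EM (genle r1 (tag A B)); last first.
  have [] := IH A B r1 sA sB zA zB ng1; rewrite -/L => h1 h2.
  have := @top_pair_cases A B a b aA bB _ uA uB g.
  rewrite -/L -/L' zA zB eqxx muln1 maxnn => -[//|[_ h3]|[_ h3]].
    by split; case: (r1) h2 irr h1 => [|?] /=; nia.
  by split; case: (r1) h2 irr h1 => [|?] /=; nia.
have := @top_pair_cases A B a b aA bB _ uA uB g1.
rewrite -/L -/L' zA zB => -[/(genle_mon (leqnSn _)) //|[//]|[_ h3]].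
case: r1 ng rj irr g g1 => [|r2] ng rj irr g g1.
  by split; nia.
(* A pair adds at most two free entries, so if [r2] sufficed for the smaller pair, [r2.+2] would
   suffice here. *)
have [g2|ng2] := EM (genle r2 (tag A B)).
  have := @top_pair_cases A B a b aA bB _ uA uB g2.
  case=> [/(@genle_mon _ r2.+2)|[/(@genle_mon _ r2.+2) h _]|[//]]; last first.
    by case: ng; apply: h.
  by move=> h; case: ng; apply: h; lia.
have [] := IH A B r2 sA sB zA zB ng2; rewrite -/L => h1 h2.
by split; case: (r2) h2 irr h1 rj => [|?] /=; nia.
Qed.

(** * Popular sums and hitting sets *)

Lemma drop_contra p q h s : p <= q + h -> q + s <= p -> h < s -> False.
Proof. by lia. Qed.

Section Representations.
Variable G : finZmodType.
Implicit Types (A B C : {set G}) (x a b : G).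

Definition ssum A B : {set G} := [set (x + y)%R | x in A, y in B].
Definition reps A B x : {set G} := [set a in A | (x - a)%R \in B].
Definition rep A B x : nat := #|reps A B x|.

Lemma mem_ssum A B a b : a \in A -> b \in B -> (a + b)%R \in ssum A B.
Proof. by move=> aA bB; apply/imset2P; exists a b. Qed.

Lemma rep_gt0 A B x : (0 < rep A B x) = (x \in ssum A B).
Proof.
apply/card_gt0P/imset2P => [[a]|[a b aA bB ->]].
  by rewrite inE => /andP[aA bB]; exists a (x - a)%R => //; rewrite addrC subrK.
by exists a; rewrite inE aA addrAC subrr add0r.
Qed.

Lemma rep_C A B x : rep A B x = rep B A x.
Proof.
rewrite /rep -(card_imset (mem (reps A B x)) (can_inj (subKr x))).
apply: eq_card => b; apply/imsetP/idP => [[a]|].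
  by rewrite !inE => /andP[aA bB] ->; rewrite bB subKr.
rewrite !inE => /andP[bB aA]; exists (x - b)%R; last by rewrite subKr.
by rewrite inE aA subKr.
Qed.

Lemma ssumC A B : ssum A B = ssum B A.
Proof. by apply/setP => x; rewrite -!rep_gt0 rep_C. Qed.

Lemma rep_sub A B A' B' x : A' \subset A -> B' \subset B -> (rep A' B' x <= rep A B x).
Proof.
move=> /subsetP hA /subsetP hB; apply/subset_leq_card/subsetP => a.
by rewrite !inE => /andP[/hA -> /hB ->].
Qed.

Lemma ssum_sub A B A' B' : A' \subset A -> B' \subset B -> ssum A' B' \subset ssum A B.
Proof. by move=> hA hB; apply: imset2S. Qed.

Lemma sum_rep A B (P : pred G) :
  (\sum_(x | P x) rep A B x = #|[set ab in setX A B | P (ab.1 + ab.2)%R]|).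
Proof.
rewrite (eq_bigr (fun x => \sum_(ab in [set ab in setX A B | (ab.1 + ab.2)%R == x]) 1)); last first.
  move=> x _; rewrite sum1_card /rep.
  have hinj : injective (fun a => (a, x - a)%R) by move=> a a' [].
  rewrite -(card_imset _ hinj); apply: eq_card => -[a b]; apply/imsetP/idP.
    by case=> a'; rewrite !inE => /andP[h1 h2] [-> ->] /=; rewrite h1 h2 addrC subrK eqxx.
  rewrite !inE /= => /andP[/andP[aA bB] /eqP <-]; exists a; rewrite ?inE ?aA addrAC subrr add0r //.
rewrite (exchange_big_dep (fun ab => ab \in [set ab in setX A B | P (ab.1 + ab.2)%R])) /=.
  rewrite -sum1_card; apply: eq_bigr => -[a b]; rewrite !inE /= => /andP[/andP[aA bB] Pab].
  rewrite (big_pred1 (a + b)%R) // => x; rewrite !inE /= aA bB /= eq_sym.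
  by case: eqP => [->|]; rewrite ?andbF ?andbT.
by move=> x [a b] Px; rewrite !inE /= => /andP[-> /eqP ->].
Qed.

(** Deleting a destroys one representation of every a + b; the truncation at [theta] is guaranteed
    to register this at the unpopular sums. *)
Lemma sum_min_drop A B a b0 (theta : nat) : a \in A ->
  (\sum_x minn (rep (A :\ a) (B :\ b0) x) theta
    + #|[set b in B | rep A B (a + b)%R <= theta]| <= \sum_x minn (rep A B x) theta).
Proof.
move=> aA; set X := [set b in B | _].
have -> : #|X| = (\sum_x ((x - a)%R \in X)).
  rewrite -sum1_card big_mkcond /= (reindex_inj (addIr (- a)%R)) /=.
  by apply: eq_bigr => x _; case: (_ \in X).
rewrite -big_split /=; apply: leq_sum => x _.
have h0 : (rep (A :\ a) (B :\ b0) x <= rep A B x) by apply: rep_sub; rewrite subD1set.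
case: (boolP (_ \in X)) => [|_]; last by lia.
rewrite inE => /andP[xB]; rewrite addrC subrK => xt.
suff : (rep (A :\ a) (B :\ b0) x < rep A B x) by lia.
apply: proper_card; apply/properP; split.
  apply/subsetP => y; rewrite !inE => /andP[/andP[_ ->] /andP[_ ->]] //.
by exists a; rewrite !inE ?aA ?xB // eqxx.
Qed.

(* Minimizing [sum_x min (rep x) theta + h * (number of deletions)] yields a
   sub-pair in which every element has at most h unpopular partners. *)
Lemma popular_core A B k h theta : #|A| = k -> #|B| = k ->
  exists A1 B1, [/\ A1 \subset A, B1 \subset B, #|A1| = #|B1|,
    (h * (k - #|A1|) <= theta * #|ssum A B|) &
    (forall a, a \in A1 -> #|[set b in B1 | rep A1 B1 (a + b)%R <= theta]| <= h) /\
    (forall b, b \in B1 -> #|[set a in A1 | rep A1 B1 (a + b)%R <= theta]| <= h)].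
Proof.
move=> cA cB.
pose P := fun AB : {set G} * {set G} => [&& AB.1 \subset A, AB.2 \subset B & #|AB.1| == #|AB.2|].
pose Phi := fun AB : {set G} * {set G} =>
  (\sum_x minn (rep AB.1 AB.2 x) theta + h * (k - #|AB.1|)).
have P0 : P (A, B) by rewrite /P /= !subxx cA cB eqxx.
case: (arg_minnP Phi P0) => -[A1 B1] /and3P[/= sA sB /eqP cAB] mn.
have cA1 : (#|A1| <= k) by rewrite -cA; exact: subset_leq_card.
have step a b : a \in A1 -> b \in B1 ->
  (\sum_x minn (rep A1 B1 x) theta <= \sum_x minn (rep (A1 :\ a) (B1 :\ b) x) theta + h).
  move=> aA bB.
  have PP : P (A1 :\ a, B1 :\ b).
    rewrite /P /= (subset_trans (subD1set _ _) sA) (subset_trans (subD1set _ _) sB) /=.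
    by move: cAB; rewrite (cardsD1 a A1) (cardsD1 b B1) aA bB => /eqP; rewrite eqn_add2l.
  have := mn _ PP; rewrite /Phi /=.
  have e : k - #|A1 :\ a| = (k - #|A1|).+1 by have := cardsD1 a A1; rewrite aA; lia.
  by rewrite e mulnS addnA leq_add2r.
exists A1, B1; split => //.
  have := mn _ P0; rewrite /Phi /= cA subnn muln0 addn0.
  move=> /(leq_trans (leq_addl _ _)) h1; apply: leq_trans h1 _.
  rewrite mulnC -sum_nat_const [X in (_ <= X)]big_mkcond /=; apply: leq_sum => x _.
  case: ifPn; rewrite -?rep_gt0 => hx; first exact: geq_minr.
  by move: hx; rewrite lt0n negbK => /eqP ->; rewrite min0n.
split.
  move=> a aA; rewrite leqNgt; apply/negP => hX.
  have /card_gt0P[b] : (0 < #|[set b in B1 | rep A1 B1 (a + b)%R <= theta]|).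
    exact: leq_ltn_trans hX.
  rewrite inE => /andP[bB _].
  exact: drop_contra (step _ _ aA bB) (sum_min_drop B1 b theta aA) hX.
move=> b bB; rewrite leqNgt; apply/negP => hX.
have /card_gt0P[a] : (0 < #|[set a in A1 | rep A1 B1 (a + b)%R <= theta]|).
  exact: leq_ltn_trans hX.
rewrite inE => /andP[aA _].
apply: (drop_contra (step _ _ aA bB) _ hX).
have := sum_min_drop A1 a theta bB.
rewrite (eq_bigr (fun x => minn (rep (A1 :\ a) (B1 :\ b) x) theta)); last by move=> x _; rewrite rep_C.
rewrite [X in _ <= X](eq_bigr (fun x => minn (rep A1 B1 x) theta)); last by move=> x _; rewrite rep_C.
rewrite (_ : [set b0 in A1 | _] = [set a in A1 | (rep A1 B1 (a + b)%R <= theta)]) //.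
by apply/setP => y; rewrite !inE rep_C addrC.
Qed.

End Representations.

Section Hitting.
Variables (I Y : finType).
Implicit Types (U : I -> {set Y}) (X : {set I}) (T S : {set Y}).

(** Averaging: some point of S lies in at least a fraction u / |S| of the sets not yet hit, so each
    chosen point multiplies their number by at most (|S| - u) / |S|. Denominators are cleared. *)
Lemma hitting_greedy U X S u t : (forall i, i \in X -> u <= #|U i :&: S|) ->
  exists T, [/\ T \subset S, #|T| <= t &
    #|[set i in X | [disjoint U i & T]]| * #|S| ^ t <= #|X| * (#|S| - u) ^ t].
Proof.
move=> hU; elim: t => [|t [T [TS cT hT]]].
  exists set0; rewrite sub0set cards0; split => //.
  by rewrite !expn0 !muln1; apply/subset_leq_card/subsetP => i; rewrite inE => /andP[].
set X' := [set i in X | _] in hT.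
have X'X i : i \in X' -> i \in X by rewrite inE => /andP[].
have tot : #|X'| * u <= \sum_(y in S) #|[set i in X' | y \in U i]|.
  rewrite -sum_nat_const.
  under [X in _ <= X]eq_bigr => y _ do rewrite -sum1dep_card.
  rewrite (exchange_big_dep (mem X')) /=; last by move=> y i _ /andP[].
  apply: leq_sum => i iX'; apply: leq_trans (hU _ (X'X _ iX')) _.
  rewrite -sum1_card leq_eqVlt; apply/orP; left; apply/eqP; apply: eq_bigl => y.
  by rewrite in_setI iX' /= andbC.
have [S0|/set0Pn[y0 y0S]] := eqVneq S set0.
  exists T; split => //; first exact: leqW.
  by rewrite S0 cards0 !exp0n // !muln0.
case: (@arg_maxnP _ y0 (mem S) (fun y => #|[set i in X' | y \in U i]|) y0S) => y yS' mx.
have yS : y \in S := yS'.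
have hy : #|X'| * u <= #|S| * #|[set i in X' | y \in U i]|.
  apply: leq_trans tot _; rewrite -sum_nat_const; apply: leq_sum => z zS; exact: mx.
exists (y |: T); split.
- by rewrite subUset sub1set yS.
- by apply: leq_trans (leq_card_setU _ _) _; rewrite cards1 add1n.
have -> : [set i in X | [disjoint U i & y |: T]] = X' :\: [set i in X' | y \in U i].
  apply/setP => i; rewrite !inE ![[disjoint U i & _]]disjoint_sym !disjoints_subset subUset sub1set inE.
  by case: (i \in X); case: (y \in U i); case: (T \subset _).
rewrite cardsD (setIidPr _); last by apply/subsetP => i; rewrite inE => /andP[].
set q := #|[set i in X' | y \in U i]| in hy *.
have h1 : (#|X'| - q) * #|S| <= #|X'| * (#|S| - u) by nia.
rewrite !expnS [X in X <= _]mulnA [X in _ <= X]mulnCA.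
apply: leq_trans (leq_mul h1 (leqnn _)) _.
by rewrite mulnAC [X in X <= _]mulnC leq_mul2l hT orbT.
Qed.

Lemma leq_exp2r_weak a b n : a <= b -> a ^ n <= b ^ n.
Proof. by move=> ab; case: n => [|n]; rewrite ?expn0 ?leq_exp2r. Qed.

(** Bernoulli's inequality. In the greedy choice it means that every m points halve the number of
    sets not hit. *)
Lemma exp_halving s u m : 0 < u -> s <= u * m -> u <= s -> 2 * (s - u) ^ m <= s ^ m.
Proof.
move=> u0 sm us; case: m sm => [|m] sm; first by move: us; rewrite muln0 in sm; lia.
rewrite -[in X in _ <= X](subnK us); set q := s - u.
have bern : q ^ m.+1 + m.+1 * u * q ^ m <= (q + u) ^ m.+1.
  elim: (m) => [|j IH]; first by rewrite !expn1 expn0; lia.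
  rewrite (expnS (q + u)); apply: leq_trans (leq_mul (leqnn _) IH).
  by rewrite !expnS; nia.
apply: leq_trans bern; rewrite mul2n -addnn leq_add2l expnS leq_mul2r; apply/orP; right.
by rewrite /q; lia.
Qed.

Lemma hitting_set U X S u m e : 0 < u -> #|S| <= u * m -> #|X| < 2 ^ e ->
  (forall i, i \in X -> u <= #|U i :&: S|) ->
  exists T, [/\ T \subset S, #|T| <= m * e & forall i, i \in X -> exists2 y, y \in T & y \in U i].
Proof.
move=> u0 sm hX hU.
have [T [TS cT hT]] := hitting_greedy (m * e) hU.
exists T; split => // i iX.
have us : u <= #|S| by apply: leq_trans (hU _ iX) (subset_leq_card (subsetIr _ _)).
have s0 : 0 < #|S| by apply: leq_trans us.
suff z : [set i in X | [disjoint U i & T]] = set0.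
  have : i \notin [set i in X | [disjoint U i & T]] by rewrite z inE.
  rewrite inE iX /= disjoint_sym => /pred0Pn[y /andP[yT yU]]; by exists y.
apply/eqP; rewrite -cards_eq0 -leqn0 -ltnS -(@ltn_pmul2r (#|S| ^ (m * e))) ?mul1n ?expn_gt0 ?s0 //.
apply: leq_ltn_trans hT _.
have h : 2 ^ e * (#|S| - u) ^ (m * e) <= #|S| ^ (m * e).
  by rewrite !expnM -expnMn leq_exp2r_weak // exp_halving.
case: (posnP ((#|S| - u) ^ (m * e))) => [->|p]; first by rewrite muln0 expn_gt0 s0.
by apply: leq_trans h; rewrite ltn_pmul2r.
Qed.

(** One hitting set per round, g rounds. In round j + 1 a set met at most j times is replaced by its
    part not chosen before, which still has u points in S, so the point that hits it is new. *)
Lemma multi_hitting_set U X S u m e g : 0 < u -> #|S| <= u * m -> #|X| < 2 ^ e ->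
  (forall i, i \in X -> u + g <= #|U i :&: S|) ->
  exists T, [/\ T \subset S, #|T| <= g * (m * e) & forall i, i \in X -> g <= #|U i :&: T|].
Proof.
move=> u0 sm hX hU.
suff h j : j <= g -> exists T, [/\ T \subset S, #|T| <= j * (m * e) & forall i, i \in X -> j <= #|U i :&: T|].
  exact: h.
elim: j => [|j IH] jg; first by exists set0; rewrite sub0set cards0.
have [T [TS cT hT]] := IH (ltnW jg).
pose V i := if j < #|U i :&: T| then U i else U i :\: T.
have hV i : i \in X -> u <= #|V i :&: S|.
  move=> iX; rewrite /V; case: ifP => [_|/negbT]; first by apply: leq_trans (hU _ iX); exact: leq_addr.
  rewrite -leqNgt => hj.
  have e1 : (U i :\: T) :&: S = (U i :&: S) :\: (U i :&: T).
    by apply/setP => y; rewrite !inE; case: (y \in T); case: (y \in U i).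
  rewrite e1 cardsD.
  have := hU _ iX; have : #|U i :&: S :&: (U i :&: T)| <= #|U i :&: T|.
    exact: subset_leq_card (subsetIr _ _).
  by lia.
have [T' [TS' cT' hT']] := hitting_set u0 sm hX hV.
exists (T :|: T'); split.
- by rewrite subUset TS TS'.
- by apply: leq_trans (leq_card_setU _ _) _; rewrite mulSn addnC; apply: leq_add.
- move=> i iX; have [y yT' yV] := hT' _ iX.
  move: yV; rewrite /V; case: ifP => [hj _|_].
    by apply: leq_trans hj _; apply: subset_leq_card; apply: setIS; exact: subsetUl.
  rewrite inE => /andP[yT yU].
  apply: leq_ltn_trans (hT _ iX) _; apply: proper_card; apply/properP; split.
    by apply: setIS; exact: subsetUl.
  by exists y; rewrite !inE ?yU ?yT' ?orbT // (negPf yT).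
Qed.
End Hitting.

(** The two sides are thinned in turn: A' keeps g representations of every popular x in A' + B, and
    these give B' room to hit them. Up to the factor e, the sizes are about g k / u and k / g, so g
    balances the two sides. *)
Lemma thin_cover (G : finZmodType) (A B : {set G}) k g u m m' e :
  #|A| <= k -> #|B| <= k -> 0 < u -> 0 < g -> k <= u * m -> k <= g * m' -> k * k < 2 ^ e ->
  exists A' B' : {set G}, [/\ A' \subset A, B' \subset B, #|A'| <= g * (m * e), #|B'| <= m' * e &
    forall x, u + g <= rep A B x -> x \in ssum A' B'].
Proof.
move=> cA cB u0 g0 km km' ke.
pose X := [set x | u + g <= rep A B x].
have cX : #|X| < 2 ^ e.
  apply: leq_ltn_trans ke; apply: leq_trans (leq_mul cA cB).
  rewrite -cardsX -[X in _ <= X](card_in_imset (f := id)) //.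
  apply: leq_trans (leq_imset_card (fun ab : G * G => (ab.1 + ab.2)%R) _).
  apply: subset_leq_card; apply/subsetP => x; rewrite inE => hx.
  have : x \in ssum A B by rewrite -rep_gt0; apply: leq_trans hx; rewrite addn_gt0 u0.
  case/imset2P => a b aA bB ->; apply/imsetP; exists (a, b) => //.
  by rewrite imset_id inE aA bB.
have [A' [sA' cA' hA']] : exists T : {set G}, [/\ T \subset A, #|T| <= g * (m * e) &
     forall x, x \in X -> g <= #|reps A B x :&: T|].
  apply: (multi_hitting_set (U := reps A B) u0 _ cX); first exact: leq_trans cA km.
  move=> x; rewrite inE => /leq_trans; apply; apply: subset_leq_card.
  by apply/subsetP => a; rewrite !inE => /andP[-> ->].
have [B' [sB' cB' hB']] : exists T : {set G}, [/\ T \subset B, #|T| <= m' * e &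
     forall x, x \in X -> exists2 y, y \in T & y \in reps B A' x].
  apply: (hitting_set (U := reps B A') g0 _ cX); first exact: leq_trans cB km'.
  move=> x xX; rewrite (setIidPl _); last by apply/subsetP => b; rewrite inE => /andP[].
  have -> : #|reps B A' x| = rep A' B x by rewrite rep_C.
  apply: leq_trans (hA' _ xX) _; apply: subset_leq_card; apply/subsetP => a.
  by rewrite !inE => /andP[/andP[_ ->] ->].
exists A', B'; split => // x hx.
have [|b bB' ] := hB' x; first by rewrite inE.
by rewrite inE => /andP[bB xA]; apply/imset2P; exists (x - b)%R b; rewrite // subrK.
Qed.

(** * Second moment of affine hashing *)

Lemma PoszX (a n : nat) : ((a ^ n)%N%:Z = a%:Z ^+ n)%R.
Proof. by rewrite -natz natrX natz. Qed.

Section Hash.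
Variable F : finFieldType.
Implicit Types (Y I : {set F}) (w : F * F).

Definition affine w (y : F) : F := (w.1 * y + w.2)%R.
Definition hashed Y I w := [set y in Y | affine w y \in I].
Let p := #|F|.

Lemma affine_single I y : #|[set w : F * F | affine w y \in I]| = p * #|I|.
Proof.
have hinj : injective (fun w : F * F => (w.1, w.1 * y + w.2)%R).
  by move=> [u v] [u' v'] /= [-> /addrI ->].
rewrite /p -cardsT -cardsX.
rewrite -(card_imset _ hinj); apply: eq_card => -[u z]; rewrite !inE /=.
apply/imsetP/idP => [[[u' v']]|zI]; first by rewrite inE /affine /= => h [_ ->].
by exists (u, z - u * y)%R; rewrite ?inE /affine /= addrC subrK.
Qed.

(** Pairwise independence: the images of two distinct points determine the affine map, and every
    pair of images occurs. *)
Lemma affine_pair I y y' : y != y' ->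
  #|[set w : F * F | (affine w y \in I) && (affine w y' \in I)]| = #|I| ^ 2.
Proof.
move=> yy'.
have hinj : injective (fun w : F * F => (affine w y, affine w y')).
  move=> [u v] [u' v'] /= [e1 e2]; rewrite /affine /= in e1 e2.
  have e : ((u - u') * (y - y') = 0)%R.
    transitivity ((u * y + v) - (u' * y + v') - ((u * y' + v) - (u' * y' + v')))%R; first by ring.
    by rewrite e1 e2; ring.
  move/eqP: e; rewrite mulf_eq0 !subr_eq0 (negPf yy') orbF => /eqP uu'.
  by move: e1; rewrite uu' => /addrI ->.
rewrite expnS expn1 -cardsX -(card_imset _ hinj); apply: eq_card => -[z z']; rewrite !inE /=.
apply/imsetP/idP => [[w]|/andP[zI z'I]]; first by rewrite inE => h [-> ->].
pose u := ((z - z') / (y - y'))%R.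
have d0 : (y - y' != 0)%R by rewrite subr_eq0.
have a1 : affine (u, z - u * y)%R y = z by rewrite /affine /=; ring.
have a2 : affine (u, z - u * y)%R y' = z'.
  by rewrite /affine /= /u; field.
by exists (u, z - u * y)%R; rewrite ?inE ?a1 ?a2 ?zI.
Qed.

Lemma hashed_sum Y I w : #|hashed Y I w| = \sum_(y in Y) (affine w y \in I).
Proof.
rewrite -sum1_card big_mkcond [RHS]big_mkcond; apply: eq_bigr => y _.
by rewrite inE; case: (y \in Y) => //=; case: (_ \in I).
Qed.

Lemma moment1 Y I : \sum_w #|hashed Y I w| = #|Y| * (p * #|I|).
Proof.
under eq_bigr do rewrite hashed_sum.
rewrite exchange_big /= -sum_nat_const; apply: eq_bigr => y _.
rewrite -(affine_single I y) -sum1_card [RHS]big_mkcond; apply: eq_bigr => w _.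
by rewrite inE; case: (_ \in I).
Qed.

Lemma moment2 Y I : \sum_w #|hashed Y I w| ^ 2 = #|Y| * (p * #|I|) + #|Y| * (#|Y|.-1 * #|I| ^ 2).
Proof.
transitivity (\sum_w \sum_(y in Y) \sum_(y' in Y) ((affine w y \in I) && (affine w y' \in I))).
  apply: eq_bigr => w _; rewrite hashed_sum expnS expn1 big_distrl /=; apply: eq_bigr => y _.
  by rewrite big_distrr /=; apply: eq_bigr => y' _; rewrite -mulnb.
rewrite exchange_big /= -mulnDr -sum_nat_const; apply: eq_bigr => y yY.
rewrite exchange_big /= (bigD1 y) //=; congr (_ + _).
  rewrite -(affine_single I y) -sum1_card [RHS]big_mkcond; apply: eq_bigr => w _.
  by rewrite inE andbb; case: (_ \in I).
have -> : #|Y|.-1 = #|Y :\ y| by rewrite (cardsD1 y Y) yY.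
rewrite -sum_nat_const [RHS](eq_bigl (fun y' => (y' \in Y) && (y' != y))); last first.
  by move=> y'; rewrite !inE andbC.
apply: eq_bigr => y' /andP[_ y'y]; rewrite eq_sym in y'y.
rewrite -(affine_pair I y'y) -sum1_card [RHS]big_mkcond; apply: eq_bigr => w _.
by rewrite inE; case: (_ && _).
Qed.

Local Open Scope ring_scope.

(** Pairwise independence bounds the variance of a cell count by its mean |Y| |I| / p. Scaling
    deviations by p keeps everything integral, and the sum over the p^2 maps accounts for the factor
    p^3. *)
Lemma variance Y I :
  \sum_w ((p * #|hashed Y I w|)%:Z - (#|Y| * #|I|)%:Z) ^+ 2 <= (p ^ 3 * (#|Y| * #|I|))%:Z.
Proof.
have m1 : \sum_w (#|hashed Y I w|)%:Z = (#|Y| * (p * #|I|))%:Z.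
  by rewrite -moment1; elim/big_rec2: _ => // w a b _ ->; rewrite PoszD.
have m2 : \sum_w (#|hashed Y I w|)%:Z ^+ 2 = (#|Y| * (p * #|I|) + #|Y| * (#|Y|.-1 * #|I| ^ 2))%:Z.
  rewrite -moment2; elim/big_rec2: _ => // w a b _ ->; rewrite PoszD; congr (_ + _).
rewrite (eq_bigr (fun w => p%:Z ^+ 2 * (#|hashed Y I w|)%:Z ^+ 2
    - (2 * p%:Z * (#|Y| * #|I|)%:Z) * (#|hashed Y I w|)%:Z + (#|Y| * #|I|)%:Z ^+ 2)); last first.
  by move=> w _; rewrite !PoszM; ring.
rewrite big_split sumrB /= -!big_distrr /= m1 m2 sumr_const.
have -> : #|[pred _ : F * F | true]| = (p * p)%N by rewrite card_prod.
case: (posnP #|Y|) => [->|y0]; first by rewrite !mul0n !mulr0 mul0r subr0 add0r ?mul0n ?muln0 ?expr0n ?mul0rn ?mulr0n.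
rewrite -mulr_natr natz.
rewrite !(PoszM, PoszD, PoszX) /=.
have -> : (#|Y|.-1)%:Z = #|Y|%:Z - 1 by rewrite -subn1 -subzn.
rewrite -subr_ge0.
set y := #|Y|%:Z; set i := #|I|%:Z; set q := p%:Z.
rewrite (_ : _ - _ = q ^+ 2 * (y * i ^+ 2)); last by ring.
by rewrite mulr_ge0 ?exprn_ge0 // mulr_ge0 ?exprn_ge0.
Qed.

Lemma tail_bound Y I (P : pred (F * F)) (T : nat) :
  (forall w, P w -> T%:Z <= `|(p * #|hashed Y I w|)%:Z - (#|Y| * #|I|)%:Z|) ->
  (#|[set w | P w]| * T ^ 2 <= p ^ 3 * (#|Y| * #|I|))%N.
Proof.
move=> hP; rewrite -lez_nat; apply: le_trans (variance Y I).
rewrite (bigID P) /= -[leLHS]addr0; apply: lerD; last by apply: sumr_ge0 => w _; exact: sqr_ge0.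
rewrite PoszM.
have -> : (#|[set w | P w]|)%:Z * (T ^ 2)%N%:Z = \sum_(w | P w) T%:Z ^+ 2.
  rewrite sumr_const -mulr_natl natz -PoszX; congr (_%:Z * _).
  by apply: eq_card => w; rewrite inE.
apply: ler_sum => w Pw; rewrite -[leRHS]real_normK ?num_real //.
by rewrite lerXn2r ?nnegrE // hP.
Qed.

Local Close Scope ring_scope.

Lemma hashed_low Y I :
  #|[set w | 2 * p * #|hashed Y I w| < #|Y| * #|I|]| * (#|Y| * #|I|) <= 4 * p ^ 3.
Proof.
set q := #|Y| * #|I|.
case: (posnP q) => [->|q0]; first by rewrite muln0.
have h := @tail_bound Y I (fun w => 2 * p * #|hashed Y I w| < q) (uphalf q) _.
have {h} : #|[set w | 2 * p * #|hashed Y I w| < q]| * uphalf q ^ 2 <= p ^ 3 * q.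
  by apply: h => w; rewrite -/q; set z := #|hashed Y I w|; have := uphalf_half q; lia.
set N := #|_| => h; rewrite -(leq_pmul2r q0).
have : q ^ 2 <= 4 * uphalf q ^ 2 by have := uphalf_half q; have := odd_double_half q; nia.
nia.
Qed.

Lemma hashed_two Y I T :
  #|[set w | ~~ ((p * #|hashed Y I w| <= #|Y| * #|I| + T) &&
                 (#|Y| * #|I| <= p * #|hashed Y I w| + T)) ]| * T ^ 2 <= p ^ 3 * (#|Y| * #|I|).
Proof. by apply: tail_bound => w; set q := #|Y| * #|I|; set z := p * _; lia. Qed.

End Hash.

(** * Hashing two sets into cells *)

Lemma card_le_sum_witness (I T : finType) (P : T -> pred I) :
  #|[set t | [exists i, P t i]]| <= \sum_i #|[set t | P t i]|.
Proof.
have -> : [set t | [exists i, P t i]] = \bigcup_i [set t | P t i].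
  by apply/setP => t; rewrite inE; apply/existsP/bigcupP => [[i h]|[i _]]; [exists i; rewrite ?inE|rewrite inE; exists i].
elim/big_rec2: _ => [|i m S _ IH]; first by rewrite cards0.
by apply: leq_trans (leq_card_setU _ _) _; rewrite leq_add2l.
Qed.

Lemma leq_sum_ord M (f : 'I_M -> nat) n : (forall i, f i <= n) -> \sum_i f i <= M * n.
Proof.
move=> h; apply: (@leq_trans (\sum_(i < M) n)); first exact: leq_sum.
by rewrite sum_nat_const card_ord.
Qed.

Lemma markov_card (T : finType) (f : T -> nat) q :
  #|[set t | q < f t]| * q <= \sum_t f t.
Proof.
rewrite -sum_nat_const (eq_bigl (fun t => q < f t)); last by move=> t; rewrite inE.
rewrite big_mkcond /=; apply: leq_sum => t _.
by case: ifP => // /ltnW.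
Qed.

Lemma three_eighths a b c ab abc q : 8 * a <= q -> 8 * b <= q -> 8 * c <= q ->
  ab <= a + b -> abc <= ab + c -> 8 * abc <= 3 * q.
Proof. by lia. Qed.

Lemma avoid_contra p a b c d : 0 < p -> p * p * p <= a + b -> a <= c * p -> b <= d * p ->
  8 * c <= 3 * p ^ 2 -> 8 * d <= 3 * p ^ 2 -> False.
Proof. by rewrite expnS expn1; nia. Qed.

Section Cells.
Variables (p M w : nat).
Hypotheses (pp : prime p) (M0 : 0 < M) (w0 : 0 < w) (Mw : M * w <= p) (pMw : p <= 2 * M * w).
Local Notation F := ('F_p).
Implicit Types (A B Y : {set F}) (h : F * F).

Definition cell c : {set F} := [set x : F | c * w <= (x : nat) < c.+1 * w].

Lemma cardF : #|F| = p. Proof. by rewrite card_Fp. Qed.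

Lemma card_cell c : c < M -> #|cell c| = w.
Proof.
move=> cM.
have cp : c.+1 * w <= p by apply: leq_trans Mw; rewrite leq_mul2r cM orbT.
have hv (i : 'I_w) : ((c * w + i)%:R : F)%R = c * w + i :> nat.
  rewrite val_Fp_nat // modn_small //; apply: leq_trans cp.
  by rewrite mulSn addnC ltn_add2r.
have hinj : injective (fun i : 'I_w => ((c * w + i)%:R : F)%R).
  move=> i j /(congr1 (fun x : F => (x : nat))) /=; rewrite !hv => /addnI e; exact: val_inj.
rewrite -[RHS]card_ord -(card_imset _ hinj); apply: eq_card => x; rewrite inE.
apply/idP/imsetP => [/andP[h1 h2]|[i _ ->]]; last first.
  by rewrite hv leq_addr mulSn addnC ltn_add2r ltn_ord.
have hx : (x : nat) - c * w < w by rewrite ltn_subLR // addnC -mulSn.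
exists (Ordinal hx) => //; apply: val_inj; rewrite /= -[LHS]/(x : nat).
by rewrite -[RHS]/(nat_of_ord _) (hv (Ordinal hx)) /= subnKC.
Qed.

Definition poor Y h := [exists c : 'I_M, 2 * p * #|hashed Y (cell c) h| < #|Y| * w].

(** Chebyshev's inequality in each of the M cells, with p / w <= 2 M. A random hash thus starves
    some cell of Y, below half of its share |Y| w / p, with probability at most 8 M^2 / |Y|. *)
Lemma card_poor Y : #|[set h | poor Y h]| * #|Y| <= 8 * M ^ 2 * p ^ 2.
Proof.
rewrite -(leq_pmul2r w0) -mulnA.
have h : #|[set h | poor Y h]| * (#|Y| * w) <= M * (4 * p ^ 3).
  apply: leq_trans (leq_mul (card_le_sum_witness _) (leqnn _)) _.
  rewrite big_distrl /=; apply: leq_sum_ord => c.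
  by have := hashed_low Y (cell c); rewrite cardF card_cell.
apply: leq_trans h _.
have -> : M * (4 * p ^ 3) = 4 * M * p ^ 2 * p by rewrite (expnS p 2); lia.
have -> : 8 * M ^ 2 * p ^ 2 * w = 4 * M * p ^ 2 * (2 * M * w) by rewrite (expnS M 1) expn1; lia.
by rewrite leq_mul2l pMw orbT.
Qed.

(** The share |A| w / p is required up to a factor 1 - 1/Z or 1 + 1/Z, much more than [poor]
    controls: the sizes of the arcs of A and B enter the ratio in Freiman's lemma, where no constant
    factor can be lost. *)
Definition unbalanced A Z h := [exists c : 'I_M,
  ~~ ((Z * p * #|hashed A (cell c) h| <= Z.+1 * (#|A| * w)) &&
      (Z * (#|A| * w) <= Z * p * #|hashed A (cell c) h| + #|A| * w))].

Lemma card_unbalanced A Z : 0 < Z -> Z <= #|A| -> 64 * Z ^ 2 * M ^ 2 <= #|A| ->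
  8 * #|[set h | unbalanced A Z h]| <= p ^ 2.
Proof.
move=> Z0 ZA hA; set N := #|_|.
pose q := #|A| * w; pose T := q %/ Z.
have qZ : Z <= q by apply: leq_trans ZA _; rewrite leq_pmulr.
have TZ : Z * T <= q by rewrite mulnC leq_trunc_div.
have T2 : q <= 2 * Z * T.
  have := divn_eq q Z; have := ltn_pmod q Z0; rewrite -/T.
  have : 0 < T by rewrite divn_gt0.
  nia.
have h : N * T ^ 2 <= M * (p ^ 3 * q).
  apply: leq_trans (leq_mul (card_le_sum_witness _) (leqnn _)) _.
  rewrite big_distrl /=; apply: leq_sum_ord => c.
  have := hashed_two A (cell c) T; rewrite cardF card_cell // -/q; apply: leq_trans.
  rewrite leq_mul2r; apply/orP; right; apply: subset_leq_card; apply/subsetP => x; rewrite !inE.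
  set z := #|_|; apply: contra => /andP[h1 h2]; apply/andP; split.
    rewrite -mulnA mulSn addnC -/q; apply: leq_trans (leq_mul (leqnn Z) h1) _.
    by rewrite mulnDr leq_add2l.
  rewrite -/q; apply: leq_trans (leq_mul (leqnn Z) h2) _.
  by rewrite mulnDr mulnA leq_add2l.
have h2 : N * q ^ 2 <= 4 * Z ^ 2 * (M * (p ^ 3 * q)).
  have : q ^ 2 <= 4 * Z ^ 2 * T ^ 2 by rewrite !expnS !expn0 !muln1; nia.
  move=> hq; apply: leq_trans (leq_mul (leqnn N) hq) _.
  by rewrite mulnCA leq_mul2l h orbT.
have q0 : 0 < q by apply: leq_trans qZ.
have h3 : N * q <= 4 * Z ^ 2 * M * p ^ 3.
  by rewrite -(leq_pmul2r q0); move: h2; rewrite !expnS !expn0 !muln1; lia.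
have h4 : N * q <= 8 * Z ^ 2 * M ^ 2 * p ^ 2 * w.
  apply: leq_trans h3 _.
  have -> : 4 * Z ^ 2 * M * p ^ 3 = 4 * Z ^ 2 * M * p ^ 2 * p by rewrite (expnS p 2); lia.
  have -> : 8 * Z ^ 2 * M ^ 2 * p ^ 2 * w = 4 * Z ^ 2 * M * p ^ 2 * (2 * M * w).
    by rewrite (expnS M 1) expn1; lia.
  by rewrite leq_mul2l pMw orbT.
have h5 : N * #|A| <= 8 * Z ^ 2 * M ^ 2 * p ^ 2.
  by rewrite -(leq_pmul2r w0) -mulnA.
have A0 : 0 < #|A| by apply: leq_trans ZA.
rewrite -(leq_pmul2r A0); apply: (@leq_trans (64 * Z ^ 2 * M ^ 2 * p ^ 2)).
  by move: h5; nia.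
by rewrite [X in _ <= X]mulnC leq_mul2r hA orbT.
Qed.

Definition badpairs A B theta h :=
  [set ab in setX A B | (theta < rep A B (ab.1 + ab.2)%R) && poor (reps A B (ab.1 + ab.2)%R) h].

(** A popular sum x accounts for [rep A B x] pairs, each bad with probability at most 8 M^2 / rep.
    The multiplicity cancels, so the mean is at most 8 M^2 |A + B|; Markov's inequality is applied
    at eight times this bound. *)
Lemma card_badpairs A B theta : 0 < #|ssum A B| ->
  8 * #|[set h | 64 * M ^ 2 * #|ssum A B| < #|badpairs A B theta h|]| <= p ^ 2.
Proof.
move=> S0; set N := #|_|.
have h1 : N * (64 * M ^ 2 * #|ssum A B|) <= \sum_h #|badpairs A B theta h| by exact: markov_card.
have h2 : \sum_h #|badpairs A B theta h| <= #|ssum A B| * (8 * M ^ 2 * p ^ 2).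
  under eq_bigr => h _ do
    rewrite -(@sum_rep _ A B (fun x => (theta < rep A B x) && poor (reps A B x) h)).
  rewrite (exchange_big_dep (mem (ssum A B))) /=; last first.
    by move=> h x _ /andP[hx _]; rewrite -rep_gt0; apply: leq_ltn_trans hx.
  rewrite -sum_nat_const; apply: leq_sum => x xS.
  rewrite sum_nat_const; apply: leq_trans (card_poor (reps A B x)).
  rewrite leq_mul2r; apply/orP; right; apply: subset_leq_card; apply/subsetP => h.
  by rewrite inE /= unfold_in => /andP[].
have K0 : 0 < 8 * M ^ 2 * #|ssum A B| by rewrite !muln_gt0 ?expn_gt0 M0 S0.
rewrite -(leq_pmul2r K0); move: (leq_trans h1 h2); lia.
Qed.

Definition partners A B theta a := [set b in B | theta < rep A B (a + b)%R].

Definition poorpoints A B theta h := [set a in A | poor (partners A B theta a) h].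

(** Each of the k points has at least k / 2 partners, so it is poor with probability at most 16 M^2
    / k. The mean is at most 16 M^2, and the threshold is eight times as large. *)
Lemma card_poorpoints A B theta k : #|A| = k -> 0 < k ->
  (forall a, a \in A -> k <= 2 * #|partners A B theta a|) ->
  8 * #|[set h | 128 * M ^ 2 < #|poorpoints A B theta h|]| <= p ^ 2.
Proof.
move=> cA k0 hG; set N := #|_|.
have h1 : N * (128 * M ^ 2) <= \sum_h #|poorpoints A B theta h| by exact: markov_card.
have h2 : \sum_h #|poorpoints A B theta h| <= 16 * M ^ 2 * p ^ 2.
  under eq_bigr => h _ do rewrite -sum1dep_card.
  rewrite (exchange_big_dep (mem A)) /=; last by move=> h a _ /andP[].
  rewrite -(leq_pmul2r k0) big_distrl /=.
  apply: (@leq_trans (\sum_(a in A) 16 * M ^ 2 * p ^ 2)); last by rewrite sum_nat_const cA mulnC.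
  apply: leq_sum => a aA; rewrite sum1dep_card.
  apply: leq_trans (leq_mul (leqnn _) (hG _ aA)) _; rewrite mulnCA.
  apply: leq_trans (_ : 2 * (8 * M ^ 2 * p ^ 2) <= _); last by lia.
  rewrite leq_mul2l /=; apply: leq_trans (card_poor (partners A B theta a)).
  rewrite leq_mul2r; apply/orP; right; apply: subset_leq_card; apply/subsetP => h.
  by rewrite !inE => /andP[].
have K0 : 0 < 16 * M ^ 2 by rewrite !muln_gt0 ?expn_gt0 M0.
rewrite -(leq_pmul2r K0); move: (leq_trans h1 h2); lia.
Qed.

(** A triple of one multiplier and two offsets is drawn; each of the two hashes is still uniform,
    and the six exceptional sets have total density at most 6/8. The common multiplier is what
    carries a + b = a' + b' over to the hashed values. *)
Lemma avoid_bad (P1 P2 P3 Q1 Q2 Q3 : {set F * F}) :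
  8 * #|P1| <= p ^ 2 -> 8 * #|P2| <= p ^ 2 -> 8 * #|P3| <= p ^ 2 ->
  8 * #|Q1| <= p ^ 2 -> 8 * #|Q2| <= p ^ 2 -> 8 * #|Q3| <= p ^ 2 ->
  exists hA hB : F * F, [/\ hA.1 = hB.1, hA \notin P1 :|: P2 :|: P3 & hB \notin Q1 :|: Q2 :|: Q3].
Proof.
move=> p1 p2 p3 q1 q2 q3.
pose P := P1 :|: P2 :|: P3; pose Q := Q1 :|: Q2 :|: Q3.
have cP : 8 * #|P| <= 3 * p ^ 2.
  exact: three_eighths p1 p2 p3 (leq_card_setU P1 P2) (leq_card_setU _ _).
have cQ : 8 * #|Q| <= 3 * p ^ 2.
  exact: three_eighths q1 q2 q3 (leq_card_setU Q1 Q2) (leq_card_setU _ _).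
pose f1 := fun t : F * F * F => t.1; pose f2 := fun t : F * F * F => (t.1.1, t.2).
have card_pre (S : {set F * F}) (f : F * F * F -> F * F) (g : F * F * F -> F * F * F) :
    injective g -> (forall t, f t \in S -> g t \in setX S [set: F]) ->
    #|[set t | f t \in S]| <= #|S| * p.
  move=> gi hg; have -> : #|S| * p = #|setX S [set: F]| by rewrite cardsX cardsT cardF.
  rewrite -(card_imset _ gi).
  by apply: subset_leq_card; apply/subsetP => y /imsetP[t]; rewrite inE => /hg h ->.
have c1 : #|[set t | f1 t \in P]| <= #|P| * p.
  by apply: (card_pre P f1 id) => // -[[u v] v']; rewrite !inE /= andbT.
have c2 : #|[set t | f2 t \in Q]| <= #|Q| * p.
  apply: (card_pre Q f2 (fun t => ((t.1.1, t.2), t.1.2))) => [[[u v] v'] [[u1 v1] v1'] /= [-> -> ->] //|].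
  by move=> [[u v] v']; rewrite !inE /= andbT.
have p0 : 0 < p by exact: prime_gt0.
have /subsetPn[t _] : ~~ ([set: F * F * F] \subset [set t | f1 t \in P] :|: [set t | f2 t \in Q]).
  apply/negP => /subset_leq_card; rewrite cardsT !card_prod cardF => h.
  have {}h := leq_trans h (leq_card_setU _ _).
  exact: avoid_contra p0 h c1 c2 cP cQ.
rewrite !in_setU negb_or !inE => /andP[h1 h2].
by exists (f1 t), (f2 t); split => //; rewrite !inE ?h1 ?h2.
Qed.

Definition crowded A B theta thr h :=
  [set a in A | thr < #|[set b in B | (theta < rep A B (a + b)%R) && poor (reps A B (a + b)%R) h]|].

Lemma card_crowded A B theta thr h : #|crowded A B theta thr h| * thr <= #|badpairs A B theta h|.
Proof.
have -> : #|badpairs A B theta h| =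
   \sum_(a in A) #|[set b in B | (theta < rep A B (a + b)%R) && poor (reps A B (a + b)%R) h]|.
  rewrite -sum1_card (eq_bigr (fun a => \sum_(b in B |
     (theta < rep A B (a + b)%R) && poor (reps A B (a + b)%R) h) 1)); last first.
    by move=> a _; rewrite sum1dep_card.
  by rewrite pair_big_dep /=; apply: eq_bigl => -[a b]; rewrite !inE /= -andbA.
rewrite -sum_nat_const big_mkcond [X in _ <= X]big_mkcond; apply: leq_sum => a _.
by rewrite inE; case: (a \in A) => //=; case: ifP => // /ltnW.
Qed.

(* [DA], [DB] collect the few elements for which the hash misbehaves. *)
Lemma good_hash A B k Z theta thr : #|A| = k -> #|B| = k -> 0 < Z -> Z <= k ->
  64 * Z ^ 2 * M ^ 2 <= k ->
  (forall a, a \in A -> k <= 2 * #|partners A B theta a|) ->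
  (forall b, b \in B -> k <= 2 * #|partners B A theta b|) ->
  exists (hA hB : F * F) (DA DB : {set F}),
   [/\ hA.1 = hB.1, ~~ unbalanced A Z hA, ~~ unbalanced B Z hB,
      (#|DA| * thr <= 128 * M ^ 2 * thr + 64 * M ^ 2 * #|ssum A B|) /\
      (#|DB| * thr <= 128 * M ^ 2 * thr + 64 * M ^ 2 * #|ssum A B|) &
      (forall a, a \in A -> a \notin DA -> ~~ poor (partners A B theta a) hB /\
        #|[set b in B | (theta < rep A B (a + b)%R) && poor (reps A B (a + b)%R) hA]| <= thr) /\
      (forall b, b \in B -> b \notin DB -> ~~ poor (partners B A theta b) hA /\
        #|[set a in A | (theta < rep B A (b + a)%R) && poor (reps B A (b + a)%R) hB]| <= thr)].
Proof.
move=> cA cB Z0 Zk hk GA GB.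
have k0 : 0 < k by apply: leq_trans Zk.
have S0 : 0 < #|ssum A B|.
  have /card_gt0P[a aA] : 0 < #|A| by rewrite cA.
  have /card_gt0P[b bB] : 0 < #|B| by rewrite cB.
  by apply/card_gt0P; exists (a + b)%R; exact: mem_ssum.
have S0' : 0 < #|ssum B A| by rewrite ssumC.
have p1 : 8 * #|[set h | unbalanced A Z h]| <= p ^ 2 by apply: card_unbalanced => //; rewrite cA.
have q1 : 8 * #|[set h | unbalanced B Z h]| <= p ^ 2 by apply: card_unbalanced => //; rewrite cB.
have [hA [hB [h1 h2 h3]]] := avoid_bad p1 (card_badpairs theta S0) (card_poorpoints cB k0 GB)
   q1 (card_badpairs theta S0') (card_poorpoints cA k0 GA).
move: h2 h3; rewrite !inE !negb_or -!leqNgt => /andP[/andP[uA bA] qB] /andP[/andP[uB bB] qA].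
exists hA, hB, (poorpoints A B theta hB :|: crowded A B theta thr hA),
  (poorpoints B A theta hA :|: crowded B A theta thr hB); split => //.
  rewrite (ssumC B A) in bB.
  split; apply: leq_trans (leq_mul (leq_card_setU _ _) (leqnn _)) _; rewrite mulnDl leq_add //.
  - by rewrite leq_mul2r qA orbT.
  - exact: leq_trans (card_crowded _ _ _ _ _) bA.
  - by rewrite leq_mul2r qB orbT.
  - exact: leq_trans (card_crowded _ _ _ _ _) bB.
split=> x xA; rewrite !inE xA /= negb_or -leqNgt => /andP[]; by split.
Qed.

End Cells.

(** * Derivations between neighbouring cells *)

Lemma leq_pred_of_lt m n : m < n -> m <= n.-1.
Proof. by lia. Qed.

Lemma remain_arith d t i h g k : d <= t -> i + d = h -> i <= g -> k + t <= h -> k <= g.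
Proof. by lia. Qed.

Lemma three_arith a b c a' b' bc : a <= a' -> b <= b' -> bc <= b + c -> a + bc <= c + (a' + b').
Proof. by lia. Qed.

Section Arcs.
Variables (p M w : nat).
Hypotheses (pp : prime p) (M0 : 0 < M) (w0 : 0 < w) (Mw : M * w <= p) (pMw : p <= M.+1 * w).
Local Notation F := ('F_p).
Implicit Types (A B Y : {set F}) (h : F * F).

Definition arc (j l : nat) : {set F} := [set x : F | j * w <= (x : nat) < (j + l) * w].

(** The hashes of a and a' differ by less than 2 w, so b', which balances them against b in the
    middle cell, stays within two cells of it. This fixes the arc length 5 and the offset 2; the
    bound [j + 5 <= M] excludes wrapping modulo p. *)
Lemma hash_shift (hA hB : F * F) a b a' b' c c' j : hA.1 = hB.1 -> (a + b = a' + b')%R ->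
  affine hA a \in cell p w c' -> affine hB b \in cell p w (j + 2) -> affine hA a' \in cell p w c ->
  c <= c'.+1 -> c' <= c.+1 -> j + 5 <= M ->
  affine hB b' \in arc j 5.
Proof.
move=> hu e; rewrite !inE => /andP[a1 a2] /andP[b1 b2] /andP[c1 c2] cc' c'c jM.
have e' : (affine hA a + affine hB b = affine hA a' + affine hB b')%R.
  rewrite /affine hu; transitivity (hB.1 * (a + b) + hA.2 + hB.2)%R; first by ring.
  by rewrite e; ring.
set al := affine hA a in a1 a2 e'; set be := affine hB b in b1 b2 e'; set al' := affine hA a' in c1 c2 e'.
have l1 : (al' : nat) <= (al : nat) + (be : nat) by nia.
have l2 : j * w <= (al : nat) + be - al' by nia.
have l3 : (al : nat) + be - al' < (j + 5) * w by nia.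
suff -> : (affine hB b' : nat) = (al : nat) + be - al' by rewrite l2.
have -> : affine hB b' = (((al : nat) + be - al')%:R)%R.
  rewrite natrB // natrD !natr_Zp e'; ring.
rewrite val_Fp_nat // modn_small //; apply: leq_trans l3 _.
by apply: leq_trans Mw; rewrite leq_mul2r jM orbT.
Qed.

Definition derivers A B' hA c a :=
  [set a' in hashed A (cell p w c) hA |
     [exists b, exists b', [&& b \in B', b' \in B' & (a + b == a' + b')%R]]].

(** Double counting of pairs (b, a') with b a partner of a in the middle cell of the arc and a' a
    representative of a + b in cell c. Both b and b' = a + b - a' lie in the arc, so few pairs are
    lost because b or b' is missing from B', and a deriver a' is counted at most once per b. The
    predecessors in the hypotheses turn half of an expected count into an integer lower bound. *)
Lemma card_derivers A B B' hA hB theta thr a c c' j kap g rho :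
  hA.1 = hB.1 -> a \in A -> affine hA a \in cell p w c' ->
  c <= c'.+1 -> c' <= c.+1 -> c < M -> j + 5 <= M ->
  ~~ poor M w (partners A B theta a) hB ->
  #|[set b in B | (theta < rep A B (a + b)%R) && poor M w (reps A B (a + b)%R) hA]| <= thr ->
  #|hashed B (arc j 5) hB :\: B'| <= kap ->
  2 * p * (g + thr).-1 < #|partners A B theta a| * w -> 2 * p * rho.-1 < theta * w ->
  g * rho <= #|derivers A B' hA c a| * #|hashed B (cell p w (j + 2)) hB|
     + kap * (#|hashed A (cell p w c) hA| + #|hashed B (cell p w (j + 2)) hB|).
Proof.
move=> hu aA ac' cc' c'c cM jM np few hkap hg hrho.
set Bm := hashed B (cell p w (j + 2)) hB; set Ac := hashed A (cell p w c) hA.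
have j2M : j + 2 < M by lia.
have lowm : g + thr <= #|hashed (partners A B theta a) (cell p w (j + 2)) hB|.
  have := np; rewrite negb_exists => /forallP /(_ (Ordinal j2M)) /=; rewrite -leqNgt => h.
  rewrite leqNgt; apply/negP => h2.
  have : 2 * p * #|hashed (partners A B theta a) (cell p w (j + 2)) hB| <= 2 * p * (g + thr).-1.
    by rewrite leq_mul2l; apply/orP; right; exact: leq_pred_of_lt h2.
  by move=> h3; have := leq_trans hg (leq_trans h h3); rewrite ltnn.
pose good := [set b in hashed (partners A B theta a) (cell p w (j + 2)) hB |
   ~~ poor M w (reps A B (a + b)%R) hA].
have cgood : g <= #|good|.
  set H := hashed _ _ _ in lowm.
  have : H :\: good \subset [set b in B | (theta < rep A B (a + b)%R) && poor M w (reps A B (a + b)%R) hA].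
    apply/subsetP => b; rewrite in_setD [b \in good]in_set => /andP[+ bH].
    rewrite bH andTb negbK => hp; rewrite in_set hp andbT.
    by move: bH; rewrite 2!in_set => /andP[].
  move/subset_leq_card => h1; have h2 := cardsID good H.
  have h3 : #|H :&: good| <= #|good| by exact: subset_leq_card (subsetIr _ _).
  exact: remain_arith (leq_trans h1 few) h2 h3 lowm.
have lowc b : b \in good -> rho <= #|hashed (reps A B (a + b)%R) (cell p w c) hA|.
  rewrite !inE => /andP[/andP[/andP[bB hth] _]] /existsPn /(_ (Ordinal cM)) /=; rewrite -leqNgt => h.
  rewrite leqNgt; apply/negP => h2.
  have h3 : 2 * p * #|hashed (reps A B (a + b)%R) (cell p w c) hA| <= 2 * p * rho.-1.
    by rewrite leq_mul2l; apply/orP; right; exact: leq_pred_of_lt h2.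
  have h4 : theta * w <= rep A B (a + b)%R * w by rewrite leq_mul2r (ltnW hth) orbT.
  by have := leq_trans hrho (leq_trans h4 (leq_trans h h3)); rewrite ltnn.
pose N := [set ba : F * F | (ba.1 \in good) && (ba.2 \in hashed (reps A B (a + ba.1)%R) (cell p w c) hA)].
have cN : g * rho <= #|N|.
  apply: leq_trans (leq_mul cgood (leqnn rho)) _.
  have -> : #|N| = \sum_(b in good) #|hashed (reps A B (a + b)%R) (cell p w c) hA|.
    rewrite -sum1_card (eq_bigr (fun b => \sum_(a' in hashed (reps A B (a + b)%R) (cell p w c) hA) 1)); last first.
      by move=> b _; rewrite sum1_card.
    by rewrite pair_big_dep /=; apply: eq_bigl => -[b a']; rewrite inE.
  by rewrite -sum_nat_const; apply: leq_sum => b; exact: lowc.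
pose Bx := hashed B (arc j 5) hB :\: B'.
pose N1 := setX Bx Ac; pose N3 := setX Bm (derivers A B' hA c a).
pose N2 := [set ba : F * F | (ba.1 \in Bm) && ((a + ba.1 - ba.2)%R \in Bx)].
have sub : N \subset N1 :|: (N2 :|: N3).
  apply/subsetP => -[b a']; rewrite in_set /= => /andP[bg a'R].
  have bBm : b \in Bm.
    by move: bg; rewrite !inE => /andP[/andP[/andP[-> _] ->]].
  have bJ : b \in hashed B (arc j 5) hB.
    move: bBm; rewrite !inE => /andP[-> /andP[h1 h2]] /=; apply/andP; split.
      by apply: leq_trans h1; rewrite leq_mul2r leq_addr orbT.
    by apply: leq_trans h2 _; rewrite leq_mul2r -addnS leq_add2l orbT.
  have a'A : a' \in Ac by move: a'R; rewrite !inE => /andP[/andP[-> _] ->].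
  have b'J : (a + b - a')%R \in hashed B (arc j 5) hB.
    rewrite inE; apply/andP; split; first by move: a'R; rewrite !inE => /andP[/andP[_ ->]].
    apply: (@hash_shift hA hB a b a' _ c c' j) => //; first by ring.
      by move: bBm; rewrite inE => /andP[].
    by move: a'A; rewrite inE => /andP[].
  rewrite !in_setU.
  have [bB'|bB'] := boolP (b \in B'); last first.
    by apply/orP; left; rewrite in_setX /= a'A in_setD bB' bJ.
  apply/orP; right.
  have [b'B'|b'B'] := boolP ((a + b - a')%R \in B'); last first.
    by apply/orP; left; rewrite in_set /= bBm in_setD b'B' b'J.
  apply/orP; right; rewrite in_setX /= bBm andTb.
  rewrite in_set a'A /=; apply/existsP; exists b; apply/existsP; exists (a + b - a')%R.
  by rewrite bB' b'B' /=; apply/eqP; ring.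
apply: leq_trans cN _; apply: leq_trans (subset_leq_card sub) _.
apply: leq_trans (leq_card_setU _ _) _.
have c1 : #|N1| <= kap * #|Ac| by rewrite cardsX leq_mul2r hkap orbT.
have c3 : #|N3| = #|derivers A B' hA c a| * #|Bm| by rewrite cardsX mulnC.
have c2 : #|N2| <= kap * #|Bm|.
  have hinj : injective (fun ba : F * F => (ba.1, a + ba.1 - ba.2)%R).
    move=> [b1 a1] [b2 a2] e; have := congr1 fst e => /= eb; have := congr1 snd e => /= ea.
    by rewrite eb in ea *; congr (_, _); apply: (can_inj (subKr (a + b2)%R)).
  rewrite -(card_imset _ hinj) mulnC; apply: leq_trans (_ : #|setX Bm Bx| <= _).
    apply: subset_leq_card; apply/subsetP => y /imsetP[[b a']]; rewrite in_set /= => /andP[h1 h2] ->.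
    by rewrite in_setX h1 h2.
  by rewrite cardsX leq_mul2l hkap orbT.
have c23 := leq_card_setU N2 N3.
by rewrite mulnDr -c3; exact: three_arith c1 c2 c23.
Qed.

End Arcs.

(** * Walking along the cells *)

Lemma exists_le_average (I : finType) (i0 : I) (f : I -> nat) :
  exists i, #|I| * f i <= \sum_i f i.
Proof.
case: (@arg_minnP _ i0 xpredT f isT) => i _ mn; exists i.
by rewrite -sum_nat_const; apply: leq_sum => j _; exact: mn.
Qed.

Lemma sum_card_disjoint (I T : finType) (S : I -> {set T}) (C : {set T}) :
  (forall i, S i \subset C) -> (forall i j x, x \in S i -> x \in S j -> i = j) ->
  \sum_i #|S i| <= #|C|.
Proof.
move=> sub dis.
have -> : \sum_i #|S i| = #|[set ix : I * T | ix.2 \in S ix.1]|.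
  rewrite -sum1_card (eq_bigr (fun i => \sum_(x in S i) 1)); last by move=> i _; rewrite sum1_card.
  by rewrite pair_big_dep /=; apply: eq_bigl => -[i x]; rewrite inE.
rewrite -(@card_in_imset _ _ snd); last first.
  move=> [i x] [j y]; rewrite !inE /= => xi yj exy; rewrite exy in xi *.
  by rewrite (dis i j y).
apply: subset_leq_card; apply/subsetP => x /imsetP[[i y]]; rewrite inE /= => yi ->.
by move/subsetP: (sub i); apply.
Qed.

Lemma gen_extend r l s : gen r l -> (forall e, e \in s -> derivable l e.2) -> gen r (s ++ l).
Proof.
move=> g; elim: s => [//|e s IH] h /=; apply: gen_der.
  by apply: IH => f fs; apply: h; rewrite inE fs orbT.
by apply: derivable_sub (h e _); rewrite ?inE ?eqxx // => f fl; rewrite mem_cat fl orbT.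
Qed.

Section Base.
Variables (p M w : nat).
Hypotheses (pp : prime p) (M0 : 0 < M) (w0 : 0 < w) (Mw : M * w <= p) (pMw : p <= M.+1 * w).
Local Notation F := ('F_p).
Implicit Types (A B C : {set F}) (h : F * F).

Lemma arc_index l (i j : nat) (x : F) : 0 < l -> x \in arc p w (l * i) l -> x \in arc p w (l * j) l -> i = j.
Proof.
move=> l0; have e k : l * k + l = l * k.+1 by rewrite mulnS addnC.
rewrite !inE (e i) (e j) => /andP[h1 h2] /andP[h3 h4]; apply/eqP; rewrite eqn_leq -[i <= j]ltnS -[j <= i]ltnS.
have := leq_ltn_trans h1 h4; have := leq_ltn_trans h3 h2.
by rewrite !ltn_mul2r !ltn_mul2l w0 l0 /= => -> ->.
Qed.

Lemma ltn_charF (x : F) : (x : nat) < p.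
Proof. by have := ltn_ord x; rewrite [X in _ < X]Fp_cast. Qed.

(** Sums of two five-cell arcs spread over ten cells, so arcs of B starting ten cells apart give
    disjoint sumsets with a fixed arc of A. The bound [10 * M1 <= M] keeps the differences of such
    sums below p. *)
Lemma sum_arc_index (hA hB : F * F) A B i j j' x (M1 : nat) : hA.1 = hB.1 -> 10 * M1 <= M ->
  j < M1 -> j' < M1 ->
  x \in ssum (hashed A (arc p w (5 * i) 5) hA) (hashed B (arc p w (10 * j) 5) hB) ->
  x \in ssum (hashed A (arc p w (5 * i) 5) hA) (hashed B (arc p w (10 * j') 5) hB) -> j <= j'.
Proof.
move=> hu MM jM j'M /imset2P[a b] aH bH ->{x} /imset2P[a' b'] a'H b'H e.
move: aH bH a'H b'H; rewrite !inE.
move=> /andP[_ /andP[a1 a2]] /andP[_ /andP[b1 b2]] /andP[_ /andP[c1 c2]] /andP[_ /andP[d1 d2]].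
have e' : (affine hA a + affine hB b = affine hA a' + affine hB b')%R.
  rewrite /affine hu; transitivity (hB.1 * (a + b) + hA.2 + hB.2)%R; first by ring.
  by rewrite e; ring.
set al := affine hA a in a1 a2 e'; set be := affine hB b in b1 b2 e'.
set al' := affine hA a' in c1 c2 e'; set be' := affine hB b' in d1 d2 e'.
rewrite leqNgt; apply/negP => jj.
have lt : (al' : nat) + be' < al + be by nia.
have lt2 : al + be < (al' : nat) + be' + p by nia.
have := congr1 (fun z : F => (z : nat)) e'.
rewrite -[al]natr_Zp -[be]natr_Zp -[al']natr_Zp -[be']natr_Zp -!natrD !val_Fp_nat //.
move/eqP; rewrite eqn_mod_dvd ?(ltnW lt) // => /dvdn_leq; rewrite subn_gt0 lt => /(_ isT).
by lia.
Qed.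

Definition uncovered A B C := [set ab in setX A B | (ab.1 + ab.2)%R \notin C].

(** Averaging over all pairs of arcs. For each arc of A the sumsets inside C are disjoint, and the
    uncovered pairs are disjoint over all pairs of arcs. The weight Y puts both quantities into one
    average, so that a single pair of arcs is good for both. *)
Lemma base_choice (hA hB : F * F) A B C M1 Y : hA.1 = hB.1 -> 0 < M1 -> 10 * M1 <= M ->
  exists i j, [/\ i < 2 * M1, j < M1 &
    let A' := hashed A (arc p w (5 * i) 5) hA in
    let B' := hashed B (arc p w (10 * j) 5) hB in
    2 * M1 ^ 2 * (#|ssum A' B' :&: C| + Y * #|uncovered A' B' C|)
      <= 2 * M1 * #|C| + Y * #|uncovered A B C| ].
Proof.
move=> hu M10 MM.
pose A' (i : nat) := hashed A (arc p w (5 * i) 5) hA.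
pose B' (j : nat) := hashed B (arc p w (10 * j) 5) hB.
pose f (ij : 'I_(2 * M1) * 'I_M1) :=
  #|ssum (A' ij.1) (B' ij.2) :&: C| + Y * #|uncovered (A' ij.1) (B' ij.2) C|.
have M20 : 0 < 2 * M1 by rewrite muln_gt0.
have [[i j] hij] := exists_le_average (Ordinal M20, Ordinal M10) f.
exists i, j; split=> //=.
have -> : 2 * M1 ^ 2 = #|{: 'I_(2 * M1) * 'I_M1}| by rewrite card_prod !card_ord expnS expn1 mulnA.
apply: leq_trans hij _; rewrite big_split /= -big_distrr /= leq_add //.
  rewrite -(pair_big xpredT xpredT (fun (i : 'I_(2 * M1)) (j : 'I_M1) => #|ssum (A' i) (B' j) :&: C|)) /=.
  apply: leq_sum_ord => i'; apply: sum_card_disjoint => [j'|j1 j2 x]; first exact: subsetIr.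
  move=> /setIP[h1 _] /setIP[h2 _]; apply: val_inj; apply/eqP; rewrite eqn_leq.
  by rewrite (sum_arc_index hu MM _ _ h1 h2) // (sum_arc_index hu MM _ _ h2 h1).
rewrite leq_mul2l; apply/orP; right; apply: sum_card_disjoint.
  move=> [i1 j1] /=; apply/subsetP => -[a b]; rewrite !inE /=.
  by move=> /andP[/andP[/andP[-> _] /andP[-> _]] ->].
move=> [i1 j1] [i2 j2] [a b].
rewrite ![_ \in uncovered _ _ _]in_set !in_setX ![_ \in A' _]in_set ![_ \in B' _]in_set.
move=> /andP[/andP[/andP[_ x1] /andP[_ y1]] _] /andP[/andP[/andP[_ x2] /andP[_ y2]] _].
congr (_, _); apply: val_inj => /=; first exact: (@arc_index 5 _ _ _ isT x1 x2).
suff h (j0 : nat) y : y \in arc p w (10 * j0) 5 -> y \in arc p w (10 * j0) 10.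
  exact: (@arc_index 10 _ _ _ isT (h _ _ y1) (h _ _ y2)).
rewrite !inE => /andP[-> h] /=; apply: leq_trans h _; rewrite leq_mul2r; apply/orP; right.
by rewrite leq_add2l.
Qed.

Definition vals (A : {set F}) : seq nat := sort geq [seq nat_of_ord x | x <- enum A].

Lemma mem_vals A (x : F) : ((x : nat) \in vals A) = (x \in A).
Proof. by rewrite mem_sort mem_map ?mem_enum //; exact: val_inj. Qed.

Lemma vals_uniq A : uniq (vals A).
Proof. by rewrite sort_uniq map_inj_uniq ?enum_uniq //; exact: val_inj. Qed.

Lemma size_vals A : size (vals A) = #|A|.
Proof. by rewrite size_sort size_map cardE. Qed.

Lemma vals_sorted A : sorted gtn (vals A).
Proof.
by rewrite gtn_sorted_uniq_geq vals_uniq sort_sorted // => x y /=; rewrite leq_total.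
Qed.

Lemma size_sums_vals A B n : (forall x, x \in A -> (x : nat) <= n) ->
  (forall x, x \in B -> (x : nat) <= n) -> 2 * n < p ->
  size (sums (vals A) (vals B)) = #|ssum A B|.
Proof.
move=> hA hB np.
have val_add (a b : F) : a \in A -> b \in B -> ((a + b)%R : nat) = a + b.
  move=> /hA ha /hB hb; rewrite -[a]natr_Zp -[b]natr_Zp -natrD val_Fp_nat // modn_small ?natr_Zp //.
  by apply: leq_ltn_trans np; rewrite mul2n -addnn leq_add.
rewrite -size_vals; apply/perm_size; apply: uniq_perm; rewrite ?undup_uniq ?vals_uniq // => s.
apply/mem_sums/idP => [[x [y []]]|].
  rewrite !mem_sort => /mapP[a]; rewrite mem_enum => aA -> /mapP[b]; rewrite mem_enum => bB -> ->.
  have h : ((a + b)%R : nat) \in vals (ssum A B) by rewrite mem_vals mem_ssum.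
  by rewrite val_add // mem_sort in h.
rewrite mem_sort => /mapP[z]; rewrite mem_enum => /imset2P[a b aA bB ->] ->.
by exists (a : nat), (b : nat); rewrite !mem_vals val_add.
Qed.

Lemma val_add n (a b : F) : (a : nat) <= n -> (b : nat) <= n -> 2 * n < p ->
  ((a + b)%R : nat) = a + b.
Proof.
move=> ha hb np; rewrite -[a]natr_Zp -[b]natr_Zp -natrD val_Fp_nat // modn_small ?natr_Zp //.
by apply: leq_ltn_trans np; rewrite mul2n -addnn leq_add.
Qed.

Section Walk.
Variables (A A1 B' : {set F}) (t : bool) (hA : F * F) (n u d m e r : nat).
Hypotheses (A1A : A1 \subset A) (A1n : forall x, x \in A1 -> (x : nat) <= n)
  (B'n : forall x, x \in B' -> (x : nat) <= n) (np : 2 * n < p) (u0 : 0 < u)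
  (hd : #|A :\: A1| <= d) (cA1 : #|A1| < 2 ^ e)
  (hcell : forall c, c < M -> #|hashed A1 (cell p w c) hA| <= u * m)
  (hder : forall a c c', a \in A1 -> affine hA a \in cell p w c' -> c < M -> c <= c'.+1 ->
    c' <= c.+1 -> u + d <= #|derivers w A B' hA c a|).

(** Invariant of the walk: once B' is listed, every element hashed within one cell of c is derivable
    from l. *)
Definition hit (l : seq tagged) c := forall a c', a \in A1 -> affine hA a \in cell p w c' ->
  c <= c'.+1 -> c' <= c.+1 ->
  exists a' b b' : F, [/\ (t, a' : nat) \in l, a' \in A1, b \in B', b' \in B' & (a + b = a' + b')%R].

Lemma hit_sub l l' c : {subset l <= l'} -> hit l c -> hit l' c.
Proof.
move=> sub h a c' aA ac h1 h2; have [a' [b [b' [hl ? ? ? ?]]]] := h a c' aA ac h1 h2.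
by exists a', b, b'; split => //; exact: sub.
Qed.

Lemma hit_derivable l (a : F) c c' : (forall b : F, b \in B' -> (~~ t, b : nat) \in l) -> hit l c ->
  a \in A1 -> affine hA a \in cell p w c' -> c <= c'.+1 -> c' <= c.+1 -> derivable l a.
Proof.
move=> hB h aA ac h1 h2; have [a' [b [b' [hl a'A bB b'B eab]]]] := h a c' aA ac h1 h2.
exists (a' : nat), (b : nat), (b' : nat); split.
- by apply/mapP; exists (t, a' : nat).
- by apply/mapP; exists (~~ t, b : nat) => //; exact: hB.
- by apply/mapP; exists (~~ t, b' : nat) => //; exact: hB.
- rewrite -(val_add (A1n aA) (B'n bB) np) eab.
  by rewrite (val_add (A1n a'A) (B'n b'B) np).
Qed.

(** By the invariant at c all elements of cell c' may be appended as derived entries. It suffices to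
    append a small hitting set for the derivers of all elements near c', which restores the
    invariant at c'. The surplus d in [hder] allows for derivers outside A1. *)
Lemma walk_step l c c' : gen r l -> (forall b : F, b \in B' -> (~~ t, b : nat) \in l) ->
  hit l c -> c <= c'.+1 -> c' <= c.+1 -> c' < M ->
  exists l', [/\ gen r l', {subset l <= l'}, size l' <= size l + m * e,
    (forall f, f \in l' -> f \in l \/ exists2 a : F, a \in A1 & f = (t, a : nat)) & hit l' c'].
Proof.
move=> g hB h cc' c'c c'M.
(* The index of a neighbouring cell may reach M, since the cells below M need not exhaust the
   field. *)
pose near (a : F) := [exists c1 : 'I_M.+2, [&& affine hA a \in cell p w c1, c' <= c1.+1 & c1 <= c'.+1]].
have hU a : a \in [set a in A1 | near a] ->
    u <= #|derivers w A B' hA c' a :&: hashed A1 (cell p w c') hA|.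
  rewrite inE => /andP[aA /existsP[c1 /and3P[ac1 h1 h2]]].
  have h3 := hder aA ac1 c'M h1 h2.
  set D := derivers _ _ _ _ _ _ in h3 *.
  have sub : D :\: hashed A1 (cell p w c') hA \subset A :\: A1.
    apply/subsetP => x; rewrite !in_setD => /andP[xH]; rewrite in_set => /andP[xA _].
    by move: xA xH; rewrite ![_ \in hashed _ _ _]in_set => /andP[-> ->]; rewrite andbT => ->.
  have h4 := leq_trans (subset_leq_card sub) hd.
  have h5 := cardsID (hashed A1 (cell p w c') hA) D.
  by move: h3; rewrite -h5 => h3; rewrite -(leq_add2r d); apply: leq_trans h3 _; rewrite leq_add2l.
have cX : #|[set a in A1 | near a]| < 2 ^ e.
  apply: leq_ltn_trans cA1; apply: subset_leq_card; apply/subsetP => x; rewrite inE => /andP[] //.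
have [T [TS cT hT]] := hitting_set u0 (hcell c'M) cX hU.
have TA x : x \in T -> x \in A1 /\ affine hA x \in cell p w c'.
  by move=> /(subsetP TS); rewrite inE => /andP[].
exists ([seq (t, nat_of_ord x) | x <- enum T] ++ l); split.
- apply: gen_extend => // f /mapP[x]; rewrite mem_enum => /TA[xA xc] -> /=.
  exact: (hit_derivable hB h xA xc).
- by move=> x xl; rewrite mem_cat xl orbT.
- by rewrite size_cat size_map -cardE addnC leq_add2l.
- move=> f; rewrite mem_cat => /orP[/mapP[x]|]; last by left.
  by rewrite mem_enum => /TA[xA _] ->; right; exists x.
- move=> a c1 aA ac1 h1 h2.
  have c1M : c1 < M.+2 by lia.
  have aX : a \in [set a in A1 | near a].
    by rewrite inE aA; apply/existsP; exists (Ordinal c1M); rewrite ac1 h1.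
  have [a' a'T] := hT a aX; rewrite inE => /andP[_ /existsP[b /existsP[b' /and3P[bB b'B /eqP eab]]]].
  have [a'A _] := TA a' a'T.
  exists a', b, b'; split => //; rewrite mem_cat; apply/orP; left.
  by apply/mapP; exists a' => //; rewrite mem_enum.
Qed.

Lemma walk l c0 : gen r l -> (forall b : F, b \in B' -> (~~ t, b : nat) \in l) ->
  hit l c0 -> c0 < M ->
  exists l', [/\ gen r l', {subset l <= l'}, size l' <= size l + 2 * M * (m * e),
    (forall f, f \in l' -> f \in l \/ exists2 a : F, a \in A1 & f = (t, a : nat)) &
    forall a : F, a \in A1 -> derivable l' (a : nat)].
Proof.
move=> g hB h c0M.
suff H s : s <= M -> exists l', [/\ gen r l', {subset l <= l'}, size l' <= size l + 2 * s * (m * e),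
    (forall f, f \in l' -> f \in l \/ exists2 a : F, a \in A1 & f = (t, a : nat)) &
    forall c, c < M -> c <= c0 + s -> c0 <= c + s -> hit l' c].
  have [l' [g' sub sz el hh]] := H _ (leqnn M).
  exists l'; split => // a aA.
  pose c' := (affine hA a : nat) %/ w.
  have ac' : affine hA a \in cell p w c'.
    by rewrite inE /c' leq_trunc_div /= ltn_ceil.
  have c'M : c' < M.+1 by rewrite ltn_divLR // (leq_trans (ltn_charF _)).
  (* The residues from M * w on form an incomplete cell of index M, which is derived from its
     neighbour [M.-1]. *)
  apply: (hit_derivable (c := minn c' M.-1) (c' := c') _ _ aA ac').
  - by move=> b /hB /sub.
  - by apply: hh; lia.
  - by lia.
  - by lia.
(* The cells satisfying the invariant form an interval around [c0] that grows by one cell at either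
   end until it meets the boundary. *)
elim: s => [_|s IH sM].
  exists l; split => //; first by rewrite muln0 mul0n addn0.
    by move=> f fl; left.
  by move=> c cM h1 h2; have -> : c = c0 by lia.
have [l1 [g1 sub1 sz1 el1 hh1]] := IH (ltnW sM).
have [l2 [g2 sub2 sz2 el2 hh2]] : exists l', [/\ gen r l', {subset l1 <= l'},
    size l' <= size l1 + m * e,
    (forall f, f \in l' -> f \in l1 \/ exists2 a : F, a \in A1 & f = (t, a : nat)) &
    c0 + s.+1 < M -> hit l' (c0 + s.+1)].
  case: (ltnP (c0 + s.+1) M) => cs; last first.
    by exists l1; split; [| |exact: leq_addr|move=> f; left|move=> h1; lia].
  have [|||||l' [? ? ? ? ?]] := @walk_step l1 (c0 + s) (c0 + s.+1) g1; try lia.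
  - by move=> b /hB /sub1.
  - by apply: hh1; lia.
  by exists l'.
have [l3 [g3 sub3 sz3 el3 hh3]] : exists l', [/\ gen r l', {subset l2 <= l'},
    size l' <= size l2 + m * e,
    (forall f, f \in l' -> f \in l2 \/ exists2 a : F, a \in A1 & f = (t, a : nat)) &
    s.+1 <= c0 -> hit l' (c0 - s.+1)].
  case: (leqP s.+1 c0) => cs; last first.
    by exists l2; split; [| |exact: leq_addr|move=> f; left|move=> h1; lia].
  have [|||||l' [? ? ? ? ?]] := @walk_step l2 (c0 - s) (c0 - s.+1) g2; try lia.
  - by move=> b /hB /sub1 /sub2.
  - by apply: (hit_sub sub2); apply: hh1; lia.
  by exists l'.
exists l3; split => //.
- by move=> x /sub1 /sub2 /sub3.
- by rewrite mulnS; lia.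
- move=> f /el3[/el2[/el1|]|]; by [|right].
- move=> c cM h1 h2.
  have [e1|ne1] := eqVneq c (c0 + s.+1); first by rewrite e1 in cM *; apply: (hit_sub sub3); exact: hh2.
  have [e2|ne2] := eqVneq c (c0 - s.+1).
    have [cs|cs] := leqP s.+1 c0; first by rewrite e2; exact: hh3.
    by apply: (hit_sub sub3); apply: (hit_sub sub2); apply: hh1; lia.
  by apply: (hit_sub sub3); apply: (hit_sub sub2); apply: hh1; lia.
Qed.

End Walk.

End Base.

(** * Parameters *)

(* Powers are generalized first: otherwise lia expands them. *)
Ltac abstract_powers :=
  repeat match goal with H : context [expn ?a ?b] |- _ => revert H end;
  repeat match goal with |- context [expn ?a ?b] => generalize (expn a b); intro end;
  intros.
Ltac plia := abstract_powers; lia.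
Ltac pnia := abstract_powers; nia.

(** With threshold k / t^2 and at most k / 8 unpopular partners allowed, about 8 k / t deletions are
    possible; the 9 absorbs the rounding of k / 8. *)
Lemma core_size k k1 t : 100 <= t -> 100 <= k -> k1 <= k ->
  k %/ 8 * (k - k1) <= k %/ t ^ 2 * (t * k) -> t * (k - k1) <= 9 * k.
Proof.
move=> t100 k100 k1k h.
have h0 : k <= 9 * (k %/ 8) by have := divn_eq k 8; have := @ltn_pmod k 8 isT; lia.
have h2 : k %/ t ^ 2 * t ^ 2 <= k by exact: leq_trunc_div.
have h8 : 0 < k %/ 8 by lia.
rewrite -(leq_pmul2l h8).
have e1 : k %/ 8 * (t * (k - k1)) <= k * k.
  apply: leq_trans (_ : t * (k %/ t ^ 2 * (t * k)) <= _).
    by rewrite mulnCA leq_mul2l h orbT.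
  by apply: leq_trans (_ : k %/ t ^ 2 * t ^ 2 * k <= _); rewrite ?leq_mul2r ?h2 ?orbT //; lia.
apply: leq_trans e1 _; nia.
Qed.

Section Num.
Variables (t q k k1 M Z : nat).
(** M = 10 q makes room for q arcs of B at spacing ten. The power t^20 makes an arc so small that
    its code is short and outweighs the powers of t lost in counting uncovered pairs; t^100 <= k
    lets the exceptional elements, at most t^7 q^3 = t^67, disappear against a cell; Z = t^5 is the
    precision of the arc sizes. *)
Hypotheses (t100 : 100 <= t) (hq : q = t ^ 20) (hk : q ^ 5 <= k) (k1k : k1 <= k)
  (hk1 : t * (k - k1) <= 9 * k) (hM : M = 10 * q) (hZ : Z = t ^ 5).

Lemma tpow a b : a <= b -> t ^ a <= t ^ b.
Proof. by move=> ab; rewrite leq_pexp2l //; plia. Qed.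

Lemma qpow : [/\ q ^ 5 = t ^ 100, q ^ 4 = t ^ 80, q ^ 3 = t ^ 60 & q ^ 2 = t ^ 40].
Proof. by rewrite hq -!expnM. Qed.

Lemma t_le_pow a : 0 < a -> t <= t ^ a.
Proof. by move=> a0; rewrite -{1}[t]expn1; apply: tpow. Qed.

Lemma k1_half : 10 * k <= 11 * k1.
Proof. pnia. Qed.

Lemma big a : a < 100 -> 100 * t ^ a <= k.
Proof.
move=> a100; apply: leq_trans hk; have [-> _ _ _] := qpow.
apply: leq_trans (_ : t * t ^ a <= _); first by rewrite leq_mul2r t100 orbT.
by rewrite -expnS; apply: tpow.
Qed.

Lemma q0 : 0 < q. Proof. by rewrite hq expn_gt0; plia. Qed.

Lemma hash_size : Z <= k1 /\ 64 * Z ^ 2 * M ^ 2 <= k1.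
Proof.
have h := k1_half.
split; first by have := big (a := 5) isT; rewrite -hZ; plia.
have -> : 64 * Z ^ 2 * M ^ 2 = 64 * 100 * t ^ 50.
  by rewrite hM hZ hq expnMn -!expnM (_ : 10 ^ 2 = 100) // (_ : 5 * 2 = 10) // (_ : 20 * 2 = 40) // [t ^ 50](expnD t 10 40); plia.
have h2 : 64 * 100 * t ^ 50 <= t ^ 52.
  rewrite (expnD t 2 50) leq_mul2r; apply/orP; right.
  by rewrite expnS expn1; pnia.
have := big (a := 52) isT; plia.
Qed.

Lemma bad_size d : let thr := k1 %/ (20 * M) in
  d * thr <= 128 * M ^ 2 * thr + 64 * M ^ 2 * (t * k) -> d <= t ^ 7 * q ^ 3.
Proof.
move=> thr h.
have h1 := k1_half; have q0 := q0.
have kq : 1000 * q <= k by apply: leq_trans (big (a := 30) isT); rewrite hq (expnD t 10 20) mulnA leq_mul2r;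
   have := t_le_pow (a := 10) isT; plia.
have thr_lo : k <= 300 * q * thr.
  have e := divn_eq k1 (20 * M); rewrite -/thr in e.
  have : k1 %% (20 * M) < 20 * M by rewrite ltn_pmod // hM; plia.
  rewrite hM in e *; pnia.
have thr0 : 0 < thr by rewrite lt0n; apply/eqP => z; move: thr_lo; rewrite z; plia.
rewrite -(leq_pmul2r thr0); apply: leq_trans h _.
have m2 : 64 * M ^ 2 <= t ^ 3 * q ^ 2.
  rewrite hM expnMn mulnA leq_mul2r; apply/orP; right.
  by rewrite !expnS !expn0 !muln1; pnia.
have a1 : 128 * M ^ 2 * thr <= 2 * (t ^ 3 * q ^ 2) * thr by pnia.
have a2 : 64 * M ^ 2 * (t * k) <= t ^ 3 * q ^ 2 * (t * (300 * q * thr)).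
  by apply: leq_mul => //; rewrite leq_mul2l thr_lo orbT.
have a3 : 300 * q <= t ^ 2 * q by rewrite leq_mul2r; apply/orP; right; rewrite expnS expn1; pnia.
apply: leq_trans (leq_add a1 a2) _.
have -> : t ^ 3 * q ^ 2 * (t * (300 * q * thr)) = t ^ 3 * q ^ 2 * t * (300 * q) * thr by plia.
rewrite -mulnDl leq_mul2r; apply/orP; right.
apply: leq_trans (_ : 2 * (t ^ 3 * q ^ 2) + t ^ 3 * q ^ 2 * t * (t ^ 2 * q) <= _).
  by rewrite leq_add2l leq_mul2l a3 orbT.
have -> : t ^ 3 * q ^ 2 * t * (t ^ 2 * q) = t ^ 6 * q ^ 3.
  by rewrite (expnD t 3 3) (expnD q 2 1) (expnD t 2 1) !expn1; plia.
have -> : t ^ 7 * q ^ 3 = t * (t ^ 6 * q ^ 3) by rewrite expnS mulnA.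
have : t ^ 3 * q ^ 2 <= t ^ 6 * q ^ 3.
  by apply: leq_mul; [exact: tpow|rewrite leq_pexp2l].
pnia.
Qed.

Lemma thin_size e x : x <= t ^ 4 * ((k %/ t ^ 8).+1 * (2 * e)) -> t ^ 4 * x <= 4 * e * k.
Proof.
move=> h; apply: leq_trans (leq_mul (leqnn _) h) _.
have h2 := leq_trunc_div k (t ^ 8); have := big (a := 8) isT.
rewrite (expnD t 4 4) in h2 *; set s := t ^ 4 in h2 *; set m := k %/ _ in h2 *.
move=> h3; have : s * s * m.+1 <= 2 * k by rewrite mulnS; pnia.
pnia.
Qed.

Lemma thin_size' e x : x <= (k %/ t ^ 4).+1 * (2 * e) -> t ^ 4 * x <= 4 * e * k.
Proof.
move=> h; apply: leq_trans (leq_mul (leqnn _) h) _.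
have h2 := leq_trunc_div k (t ^ 4); have := big (a := 4) isT.
set s := t ^ 4 in h2 *; set m := k %/ _ in h2 *.
move=> h3; have : s * m.+1 <= 2 * k by rewrite mulnS; pnia.
pnia.
Qed.

Lemma base_sum_size c x H H' : 2 * q ^ 2 * (c + t ^ 6 * H') <= 2 * q * x + t ^ 6 * H ->
  H <= t ^ 10 * k -> t * q * c <= t * x + k.
Proof.
move=> h hH; have q0 := q0.
have h1 : t ^ 6 * H <= t ^ 16 * k by rewrite (expnD t 6 10) -mulnA leq_mul2l hH orbT.
have h2 : t * t ^ 16 <= q by rewrite hq -expnS; apply: tpow.
have h3 : 2 * q ^ 2 * c <= 2 * q * x + t ^ 16 * k by pnia.
have h4 : t * (2 * q ^ 2 * c) <= t * (2 * q * x) + q * k by pnia.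
rewrite -(leq_pmul2l q0); move: h4; rewrite expnS expn1; pnia.
Qed.

Lemma base_uncovered_size c x H H' : 2 * q ^ 2 * (c + t ^ 6 * H') <= 2 * q * x + t ^ 6 * H ->
  H <= t ^ 10 * k -> x <= t * k -> q * t ^ 5 * H' <= 2 * k.
Proof.
move=> h hH hx; have q0 := q0.
have h1 : t ^ 6 * H <= t ^ 16 * k by rewrite (expnD t 6 10) -mulnA leq_mul2l hH orbT.
have h2 : t ^ 16 <= q by rewrite hq; apply: tpow.
have h3 : 2 * q ^ 2 * (t ^ 6 * H') <= 2 * q * (t * k) + q * k by pnia.
have h4 : 2 * q ^ 2 * (t ^ 6 * H') = q * t * (2 * (q * t ^ 5 * H')) by rewrite (expnS t 5) (expnS q 1) expn1; plia.
have qt0 : 0 < q * t by rewrite muln_gt0 q0; plia.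
rewrite -(leq_pmul2l qt0); move: h3; rewrite h4; pnia.
Qed.

Lemma arc_hi s : Z * M * s <= 5 * Z.+1 * k1 -> q * s <= k1.
Proof.
move=> h; have Z0 : 0 < Z by rewrite hZ expn_gt0; plia.
rewrite -(leq_pmul2l Z0); rewrite hM in h; pnia.
Qed.

Lemma arc_diff s s' : Z * M * s <= 5 * Z.+1 * k1 -> 5 * Z * k1 <= Z * M.+1 * s' + 5 * k1 ->
  q * s' <= k1 -> q * t ^ 5 * (s - s') <= 2 * k.
Proof.
move=> h1 h2 h3.
case: (leqP s s') => [ss|ss].
  by move: ss; rewrite -subn_eq0 => /eqP ->; rewrite muln0.
have h4 : Z * s' <= k1.
  apply: leq_trans h3; rewrite leq_mul2r; apply/orP; right; rewrite hZ hq; exact: tpow.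
have e : Z * M.+1 * s' = Z * M * s' + Z * s' by rewrite mulnS; plia.
have h5 : Z * M * (s - s') <= 11 * k1 by rewrite mulnBr; move: h1 h2; rewrite e !mulnS; plia.
by rewrite -hZ; move: h5; rewrite hM; pnia.
Qed.

Lemma bad_small : q * t ^ 5 * (t ^ 7 * q ^ 3) <= k.
Proof.
have -> : q * t ^ 5 * (t ^ 7 * q ^ 3) = t ^ 92.
  by rewrite hq -expnM -!expnD.
have := big (a := 92) isT; plia.
Qed.

Lemma base_lo j s d H' : d <= t ^ 7 * q ^ 3 -> q * t ^ 5 * H' <= 2 * k ->
  5 * Z * k1 <= Z * M.+1 * s + 5 * k1 -> q * s <= k1 -> s <= j + d + H' ->
  t * k <= 2 * t * q * j + 10 * k.
Proof.
move=> hd hH h1 h2 h3.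
have Z0 : 0 < Z by rewrite hZ expn_gt0; plia.
have t4 : t ^ 4 >= 100 by apply: leq_trans t100 _; exact: t_le_pow.
have e5 : t ^ 5 = t * t ^ 4 by rewrite expnS.
have hd' : q * t ^ 5 * d <= k by apply: leq_trans bad_small; rewrite leq_mul2l hd orbT.
have a1 : 100 * (t * q * d) <= k by move: hd'; rewrite e5; pnia.
have a2 : 50 * (t * q * H') <= k by move: hH; rewrite e5; pnia.
have ts : t * s <= k.
  apply: leq_trans (_ : q * s <= _); last by apply: leq_trans h2 k1k.
  by rewrite leq_mul2r; apply/orP; right; rewrite hq; exact: t_le_pow.
have b1 : t * (5 * Z * k1) <= t * (Z * M.+1 * s) + t * (5 * k1) by pnia.
have b2 : t * (5 * k1) <= Z * k.
  by rewrite hZ e5; pnia.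
have b3 : 5 * t * k1 <= t * (M.+1 * s) + k.
  by rewrite -(leq_pmul2l Z0); move: b1 b2; pnia.
have b4 : 5 * t * k1 <= 10 * (t * q * s) + 2 * k.
  by move: b3; rewrite hM mulSn; pnia.
have b5 : t * q * s <= t * q * j + t * q * d + t * q * H' by rewrite -!mulnDr leq_mul2l h3 orbT.
have b6 : t * k <= t * k1 + 9 * k by move: hk1; rewrite mulnBr; plia.
by move: a1 a2 b4 b5 b6; pnia.
Qed.

Lemma sparse_room : [/\ 100 * 100 <= t ^ 2, 1000 * q * t ^ 2 <= k & 100 <= q].
Proof.
have q0 := q0; 
have t2 : 100 * 100 <= t ^ 2 by rewrite expnS expn1; exact: leq_mul.
have kq : 1000 * q * t ^ 2 <= k.
  apply: leq_trans (big (a := 30) isT).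
  have e30 : t ^ 30 = t ^ 8 * q * t ^ 2 by rewrite hq -!expnD.
  have h8 : 1000 <= 100 * t ^ 8 by have := t_le_pow (a := 8) isT; plia.
  rewrite e30; apply: leq_trans (leq_mul (leq_mul h8 (leqnn q)) (leqnn (t ^ 2))) _; plia.
have q100 : 100 <= q by rewrite hq; apply: leq_trans t100 _; exact: t_le_pow.
by split.
Qed.

Lemma good_partners_size g thr : thr = k1 %/ (20 * M) -> g = k1 %/ (4 * M.+1) - thr ->
  k1 <= 100 * q * g.
Proof.
have [t2 kq q100] := sparse_room; have hk11 := k1_half.
move=> ethr eg.
have e3 : thr * (20 * M) <= k1 by rewrite ethr leq_trunc_div.
have e4 : k1 < (k1 %/ (4 * M.+1)).+1 * (4 * M.+1) by exact: ltn_ceil.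
move: (k1 %/ (4 * M.+1)) eg e4 => G -> e4 {ethr}.
rewrite hM in e3 e4; rewrite mulnBr.
have e5 : k1 < 41 * (q * G.+1) by apply: leq_trans e4 _; clear - q100; nia.
move: e3 e5 kq hk11; clear - t2; move: (t ^ 2) t2 => T; nia.
Qed.

Lemma rep_cell_size rho : rho = k %/ t ^ 2 %/ (2 * M.+1) -> k <= 30 * q * t ^ 2 * rho.
Proof.
have [t2 kq q100] := sparse_room => erho.
have t20 : 0 < t ^ 2 by apply: leq_trans t2.
have e4 : k < (k %/ t ^ 2).+1 * t ^ 2 by exact: ltn_ceil.
move: (k %/ t ^ 2) erho e4 => th erho e4.
have e3 : th < rho.+1 * (2 * M.+1) by rewrite erho; exact: ltn_ceil.
rewrite hM in e3; move: (t ^ 2) t2 kq e4 {erho t20} => T t2 kq e4.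
have e5 : th.+1 <= 21 * q * rho.+1 by apply: leq_trans e3 _; clear - q100; nia.
have e6 : k < 21 * q * rho.+1 * T by apply: leq_trans e4 _; rewrite leq_mul2r e5 orbT.
by move: e6 kq; clear; nia.
Qed.

(** Up to constants, g is k / q, rho is k / (t^2 q) and a cell has at most k / q elements, so the
    double count yields about k / (t^2 q) derivers. This exceeds the required k / (q t^4), the
    exceptional elements, and kap, which is of order k / (q t^5). *)
Lemma derivers_size d b a kap g rho thr :
  g * rho <= d * b + kap * (a + b) -> 5 * q * a <= k1 -> 5 * q * b <= k1 ->
  thr = k1 %/ (20 * M) -> g = k1 %/ (4 * M.+1) - thr -> rho = k %/ t ^ 2 %/ (2 * M.+1) ->
  q * t ^ 5 * kap <= 5 * k ->
  k %/ (q * t ^ 4) + t ^ 7 * q ^ 3 + kap < d.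
Proof.
move=> h ha hb ethr eg erho hkap; have q0 := q0; have hk11 := k1_half.
have [t2 kq q100] := sparse_room.
have g_lo := good_partners_size ethr eg; have rho_lo := rep_cell_size erho.
move=> {ethr eg erho}.
have k10 : 0 < k1 by plia.
have h1 : rho <= 20 * (d + 2 * kap).
  rewrite -(leq_pmul2l k10).
  apply: leq_trans (_ : 100 * q * g * rho <= _); first by rewrite leq_mul2r g_lo orbT.
  have -> : 100 * q * g * rho = 20 * (5 * q * (g * rho)) by plia.
  have : 5 * q * (g * rho) <= 5 * q * (d * b + kap * (a + b)) by rewrite leq_mul2l h orbT.
  have : 5 * q * (d * b + kap * (a + b)) <= d * k1 + kap * (2 * k1) by pnia.
  pnia.
have t3 : 100 * 100 * 100 <= t ^ 3 by rewrite 2!expnS expn1; apply: leq_trans (leq_mul t100 (leq_mul t100 t100)); plia.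
have e52 : t ^ 5 = t ^ 2 * t ^ 3 by rewrite -expnD.
have e54 : t ^ 5 = t * t ^ 4 by rewrite -expnS.
have h2 : k * t ^ 3 <= 600 * (q * t ^ 5 * (d + 2 * kap)).
  apply: leq_trans (_ : 30 * q * t ^ 2 * rho * t ^ 3 <= _); first by rewrite leq_mul2r rho_lo orbT.
  rewrite e52; apply: leq_trans (_ : 30 * q * t ^ 2 * (20 * (d + 2 * kap)) * t ^ 3 <= _); last by plia.
  by rewrite leq_mul2r leq_mul2l h1 !orbT.
have h3 : k * t ^ 3 <= 600 * (q * t ^ 5 * d) + 60 * 100 * k.
  apply: leq_trans h2 _; rewrite mulnDr; pnia.
have qt0 : 0 < q * t ^ 5 by rewrite muln_gt0 q0 expn_gt0; plia.
rewrite -(ltn_pmul2l qt0) !mulnDr.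
have h4 : q * t ^ 5 * (k %/ (q * t ^ 4)) <= t * k.
  by rewrite e54 mulnCA -mulnA leq_mul2l mulnC leq_trunc_div orbT.
have h5 := bad_small.
have e33 : t ^ 3 = t * t ^ 2 by rewrite -expnS.
have h6 : 600 * (t * k + k + 5 * k) + 60 * 100 * k < k * t ^ 3.
  have h7 : 600 * t + 96 * 100 < t * t ^ 2.
    by move: (t ^ 2) t2 => T t2; clear - t2 t100; nia.
  have k0 : 0 < k by apply: leq_trans k10 k1k.
  apply: leq_trans (_ : k * (600 * t + 96 * 100) < k * t ^ 3); first by clear; lia.
  by rewrite e33 ltn_pmul2l.
move: (k %/ _) (q * t ^ 5 * (t ^ 7 * q ^ 3)) (q * t ^ 5 * kap) h4 h5 hkap h3 h6 => u1 u2 u3.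
move: (q * t ^ 5 * u1) (q * t ^ 5 * d) (k * t ^ 3) => u4 u5 u6; clear; lia.
Qed.

Lemma cell_cover_size s : 5 * q * s <= k1 -> s <= k %/ (q * t ^ 4) * t ^ 4.
Proof.
move=> h; have q0 := q0.
have e := divn_eq k (q * t ^ 4); set u := k %/ _ in e *.
have t40 : 0 < t ^ 4 by rewrite expn_gt0; plia.
have l : k %% (q * t ^ 4) < q * t ^ 4 by rewrite ltn_pmod // muln_gt0 q0.
have kq : 100 * (q * t ^ 4) <= k by apply: leq_trans (big (a := 24) isT); rewrite hq -expnD.
rewrite -(leq_pmul2l q0).
have h2 : 2 * k <= 5 * (u * (q * t ^ 4)).
  by move: (q * t ^ 4) (k %% _) e l kq {h} => v r1; clear; nia.
by move: (t ^ 4) h2 h k1k => v; clear; nia.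
Qed.

Lemma total_size e j a b : 0 < e -> q * j <= k -> t ^ 4 * a <= 4 * e * k -> t ^ 4 * b <= 4 * e * k ->
  t ^ 4 * (2 * j + 2 * (2 * M * (t ^ 4 * e)) + a + b) <= 11 * e * k.
Proof.
move=> e0 hj ha hb.
have h1 : t ^ 4 * j <= k.
  by apply: leq_trans hj; rewrite leq_mul2r; apply/orP; right; rewrite hq; exact: tpow.
have h2 : 40 * (t ^ 4 * q * t ^ 4) <= k.
  have -> : t ^ 4 * q * t ^ 4 = t ^ 28 by rewrite hq -!expnD.
  have := big (a := 28) isT; plia.
have -> : 2 * (2 * M * (t ^ 4 * e)) = 40 * (q * t ^ 4) * e by rewrite hM; plia.
rewrite !mulnDr.
have h3 : t ^ 4 * (40 * (q * t ^ 4) * e) <= k * e.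
  have -> : t ^ 4 * (40 * (q * t ^ 4) * e) = 40 * (t ^ 4 * q * t ^ 4) * e by plia.
  by rewrite leq_mul2r h2 orbT.
have : k <= e * k by rewrite leq_pmull.
plia.
Qed.

(** Up to relative errors of order 1 / t, 2 c is at most 2 x / q and 2 r j at least r k / q, so r
    must exceed 2 x / k. Rounding r down costs less than 1, hence about x / k at most by the lower
    bound on x; the remaining x / (D k) pays for the errors, which is why t >= 100 D. *)
Lemma ratio_size D x j c r : 0 < D -> 100 * D <= t -> r = (3 * D + 1) * x %/ (k * D) ->
  t * k <= t * x + 10 * k -> x <= t * k -> t * k <= 2 * t * q * j + 10 * k -> t * q * c <= t * x + k ->
  2 * c + r * r.-1 < 2 * r * j.
Proof.
move=> D0 tD er hx xk hj hc; have q0 := q0.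
have k0 : 0 < k by apply: leq_trans (big (a := 0) isT).
have e := divn_eq ((3 * D + 1) * x) (k * D); rewrite -er in e.
have kD0 : 0 < k * D by rewrite muln_gt0 k0.
have l : ((3 * D + 1) * x) %% (k * D) < k * D by rewrite ltn_pmod.
have r4 : r <= 4 * t.
  rewrite er; apply: leq_trans (_ : 4 * t * (k * D) %/ (k * D) <= _); last by rewrite mulnK.
  apply: leq_div2r; apply: leq_trans (_ : 4 * D * x <= _).
    by rewrite leq_mul2r; apply/orP; right; clear - D0; lia.
  have -> : 4 * t * (k * D) = 4 * D * (t * k) by clear; lia.
  by rewrite leq_mul2l xk orbT.
have tq0 : 0 < t * q by rewrite muln_gt0 q0; plia.
rewrite -(ltn_pmul2l tq0) mulnDr.
have a1 : t * q * (2 * c) <= 2 * t * x + 2 * k by plia.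
have a2 : t * q * (r * r.-1) <= k.
  apply: leq_trans (_ : t * q * (4 * t * (4 * t)) <= _).
    by rewrite leq_mul2l; apply/orP; right; apply: leq_mul => //; plia.
  have -> : t * q * (4 * t * (4 * t)) = 16 * t ^ 23 by rewrite hq (expnD t 20 3) !expnS expn0; plia.
  have := big (a := 23) isT; plia.
have a3 : r * (t * k) <= t * q * (2 * r * j) + r * (10 * k).
  by have : r * (t * k) <= r * (2 * t * q * j + 10 * k) by [rewrite leq_mul2l hj orbT]; plia.
suff a4 : 2 * t * x + 3 * k + r * (10 * k) < r * (t * k) by plia.
rewrite -(ltn_pmul2r D0).
have b1 : (3 * D + 1) * x < r * (k * D) + k * D by plia.
have b2 : r * (t * k) * D = t * (r * (k * D)) by plia.
have b3 : r * (10 * k) * D = 10 * (r * (k * D)) by plia.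
rewrite mulnDl b2 b3; set y := r * (k * D) in b1 *.
have [tt et] : exists tt, t = tt + 10 by exists (t - 10); plia.
suff a5 : (2 * t * x + 3 * k) * D < tt * y by rewrite et mulnDl; plia.
have b4 : tt * ((3 * D + 1) * x) <= tt * y + tt * (k * D).
  by rewrite -mulnDr leq_mul2l (ltnW b1) orbT.
have b5 : tt * k <= t * x by move: hx; rewrite [in t * k]et mulnDl leq_add2r.
suff a6 : (2 * t * x + 3 * k) * D + tt * (k * D) < tt * ((3 * D + 1) * x).
  by move: b4 a6; move: (tt * y) (tt * (k * D)) (tt * _) => ? ? ?; clear; lia.
have ttD : 90 * D <= tt by move: tD; rewrite et; clear - D0; lia.
have b6 : tt * D * k <= t * D * x by rewrite mulnAC [t * D * x]mulnAC leq_mul2r b5 orbT.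
have tt0 : 0 < tt by apply: leq_trans ttD; rewrite muln_gt0.
have b7 : 9 * k <= 10 * x.
  rewrite -(leq_pmul2l tt0) mulnCA; apply: leq_trans (_ : 9 * (t * x) <= _).
    by rewrite leq_mul2l b5 orbT.
  by move: ttD; rewrite et; clear - D0; nia.
have b8 : 90 * D * x <= tt * x by rewrite leq_mul2r ttD orbT.
have b9 : 3 * k * D <= 4 * (D * x).
  by have : D * (9 * k) <= D * (10 * x); [rewrite leq_mul2l b7 orbT|clear; lia].
have b10 : 0 < D * x by rewrite muln_gt0 D0; move: b7 k0; clear; lia.
by move: b6 b8 b9 b10; rewrite et; clear; lia.
Qed.

Lemma cover_lower d a b f x : d <= t ^ 7 * q ^ 3 -> k1 <= a + d -> k1 <= b + d ->
  a * f <= t ^ 10 * k -> b <= x + f -> t * k <= t * x + 10 * k.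
Proof.
move=> hd ha hb haf hbx; have h1 := k1_half.
have k0 : 0 < k by apply: leq_trans (big (a := 0) isT).
have e68 : t * (t ^ 7 * q ^ 3) = t ^ 68 by rewrite hq -expnM -!expnD -expnS.
have e11 : t * t ^ 10 = t ^ 11 by rewrite -expnS.
have b68 := big (a := 68) isT; have b11 := big (a := 11) isT; rewrite -e68 in b68; rewrite -e11 in b11.
move: (t ^ 7 * q ^ 3) (t ^ 10) hd haf b68 b11 => u v hd haf b68 b11.
have hd1 : 100 * d <= k by apply: leq_trans b68; move: hd t100; clear; nia.
have h2 : k <= 2 * a by move: h1 ha hd1; clear; lia.
have hf : f <= 2 * v.
  rewrite -(leq_pmul2l k0); apply: leq_trans (leq_mul h2 (leqnn f)) _; move: haf; clear; lia.
have tf : 100 * (t * f) <= 2 * k.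
  by apply: leq_trans (_ : 2 * (100 * (t * v)) <= _); [move: hf; clear; nia|rewrite leq_mul2l b11 orbT].
have td : 100 * (t * d) <= k by apply: leq_trans b68; rewrite !leq_mul2l hd !orbT.
have e1 : t * k1 <= t * x + t * f + t * d by rewrite -!mulnDr leq_mul2l; apply/orP; right; move: hb hbx; clear; lia.
have e2 : t * k <= t * k1 + 9 * k by move: hk1; rewrite mulnBr; clear; lia.
by move: tf td e1 e2; clear; lia.
Qed.

Lemma missing_size j s s' d H' : d <= t ^ 7 * q ^ 3 -> q * t ^ 5 * H' <= 2 * k ->
  s <= j + d + H' -> q * t ^ 5 * (s' - s) <= 2 * k -> q * t ^ 5 * (s' - j) <= 5 * k.
Proof.
move=> hd hH hs hs'; have h := bad_small.
have hd' : q * t ^ 5 * d <= k by apply: leq_trans h; rewrite leq_mul2l hd orbT.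
apply: leq_trans (_ : q * t ^ 5 * ((s' - s) + d + H') <= _).
  by rewrite leq_mul2l; apply/orP; right; move: hs; clear; lia.
by rewrite !mulnDr; move: hs' hd' hH; clear; lia.
Qed.

Lemma cell_hi s : Z * M * s <= Z.+1 * k1 -> 5 * q * s <= k1.
Proof.
move=> h; have Z0 : 0 < Z by rewrite hZ expn_gt0; move: t100; clear; lia.
rewrite -(leq_pmul2l Z0); rewrite hM in h; move: h Z0; clear; nia.
Qed.

Lemma thr_le : k1 %/ (20 * M) <= k1 %/ (4 * M.+1).
Proof. by apply: leq_div2l => //; rewrite hM; have := q0; clear; lia. Qed.

End Num.

Lemma floor_lt p M w K P G : p <= M.+1 * w -> 0 < w -> 0 < P -> K <= 2 * P -> G = K %/ (4 * M.+1) ->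
  2 * p * G.-1 < P * w.
Proof.
move=> hp w0 P0 KP eG; have h : G * (4 * M.+1) <= K by rewrite eG leq_trunc_div.
case: G h {eG} => [|G] h /=; first by rewrite muln0 muln_gt0 P0.
apply: leq_ltn_trans (_ : 2 * (M.+1 * w) * G < _); first by rewrite leq_mul2r leq_mul2l hp !orbT.
have {}h : 2 * (M.+1) * G.+1 <= P by move: h KP; clear; lia.
apply: leq_trans (leq_mul h (leqnn w)); move: w0; clear; nia.
Qed.

Lemma floor_lt' p M w K G : p <= M.+1 * w -> 0 < w -> 0 < K -> G = K %/ (2 * M.+1) ->
  2 * p * G.-1 < K * w.
Proof.
move=> hp w0 K0 eG; have h : G * (2 * M.+1) <= K by rewrite eG leq_trunc_div.
case: G h {eG} => [|G] h /=; first by rewrite muln0 muln_gt0 K0.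
apply: leq_ltn_trans (_ : 2 * (M.+1 * w) * G < _); first by rewrite leq_mul2r leq_mul2l hp !orbT.
have {}h : 2 * (M.+1) * G.+1 <= K by move: h; clear; lia.
apply: leq_trans (leq_mul h (leqnn w)); move: w0; clear; nia.
Qed.

(** * Sets of small doubling *)

Lemma subset_card (T : finType) (S : {set T}) j : j <= #|S| ->
  exists S' : {set T}, S' \subset S /\ #|S'| = j.
Proof.
move=> jS; exists [set x in take j (enum S)]; split.
  by apply/subsetP => x; rewrite inE => /mem_take; rewrite mem_enum.
rewrite cardsE (card_uniqP _) ?size_take -?cardE ?take_uniq ?enum_uniq //.
by rewrite ltn_neqAle jS andbT; case: eqP.
Qed.

Section ArcSizes.
Variables (p M w : nat).
Hypotheses (pp : prime p) (M0 : 0 < M) (w0 : 0 < w) (Mw : M * w <= p) (pMw : p <= M.+1 * w).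
Local Notation F := ('F_p).
Implicit Types (A B C : {set F}) (h : F * F).

Lemma card_arcS A h c l :
  #|hashed A (arc p w c l.+1) h| = #|hashed A (arc p w c l) h| + #|hashed A (cell p w (c + l)) h|.
Proof.
rewrite -cardsUI [X in _ + X](_ : _ = 0) ?addn0; last first.
  apply/eqP; rewrite cards_eq0 -subset0; apply/subsetP => x.
  rewrite in_setI ![_ \in hashed _ _ _]in_set ![_ \in arc _ _ _ _]in_set ![_ \in cell _ _ _]in_set.
  by move=> /andP[/andP[_ /andP[_ h1]] /andP[_ /andP[h2 _]]]; have := leq_trans h1 h2; rewrite ltnn.
apply: eq_card => x.
rewrite in_setU ![_ \in hashed _ _ _]in_set ![_ \in arc _ _ _ _]in_set ![_ \in cell _ _ _]in_set.
rewrite -andb_orr; congr (_ && _); rewrite addnS.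
have h1 : c * w <= (c + l) * w by rewrite leq_mul2r leq_addr orbT.
have h2 : (c + l) * w <= (c + l).+1 * w by rewrite leq_mul2r leqnSn orbT.
apply/andP/orP => [[a b]|[/andP[a b]|/andP[a b]]].
- by case: (ltnP (affine h x) ((c + l) * w)) => d; [left; rewrite a|right].
- by split => //; apply: leq_trans b h2.
- by split => //; apply: leq_trans h1 a.
Qed.

Lemma arc0 A h c : #|hashed A (arc p w c 0) h| = 0.
Proof.
apply/eqP; rewrite cards_eq0 -subset0; apply/subsetP => x.
rewrite ![_ \in hashed _ _ _]in_set ![_ \in arc _ _ _ _]in_set addn0 => /andP[_ /andP[h1 h2]].
by have := leq_ltn_trans h1 h2; rewrite ltnn.
Qed.

Lemma cell_size A Z h c : ~~ unbalanced M w A Z h -> c < M ->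
  Z * M * #|hashed A (cell p w c) h| <= Z.+1 * #|A| /\
  Z * #|A| <= Z * M.+1 * #|hashed A (cell p w c) h| + #|A|.
Proof.
rewrite negb_exists => /forallP b cM; move: (b (Ordinal cM)) => /=; rewrite negbK => /andP[h1 h2].
set s := #|hashed _ _ _| in h1 h2 *; split; rewrite -(leq_pmul2r w0).
  apply: leq_trans (_ : Z * p * s <= _); last by rewrite -[X in _ <= X]mulnA.
  have := leq_mul (leqnn (Z * s)) Mw; rewrite mulnA (mulnAC Z s M) => /leq_trans; apply.
  by rewrite mulnAC.
rewrite mulnDl -mulnA; apply: leq_trans h2 _; rewrite leq_add2r.
have := leq_mul (leqnn (Z * s)) pMw; rewrite [X in _ <= X]mulnA (mulnAC Z s M.+1) mulnAC; exact.
Qed.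

Lemma arc_size A Z h c : ~~ unbalanced M w A Z h -> c + 5 <= M ->
  Z * M * #|hashed A (arc p w c 5) h| <= 5 * Z.+1 * #|A| /\
  5 * Z * #|A| <= Z * M.+1 * #|hashed A (arc p w c 5) h| + 5 * #|A|.
Proof.
move=> b cM; rewrite !card_arcS arc0.
have [|a0 b0] := @cell_size A Z h (c + 0) b; first by lia.
have [|a1 b1] := @cell_size A Z h (c + 1) b; first by lia.
have [|a2 b2] := @cell_size A Z h (c + 2) b; first by lia.
have [|a3 b3] := @cell_size A Z h (c + 3) b; first by lia.
have [|a4 b4] := @cell_size A Z h (c + 4) b; first by lia.
move: #|hashed A (cell p w (c + 0)) h| #|hashed A (cell p w (c + 1)) h| #|hashed A (cell p w (c + 2)) h|
 #|hashed A (cell p w (c + 3)) h| #|hashed A (cell p w (c + 4)) h| a0 b0 a1 b1 a2 b2 a3 b3 a4 b4.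
by move: #|A| => k1 s0 s1 s2 s3 s4; clear; split; lia.
Qed.

(** Freiman's lemma needs equal sizes and a sumset inside C: elements of A in uncovered pairs are
    dropped, then the larger side is cut down to the smaller. Hence the result is nearly all of only
    one of the two sets. *)
Lemma base_pair A B C : exists A' B' : {set F}, [/\ A' \subset A, B' \subset B, #|A'| = #|B'|,
  ssum A' B' \subset ssum A B :&: C &
  #|A| <= #|A'| + #|uncovered A B C| \/ #|B| <= #|A'| + #|uncovered A B C| ].
Proof.
pose A2 := A :\: [set ab.1 | ab in uncovered A B C].
have cA2 : #|A| <= #|A2| + #|uncovered A B C|.
  rewrite -(cardsID [set ab.1 | ab in uncovered A B C] A) addnC leq_add2l.
  by apply: leq_trans (subset_leq_card (subsetIr _ _)) (leq_imset_card _ _).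
have [A' [sA' cA']] := subset_card (geq_minl #|A2| #|B|).
have [B' [sB' cB']] := subset_card (geq_minr #|A2| #|B|).
have sA : A' \subset A by apply: subset_trans sA' (subsetDl _ _).
exists A', B'; split => //; first by rewrite cA' cB'.
- rewrite subsetI ssum_sub //=; apply/subsetP => x /imset2P[a b aA bB ->].
  have := subsetP sA' a aA; rewrite in_setD => /andP[+ aA2].
  apply: contraNT => nC; apply/imsetP; exists (a, b) => //.
  by rewrite inE in_setX /= aA2 (subsetP sB') // nC.
- rewrite cA'; case: (leqP #|A2| #|B|) => h; [left|right] => //.
  by apply: leq_addr.
Qed.

End ArcSizes.

Section SmallDoubling.
Variables (p n D t e q k : nat).
Hypotheses (pp : prime p) (np : 2 * n < p) (D0 : 0 < D) (tD : 100 * D <= t) (hq : q = t ^ 20)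
  (hk : q ^ 5 <= k) (ke : k < 2 ^ e) (qp : 200 * q ^ 2 <= p).
Local Notation F := ('F_p).

Let t100 : 100 <= t. Proof. by apply: leq_trans tD; rewrite leq_pmulr. Qed.
Let kk0 : t * (k - k) <= 9 * k. Proof. by rewrite subnn muln0. Qed.
Let qpos : 0 < q. Proof. exact: q0 t100 hq hk (leqnn k) kk0 erefl erefl. Qed.

Theorem small_doubling_Fp (A0 B0 : {set F}) : #|A0| = k -> #|B0| = k ->
  (forall x, x \in A0 -> (x : nat) <= n) -> (forall x, x \in B0 -> (x : nat) <= n) ->
  #|ssum A0 B0| <= t * k ->
  exists r l (A' B' : {set F}), [/\ gen r l,
    (forall f, f \in l -> (exists2 a : F, a \in A0 & f = (true, a : nat)) \/
       (exists2 b : F, b \in B0 & f = (false, b : nat))),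
    (forall a : F, a \in A' -> (true, a : nat) \in l) /\
    (forall b : F, b \in B' -> (false, b : nat) \in l),
    r * (k * D) <= (3 * D + 1) * #|ssum A' B'| &
    t ^ 4 * size l <= 11 * e * k /\ t * k <= t * #|ssum A' B'| + 10 * k].
Proof.
move=> cA0 cB0 A0n B0n S0.
pose M := 10 * q; pose Z := t ^ 5; pose w := p %/ M.
have M0 : 0 < M by rewrite muln_gt0.
(* Cells wider than their number leave a remainder shorter than one cell. *)
have wM : M < w.
  rewrite /w /M; apply: leq_trans (_ : 200 * q ^ 2 %/ (10 * q) <= _); last exact: leq_div2r.
  by rewrite (_ : 200 * q ^ 2 = 20 * q * (10 * q)) ?mulnK // ?expnS ?expn1; lia.
have w0 : 0 < w by apply: leq_ltn_trans wM.
have Mw : M * w <= p by rewrite mulnC leq_trunc_div.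
have pMw : p <= M.+1 * w.
  apply: ltnW; apply: leq_trans (ltn_ceil p M0) _; rewrite -/w.
  by rewrite [w.+1 * M]mulSn [M.+1 * w]mulSn [w * M]mulnC leq_add2r ltnW.
have p2Mw : p <= 2 * M * w.
  apply: leq_trans pMw _; rewrite leq_mul2r; apply/orP; right; lia.
(* Discarding few elements, every remaining one has mostly popular sums. *)
have [A [B [sA sB cAB hcore [popA popB]]]] := popular_core (k %/ 8) (k %/ t ^ 2) cA0 cB0.
have k100 : 100 <= k by have := big t100 hq hk (leqnn k) kk0 erefl erefl (a := 0) isT; rewrite expn0 muln1.
pose k1 := #|A|.
have cB : #|B| = k1 by [].
have k1k : k1 <= k by rewrite -cA0; exact: subset_leq_card.
have hk1 : t * (k - k1) <= 9 * k.
  apply: core_size t100 k100 k1k _; apply: leq_trans hcore _.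
  by rewrite leq_mul2l S0 orbT.
have k1h := k1_half t100 hq hk k1k hk1 (erefl M) (erefl Z).
have k8 : 2 * (k %/ 8) <= k1 by move: (leq_trunc_div k 8) k1h; move: (k %/ 8); clearbody k1; clear; lia.
set theta := k %/ t ^ 2 in popA popB hcore.
have partA a : a \in A -> k1 <= 2 * #|partners A B theta a|.
  move=> /popA h; have := cardsID (partners A B theta a) B.
  have -> : B :&: partners A B theta a = partners A B theta a.
    by apply/setIidPr/subsetP => x; rewrite inE => /andP[].
  have -> : B :\: partners A B theta a = [set b in B | rep A B (a + b)%R <= theta].
    by apply/setP => x; rewrite !inE; case: (x \in B); rewrite //= ?andbT ?andbF -?leqNgt.
  by rewrite cB; move: #|_| #|_| h => u v; move: k8; clear; lia.
have partB b : b \in B -> k1 <= 2 * #|partners B A theta b|.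
  move=> /popB h; have := cardsID (partners B A theta b) A.
  have -> : A :&: partners B A theta b = partners B A theta b.
    by apply/setIidPr/subsetP => x; rewrite inE => /andP[].
  have -> : A :\: partners B A theta b = [set a in A | rep A B (a + b)%R <= theta].
    by apply/setP => x; rewrite !inE rep_C addrC; case: (x \in A); rewrite //= ?andbT ?andbF -?leqNgt.
  by rewrite -/k1; move: #|_| #|_| h => u v; move: k8; clear; lia.
have [Zk1 ZMk1] := hash_size t100 hq hk k1k hk1 (erefl M) (erefl Z).
have Z0 : 0 < Z by rewrite expn_gt0; have := t100; lia.
pose thr := k1 %/ (20 * M).
have [hA [hB [DA [DB [hu balA balB [szA szB] [okA okB]]]]]] :=
  @good_hash p M w pp M0 w0 Mw p2Mw A B k1 Z theta thr erefl cB Z0 Zk1 ZMk1 partA partB.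
have SAB : #|ssum A B| <= t * k by apply: leq_trans S0; exact: subset_leq_card (ssum_sub sA sB).
pose d := t ^ 7 * q ^ 3.
have dA : #|DA| <= d.
  apply: (bad_size t100 hq hk k1k hk1 (erefl M) (erefl Z)).
  by apply: leq_trans szA _; rewrite leq_add2l leq_mul2l SAB orbT.
have dB : #|DB| <= d.
  apply: (bad_size t100 hq hk k1k hk1 (erefl M) (erefl Z)).
  by apply: leq_trans szB _; rewrite leq_add2l leq_mul2l SAB orbT.
pose A1 := A :\: DA; pose B1 := B :\: DB.
have sA1 : A1 \subset A by exact: subsetDl.
have sB1 : B1 \subset B by exact: subsetDl.
have cA1k : #|A1| <= k by apply: leq_trans (subset_leq_card sA1) k1k.
have cB1k : #|B1| <= k by apply: leq_trans (subset_leq_card sB1) _; rewrite cB.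
have A1n x : x \in A1 -> (x : nat) <= n by move=> /(subsetP sA1) /(subsetP sA); exact: A0n.
have B1n x : x \in B1 -> (x : nat) <= n by move=> /(subsetP sB1) /(subsetP sB); exact: B0n.
(* Every popular sum is already a sum of the sparse sets [A'], [B'], so only the few
   unpopular sums are missing from [C]. *)
have t0 : 0 < t by apply: leq_trans t100.
have tp a : 0 < t ^ a by rewrite expn_gt0 t0.
have ceil_le s : 0 < s -> k <= s * (k %/ s).+1 by move=> s0; rewrite mulnC ltnW // ltn_ceil.
have kke : k * k < 2 ^ (2 * e).
  by rewrite mul2n -addnn expnD; apply: ltn_mul.
(* The values u = t^8 and g = t^4 give both sparse sets about 2 e k / t^4 elements. A sum that
   escapes them has fewer than t^8 + t^4 <= t^9 representations. *)
have [A' [B' [sA' sB' cA' cB' cover]]] :=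
  thin_cover cA1k cB1k (tp 8) (tp 4) (ceil_le _ (tp 8)) (ceil_le _ (tp 4)) kke.
pose C := ssum A' B'; pose x := #|C|.
have H : #|uncovered A1 B1 C| <= t ^ 10 * k.
  rewrite /uncovered -(@sum_rep _ A1 B1 (fun x => x \notin C)).
  apply: leq_trans (_ : \sum_(x in ssum A1 B1) t ^ 9 <= _).
    rewrite big_mkcond [X in _ <= X]big_mkcond; apply: leq_sum => y _.
    case: ifPn => // yC; case: ifPn => [_|]; last by rewrite -rep_gt0 -eqn0Ngt => /eqP ->.
    rewrite leqNgt; apply/negP => h; move/negP: yC; apply; apply: cover.
    apply: leq_trans (ltnW h); rewrite (expnS t 8); move: (tpow t100 hq hk k1k hk1 (erefl M) (erefl Z) (a := 4) (b := 8) isT).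
    by move: t100; clear; nia.
  have hS : #|ssum A1 B1| <= t * k.
    by apply: leq_trans SAB; exact: subset_leq_card (ssum_sub sA1 sB1).
  rewrite sum_nat_const; apply: leq_trans (leq_mul hS (leqnn (t ^ 9))) _.
  have e10 : t ^ 10 = t * t ^ 9 by rewrite -expnS.
  by rewrite e10 mulnAC.
have xk : x <= t * k.
  apply: leq_trans SAB; apply: subset_leq_card; apply: ssum_sub.
    exact: subset_trans sA' sA1.
  exact: subset_trans sB' sB1.
have A1d : k1 <= #|A1| + d.
  by rewrite /k1 -(cardsID DA A) addnC leq_add2l; apply: leq_trans (subset_leq_card (subsetIr _ _)) dA.
have B1d : k1 <= #|B1| + d.
  by rewrite -cB -(cardsID DB B) addnC leq_add2l; apply: leq_trans (subset_leq_card (subsetIr _ _)) dB.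
(* By averaging, some a in A1 has few b with a + b outside C, so C contains almost a full translate
   of B1. *)
have xlow : t * k <= t * x + 10 * k.
  pose f a := #|[set b in B1 | (a + b)%R \notin C]|.
  have sumf : \sum_(a in A1) f a = #|uncovered A1 B1 C|.
    rewrite -sum1_card (eq_bigr (fun a => \sum_(b in B1 | (a + b)%R \notin C) 1)); last first.
      by move=> a _; rewrite sum1dep_card.
    by rewrite pair_big_dep /=; apply: eq_bigl => -[a b]; rewrite !inE /= andbA.
  have [a0 a0A] : exists a, a \in A1.
    apply/card_gt0P.
    have := bad_small t100 hq hk k1k hk1 (erefl M) (erefl Z); rewrite -/d => hd.
    have h2 : 2 * d <= k.
      apply: leq_trans hd; rewrite leq_mul2r; apply/orP; right.
      have := t100; have := tp 5; move: qpos (tpow t100 hq hk k1k hk1 (erefl M) (erefl Z) (a := 1) (b := 5) isT).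
      by rewrite expn1; move: (t ^ 5) => T; clear; nia.
    by move: h2 A1d k1h k100; clear; lia.
  case: (@arg_minnP _ a0 (mem A1) f a0A) => a aA mn.
  have h1 : #|A1| * f a <= t ^ 10 * k.
    by apply: leq_trans H; rewrite -sumf -sum_nat_const; apply: leq_sum => y yA; exact: mn.
  have h2 : #|B1| <= x + f a.
    rewrite -(cardsID [set b | (a + b)%R \in C] B1) leq_add //.
      set S := B1 :&: _; have -> : #|S| = #|[set (a + b)%R | b in S]| by rewrite card_imset //; exact: addrI.
      apply: subset_leq_card; apply/subsetP => y /imsetP[b bS ->].
      by move: bS; rewrite in_setI in_set => /andP[].
    by apply: subset_leq_card; apply/subsetP => y; rewrite !inE => /andP[-> ->].
  exact: (cover_lower t100 hq hk k1k hk1 (erefl M) (erefl Z) (leqnn d) A1d B1d h1 h2).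
(* On average a pair of arcs spans its proportional share of [C]; Freiman's lemma applied
   there yields the free entries, and the walk along the cells derives all the others. *)
have [i [j [iM jM]]] := base_choice pp M0 w0 Mw pMw A1 B1 C (t ^ 6) hu qpos (leqnn M).
set AI := hashed A1 (arc p w (5 * i) 5) hA; set BJ := hashed B1 (arc p w (10 * j) 5) hB => /= hbase.
set c := #|ssum AI BJ :&: C| in hbase; set H' := #|uncovered AI BJ C| in hbase.
have hc := base_sum_size t100 hq hk k1k hk1 (erefl M) (erefl Z) hbase H.
have hH' := base_uncovered_size t100 hq hk k1k hk1 (erefl M) (erefl Z) hbase H xk.
have [Ab [Bb [sAb sBb cAb sCb hmin]]] := base_pair AI BJ C.
rewrite -/H' in hmin.
pose sA0 := #|hashed A (arc p w (5 * i) 5) hA|; pose sB0 := #|hashed B (arc p w (10 * j) 5) hB|.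
have iM5 : 5 * i + 5 <= M by rewrite /M; move: iM; clear; lia.
have jM5 : 10 * j + 5 <= M by rewrite /M; move: jM; clear; lia.
have [A_hi A_lo] := arc_size pp M0 w0 Mw pMw balA iM5.
have [B_hi B_lo] := arc_size pp M0 w0 Mw pMw balB jM5.
rewrite -/sA0 -/k1 in A_hi A_lo; rewrite -/sB0 cB in B_hi B_lo.
have qA := arc_hi t100 hq hk k1k hk1 (erefl M) (erefl Z) A_hi.
have qB := arc_hi t100 hq hk k1k hk1 (erefl M) (erefl Z) B_hi.
have dAB := arc_diff t100 hq hk k1k hk1 (erefl M) (erefl Z) A_hi B_lo qB.
have dBA := arc_diff t100 hq hk k1k hk1 (erefl M) (erefl Z) B_hi A_lo qA.
have sAI : sA0 <= #|AI| + d.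
  rewrite /sA0 -(cardsID DA) addnC leq_add //; last first.
    by apply: leq_trans (subset_leq_card (subsetIr _ _)) dA.
  apply: subset_leq_card; apply/subsetP => y; rewrite in_setD ![_ \in hashed _ _ _]in_set.
  by rewrite in_setD => /andP[-> /andP[-> ->]].
have sBJ : sB0 <= #|BJ| + d.
  rewrite /sB0 -(cardsID DB) addnC leq_add //; last first.
    by apply: leq_trans (subset_leq_card (subsetIr _ _)) dB.
  apply: subset_leq_card; apply/subsetP => y; rewrite in_setD ![_ \in hashed _ _ _]in_set.
  by rewrite in_setD => /andP[-> /andP[-> ->]].
pose kap := maxn (sA0 - #|Ab|) (sB0 - #|Ab|).
have hmin' : sA0 <= #|Ab| + d + H' \/ sB0 <= #|Ab| + d + H'.
  case: hmin => h; [left; apply: leq_trans sAI _|right; apply: leq_trans sBJ _];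
    by rewrite -addnA [d + H']addnC addnA leq_add2r.
(* The base pair nearly exhausts one of the two arcs; since the hashes are balanced, the arcs have
   almost equal sizes, which bounds what is missing from the other. *)
have hkap : q * t ^ 5 * kap <= 5 * k.
  have z s : q * t ^ 5 * (s - s) <= 2 * k by rewrite subnn muln0.
  rewrite /kap; case: (leqP (sA0 - #|Ab|) (sB0 - #|Ab|)) => _; case: hmin' => h.
  - exact: (missing_size t100 hq hk k1k hk1 (erefl M) (erefl Z) (leqnn d) hH' h dBA).
  - exact: (missing_size t100 hq hk k1k hk1 (erefl M) (erefl Z) (leqnn d) hH' h (z _)).
  - exact: (missing_size t100 hq hk k1k hk1 (erefl M) (erefl Z) (leqnn d) hH' h (z _)).
  - exact: (missing_size t100 hq hk k1k hk1 (erefl M) (erefl Z) (leqnn d) hH' h dAB).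
have jlow : t * k <= 2 * t * q * #|Ab| + 10 * k.
  case: hmin' => h.
  - exact: (base_lo t100 hq hk k1k hk1 (erefl M) (erefl Z) (leqnn d) hH' A_lo qA h).
  - exact: (base_lo t100 hq hk k1k hk1 (erefl M) (erefl Z) (leqnn d) hH' B_lo qB h).
have AbA1 : Ab \subset A1.
  by apply: subset_trans sAb _; apply/subsetP => y; rewrite in_set => /andP[].
have BbB1 : Bb \subset B1.
  by apply: subset_trans sBb _; apply/subsetP => y; rewrite in_set => /andP[].
pose r := (3 * D + 1) * x %/ (k * D).
have hr := ratio_size t100 hq hk k1k hk1 (erefl M) (erefl Z) D0 tD (erefl r) xlow xk jlow hc.
have Abn y : y \in Ab -> (y : nat) <= n by move=> /(subsetP AbA1); exact: A1n.
have Bbn y : y \in Bb -> (y : nat) <= n by move=> /(subsetP BbB1); exact: B1n.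
have [r' [l0 [r'r g0 l0E u0]]] : genle r (tag (vals Ab) (vals Bb)).
  apply: contrapT => ng.
  have szBb : size (vals Bb) = #|Ab| by rewrite size_vals cAb.
  have [_] := freiman_gen (vals_sorted Ab) (vals_sorted Bb) (size_vals Ab) szBb ng.
  rewrite (size_sums_vals pp Abn Bbn np).
  have : #|ssum Ab Bb| <= c by exact: subset_leq_card.
  by move: hr; move: (r * r.-1) #|ssum Ab Bb| (2 * r * #|Ab|); clear; lia.
have missA : #|hashed A (arc p w (5 * i) 5) hA :\: Ab| <= kap.
  rewrite cardsD (setIidPr _) ?leq_maxl //.
  apply: subset_trans sAb _; apply/subsetP => y; rewrite ![_ \in hashed _ _ _]in_set.
  by case/andP => /(subsetP sA1) -> ->.
have missB : #|hashed B (arc p w (10 * j) 5) hB :\: Bb| <= kap.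
  rewrite cardsD (setIidPr _) -?cAb ?leq_maxr //.
  apply: subset_trans sBb _; apply/subsetP => y; rewrite ![_ \in hashed _ _ _]in_set.
  by case/andP => /(subsetP sB1) -> ->.
pose u := k %/ (q * t ^ 4).
pose G := k1 %/ (4 * M.+1); pose g := G - thr; pose rho := theta %/ (2 * M.+1).
have gthr : g + thr = G by rewrite subnK //; exact: thr_le t100 hq hk k1k hk1 (erefl M) (erefl Z).
have k10 : 0 < k1 by move: k1h k100; clear; lia.
have th0 : 0 < theta.
  rewrite divn_gt0 //; have := big t100 hq hk k1k hk1 (erefl M) (erefl Z) (a := 2) isT.
  by move: (t ^ 2) => T; clear; lia.
have hrho : 2 * p * rho.-1 < theta * w by exact: (floor_lt' pMw w0 th0 erefl).
have szcell (X : {set F}) h cc : #|X| = k1 -> ~~ unbalanced M w X Z h -> cc < M ->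
    5 * q * #|hashed X (cell p w cc) h| <= k1.
  move=> cX bal ccM; have [h1 _] := cell_size w0 Mw pMw bal ccM; rewrite cX in h1.
  exact: (cell_hi t100 (erefl M) (erefl Z) h1).
have derA a cc c' : a \in A1 -> affine hA a \in cell p w c' -> cc < M -> cc <= c'.+1 -> c' <= cc.+1 ->
    u + d + kap < #|derivers w A Bb hA cc a|.
  rewrite in_setD => /andP[aD aA] ac ccM h1 h2; have [np1 few] := okA a aA aD.
  have P0 : 0 < #|partners A B theta a| by have := partA a aA; move: k10; clear; lia.
  have hg : 2 * p * (g + thr).-1 < #|partners A B theta a| * w.
    by rewrite gthr; exact: (floor_lt pMw w0 P0 (partA a aA) erefl).
  have jM2 : 10 * j + 2 < M by move: jM5; clear; lia.
  have := card_derivers pp M0 w0 Mw pMw hu aA ac h1 h2 ccM jM5 np1 few missB hg hrho.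
  move=> h; apply: (derivers_size t100 hq hk k1k hk1 (erefl M) (erefl Z) h _ _ erefl erefl erefl hkap).
    exact: szcell.
  exact: szcell.
have derB b cc c' : b \in B1 -> affine hB b \in cell p w c' -> cc < M -> cc <= c'.+1 -> c' <= cc.+1 ->
    u + d + kap < #|derivers w B Ab hB cc b|.
  rewrite in_setD => /andP[bD bB] bc ccM h1 h2; have [np1 few] := okB b bB bD.
  have P0 : 0 < #|partners B A theta b| by have := partB b bB; move: k10; clear; lia.
  have hg : 2 * p * (g + thr).-1 < #|partners B A theta b| * w.
    by rewrite gthr; exact: (floor_lt pMw w0 P0 (partB b bB) erefl).
  have iM2 : 5 * i + 2 < M by move: iM5; clear; lia.
  have := card_derivers pp M0 w0 Mw pMw (esym hu) bB bc h1 h2 ccM iM5 np1 few missA hg hrho.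
  move=> h; apply: (derivers_size t100 hq hk k1k hk1 (erefl M) (erefl Z) h _ _ erefl erefl erefl hkap).
    exact: szcell.
  exact: szcell.
have upos : 0 < u.
  rewrite divn_gt0; last by rewrite muln_gt0 qpos tp.
  have := big t100 hq hk k1k hk1 (erefl M) (erefl Z) (a := 24) isT.
  have -> : t ^ 24 = q * t ^ 4 by rewrite hq -expnD.
  by move: (q * t ^ 4) => T; clear; lia.
have cov (X X1 : {set F}) h : X1 \subset X -> #|X| = k1 -> ~~ unbalanced M w X Z h ->
    forall cc, cc < M -> #|hashed X1 (cell p w cc) h| <= u * t ^ 4.
  move=> sX cX bal cc ccM; apply: (cell_cover_size t100 hq hk k1k hk1 (erefl M) (erefl Z)).
  apply: leq_trans (szcell X h cc cX bal ccM); rewrite leq_mul2l; apply/orP; right.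
  apply: subset_leq_card; apply/subsetP => y; rewrite ![_ \in hashed _ _ _]in_set.
  by case/andP => /(subsetP sX) -> ->.
have dA' : #|A :\: A1| <= d.
  apply: leq_trans dA; apply: subset_leq_card; apply/subsetP => y.
  by rewrite !in_setD negb_and negbK => /andP[/orP[//|/negP]].
have dB' : #|B :\: B1| <= d.
  apply: leq_trans dB; apply: subset_leq_card; apply/subsetP => y.
  by rewrite !in_setD negb_and negbK => /andP[/orP[//|/negP]].
have l0T a : a \in Ab -> (true, nat_of_ord a) \in l0 by move=> aAb; rewrite l0E mem_tag /= mem_vals.
have l0F b : b \in Bb -> (false, nat_of_ord b) \in l0 by move=> bBb; rewrite l0E mem_tag /= mem_vals.
have in_arc (y : F) s : y \in cell p w (s + 2) -> y \in arc p w s 5.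
  rewrite !in_set => /andP[h1 h2]; apply/andP; split.
    by apply: leq_trans h1; rewrite leq_mul2r leq_addr orbT.
  by apply: leq_trans h2 _; rewrite leq_mul2r -addnS leq_add2l orbT.
have iM2 : 5 * i + 2 < M by move: iM5; clear; lia.
have jM2 : 10 * j + 2 < M by move: jM5; clear; lia.
(* The walk starts in the middle cell of the arc: more than kap of its elements derive a, and at
   most kap of them are missing from [Ab]. *)
have hitA : hit w A1 Bb true hA l0 (5 * i + 2).
  move=> a c' aA ac h1 h2.
  have hd := derA a (5 * i + 2) c' aA ac iM2 h1 h2.
  have /subsetPn[a' a'D a'N] : ~~ (derivers w A Bb hA (5 * i + 2) a \subset
      hashed A (arc p w (5 * i) 5) hA :\: Ab).
    apply/negP => /subset_leq_card /leq_trans /(_ missA) h; have := leq_trans hd h.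
    by move: (u + d); clear; lia.
  move: a'D; rewrite in_set => /andP[a'H /existsP[b /existsP[b' /and3P[bB b'B /eqP eab]]]].
  have a'Ab : a' \in Ab.
    move: a'N; rewrite in_setD negb_and negbK => /orP[//|/negP[]].
    by move: a'H; rewrite ![_ \in hashed _ _ _]in_set => /andP[-> /in_arc ->].
  exists a', b, b'; split => //; [exact: l0T|exact: (subsetP AbA1)].
have hitB : hit w B1 Ab false hB l0 (10 * j + 2).
  move=> a c' aA ac h1 h2.
  have hd := derB a (10 * j + 2) c' aA ac jM2 h1 h2.
  have /subsetPn[a' a'D a'N] : ~~ (derivers w B Ab hB (10 * j + 2) a \subset
      hashed B (arc p w (10 * j) 5) hB :\: Bb).
    apply/negP => /subset_leq_card /leq_trans /(_ missB) h; have := leq_trans hd h.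
    by move: (u + d); clear; lia.
  move: a'D; rewrite in_set => /andP[a'H /existsP[b /existsP[b' /and3P[bB b'B /eqP eab]]]].
  have a'Ab : a' \in Bb.
    move: a'N; rewrite in_setD negb_and negbK => /orP[//|/negP[]].
    by move: a'H; rewrite ![_ \in hashed _ _ _]in_set => /andP[-> /in_arc ->].
  exists a', b, b'; split => //; [exact: l0F|exact: (subsetP BbB1)].
have e0 : 0 < e by case: (e) ke k100 => [|//]; rewrite expn0; clear; lia.
have derA1 a cc c' : a \in A1 -> affine hA a \in cell p w c' -> cc < M -> cc <= c'.+1 -> c' <= cc.+1 ->
    u + d <= #|derivers w A Bb hA cc a|.
  by move=> h1 h2 h3 h4 h5; have := derA a cc c' h1 h2 h3 h4 h5; move: (u + d); clear; lia.
have derB1 a cc c' : a \in B1 -> affine hB a \in cell p w c' -> cc < M -> cc <= c'.+1 -> c' <= cc.+1 ->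
    u + d <= #|derivers w B Ab hB cc a|.
  by move=> h1 h2 h3 h4 h5; have := derB a cc c' h1 h2 h3 h4 h5; move: (u + d); clear; lia.
(* Each walk uses only the base set of the other side as auxiliary elements, so the two walks can be
   run one after the other from the same base. *)
have [l1 [g1 sub1 sz1 el1 der1]] := walk (t := true) pp M0 w0 Mw pMw sA1 A1n Bbn np upos dA'
  (leq_ltn_trans cA1k ke) (cov A A1 hA sA1 erefl balA) derA1 g0 l0F hitA iM2.
have [l2 [g2 sub2 sz2 el2 der2]] := walk (t := false) pp M0 w0 Mw pMw sB1 B1n Abn np upos dB'
  (leq_ltn_trans cB1k ke) (cov B B1 hB sB1 cB balB) derB1 g1 (fun a h => sub1 _ (l0T a h))
  (hit_sub sub1 hitB) jM2.
pose l3 := [seq (true, nat_of_ord y) | y <- enum A'] ++ [seq (false, nat_of_ord y) | y <- enum B'] ++ l2.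
exists r', l3, A', B'; split.
- apply: gen_extend.
    apply: gen_extend g2 _ => f /mapP[y]; rewrite mem_enum => /(subsetP sB') yB -> /=.
    exact: der2.
  move=> f /mapP[y]; rewrite mem_enum => /(subsetP sA') yA -> /=.
  by apply: derivable_sub (der1 _ yA) => z /sub2 zl; rewrite mem_cat zl orbT.
- have inA y : y \in A1 -> y \in A0 by move=> /(subsetP sA1) /(subsetP sA).
  have inB y : y \in B1 -> y \in B0 by move=> /(subsetP sB1) /(subsetP sB).
  move=> f; rewrite !mem_cat => /or3P[/mapP[y]|/mapP[y]|/el2[/el1[|]|]].
  + by rewrite mem_enum => /(subsetP sA') /inA yA ->; left; exists y.
  + by rewrite mem_enum => /(subsetP sB') /inB yA ->; right; exists y.
  + rewrite l0E mem_tag; case: f => -[] v /=.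
      rewrite mem_sort => /mapP[y]; rewrite mem_enum => /(subsetP AbA1) /inA yA ->.
      by left; exists y.
    rewrite mem_sort => /mapP[y]; rewrite mem_enum => /(subsetP BbB1) /inB yA ->.
    by right; exists y.
  + by case=> y /inA yA ->; left; exists y.
  + by case=> y /inB yA ->; right; exists y.
- split=> y yA; rewrite !mem_cat; apply/or3P.
    by apply: Or31; apply/mapP; exists y; rewrite ?mem_enum.
  by apply: Or32; apply/mapP; exists y; rewrite ?mem_enum.
- apply: leq_trans (leq_mul r'r (leqnn _)) _; exact: leq_trunc_div.
- split; last exact: xlow.
  have szl0 : size l0 <= 2 * #|Ab|.
    have -> : 2 * #|Ab| = size (tag (vals Ab) (vals Bb)).
      by rewrite size_cat !size_map !size_sort !size_map -!cardE -cAb mul2n addnn.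
    by apply: uniq_leq_size => // f; rewrite l0E.
  have qAb : q * #|Ab| <= k.
    apply: leq_trans (_ : q * sA0 <= _); last by apply: leq_trans qA k1k.
    rewrite leq_mul2l; apply/orP; right; apply: subset_leq_card; apply: subset_trans sAb _.
    apply/subsetP => y; rewrite ![_ \in hashed _ _ _]in_set.
    by case/andP => /(subsetP sA1) -> ->.
  apply: leq_trans (total_size t100 hq hk k1k hk1 (erefl M) (erefl Z) e0 qAb
    (thin_size t100 hq hk k1k hk1 (erefl M) (erefl Z) cA')
    (thin_size' t100 hq hk k1k hk1 (erefl M) (erefl Z) cB')).
  rewrite leq_mul2l; apply/orP; right; rewrite !size_cat !size_map -!cardE.
  move: sz1 sz2 szl0; move: (2 * M * (t ^ 4 * e)) (size l0) (size l1) (size l2) #|Ab| #|A'| #|B'|.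
  by clear; lia.
Qed.
End SmallDoubling.

(** * Codes of arbitrary pairs *)

Definition side (t : bool) (l : seq tagged) := [seq e.2 | e <- l & e.1 == t].
Definition spread (l : seq tagged) := size (sums (side true l) (side false l)).

Lemma mem_side t l v : (v \in side t l) = ((t, v) \in l).
Proof.
apply/mapP/idP => [[[t' v']]|h]; first by rewrite mem_filter /= => /andP[/eqP -> h] ->.
by exists (t, v); rewrite ?mem_filter /= ?eqxx.
Qed.

Lemma leq_size_sums A B A' B' : {subset A <= A'} -> {subset B <= B'} ->
  size (sums A B) <= size (sums A' B').
Proof.
move=> hA hB; apply: uniq_leq_size; first exact: undup_uniq.
move=> s /mem_sums[x [y [xA yB ->]]]; apply/mem_sums; exists x, y.
by split; [exact: hA|exact: hB|].
Qed.

(* [2 + 2 E ^ 3] bounds the number of choices for one step of a code of length [E] *)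
Definition encodable (D k : nat) (l : seq tagged) (r : nat) := [/\ gen r l,
  r * (k * D) <= (3 * D + 1) * spread l,
  (2 + 2 * size l ^ 3) ^ (D * size l) <= 2 ^ spread l & k <= 2 * spread l].

Lemma cube_exp e E : E < 2 ^ e -> 2 + 2 * E ^ 3 <= 2 ^ (3 * e + 2).
Proof.
move=> h; rewrite expnD mulnC [3 * e]mulnC expnM.
have : E ^ 3 < (2 ^ e) ^ 3 by rewrite ltn_exp2r.
by move: (E ^ 3) ((2 ^ e) ^ 3) => u v; rewrite -[2 ^ 2]/4; lia.
Qed.

Lemma code_cost D E e x : E < 2 ^ e -> (3 * e + 2) * (D * E) <= x ->
  (2 + 2 * E ^ 3) ^ (D * E) <= 2 ^ x.
Proof.
move=> /cube_exp h hx; apply: leq_trans (leq_exp2r_weak _ h) _.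
by rewrite -expnM leq_exp2l.
Qed.

(** All 2 k elements can be listed, at a cost of order D e k, because L > t k. The first bound of
    [freiman_gen] allows r = 2 L / k rounded down, so the ratio here is 2 rather than 3. *)
Lemma large_spread D t e k (A B : seq nat) : 0 < D -> 0 < e -> 0 < k -> 16 * D * e <= t ->
  2 * k < 2 ^ e -> uniq A -> uniq B -> size A = k -> size B = k -> t * k < size (sums A B) ->
  exists r l, {subset l <= tag A B} /\ encodable D k l r.
Proof.
move=> D0 e0 k0 te ke uA uB sA sB hL; set L := size (sums A B) in hL.
pose A' := sort geq A; pose B' := sort geq B.
have sumsE : size (sums A' B') = L.
  by apply/eqP; rewrite eqn_leq !leq_size_sums // => x; rewrite ?mem_sort.
have tagE : tag A' B' =i tag A B by move=> f; rewrite !mem_tag !mem_sort.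
have srt X : uniq X -> sorted gtn (sort geq X).
  by move=> u; rewrite gtn_sorted_uniq_geq sort_uniq u sort_sorted // => x y /=; rewrite leq_total.
pose r := 2 * L %/ k.
have [r' [l [r'r g lE u]]] : genle r (tag A' B').
  apply: contrapT => ng.
  have := freiman_gen (srt A uA) (srt B uB) _ _ ng; rewrite !size_sort => /(_ k sA sB) [+ _].
  rewrite -/A' -/B' sumsE mulnC leqNgt => /negP; apply; exact: ltn_ceil.
have spr : spread l = L.
  rewrite /spread -sumsE; apply/eqP; rewrite eqn_leq !leq_size_sums // => x;
    by rewrite mem_side lE mem_tag.
have szl : size l <= 2 * k.
  have -> : 2 * k = size (tag A' B').
    by rewrite size_cat !size_map !size_sort sA sB mul2n addnn.
  by apply: uniq_leq_size => // f; rewrite lE.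
exists r', l; split; first by move=> f; rewrite lE tagE.
split; rewrite ?spr //.
- apply: leq_trans (leq_mul r'r (leqnn _)) _.
  have := leq_trunc_div (2 * L) k; rewrite -/r mulnA => h.
  by apply: leq_trans (leq_mul h (leqnn D)) _; rewrite mulnDl; lia.
- apply: (@code_cost D (size l) e); first exact: leq_ltn_trans szl ke.
  apply: leq_trans (ltnW hL).
  apply: leq_trans (_ : (3 * e + 2) * (D * (2 * k)) <= _).
    by rewrite !leq_mul2l szl !orbT.
  apply: leq_trans (_ : 16 * D * e * k <= _); last by rewrite leq_mul2r te orbT.
  by have : D * k <= D * k * e; [rewrite leq_pmulr|lia].
- by apply: leq_trans (_ : t * k <= _); [rewrite leq_pmull //; nia|lia].
Qed.

Lemma small_spread D t e k (A B : seq nat) : 0 < D -> 0 < e -> 100 * D <= t -> 16 * D * e <= t ->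
  (t ^ 20) ^ 5 <= k -> k < 2 ^ e -> uniq A -> uniq B -> size A = k -> size B = k ->
  size (sums A B) <= t * k -> exists r l, {subset l <= tag A B} /\ encodable D k l r.
Proof.
move=> D0 e0 tD te hk ke uA uB sA sB hL.
pose n := \max_(x <- A ++ B) x; pose q := t ^ 20.
(* Beyond 2 n, sums do not wrap, so relations modulo p between the elements are relations between
   integers; beyond 200 q^2, cells are wider than their number. *)
have [p pbig pp] := prime_above (maxn (2 * n) (200 * q ^ 2)).
move: pbig; rewrite gtn_max => /andP[np /ltnW qp].
have hn v : v \in A ++ B -> v <= n by move=> vA; exact: leq_bigmax_seq.
have val_of v : v \in A ++ B -> ((v%:R : 'F_p)%R : nat) = v.
  move=> /hn vn; rewrite val_Fp_nat // modn_small //; apply: leq_ltn_trans np.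
  by rewrite mul2n -addnn; apply: leq_trans (leq_addr _ _).
pose lift (X : seq nat) : {set 'F_p} := [set x : 'F_p | (x : nat) \in X].
have liftE (X : seq nat) : {subset X <= A ++ B} -> vals (lift X) =i X.
  move=> sX v; apply/idP/idP => [|vX].
    by rewrite mem_sort => /mapP[x]; rewrite mem_enum inE => h ->.
  by rewrite -(val_of v (sX _ vX)) mem_vals inE val_of // sX.
have subA : {subset A <= A ++ B} by move=> v vA; rewrite mem_cat vA.
have subB : {subset B <= A ++ B} by move=> v vA; rewrite mem_cat vA orbT.
have card_lift (X : seq nat) : {subset X <= A ++ B} -> uniq X -> #|lift X| = size X.
  by move=> sX uX; rewrite -size_vals; apply/perm_size/uniq_perm; rewrite ?vals_uniq // ; exact: liftE.
have An x : x \in lift A -> (x : nat) <= n by rewrite inE => /subA; exact: hn.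
have Bn x : x \in lift B -> (x : nat) <= n by rewrite inE => /subB; exact: hn.
have S0 : #|ssum (lift A) (lift B)| <= t * k.
  rewrite -(size_sums_vals pp An Bn np); apply: leq_trans hL.
  by apply: leq_size_sums => v; rewrite liftE.
have cA : #|lift A| = k by rewrite card_lift.
have cB : #|lift B| = k by rewrite card_lift.
have [r [l [A' [B' [g el [inA inB] hr [sz low]]]]]] :=
  small_doubling_Fp pp np D0 tD (erefl q) hk ke qp cA cB An Bn S0.
set x := #|ssum A' B'| in hr low.
have A'n y : y \in A' -> (y : nat) <= n.
  by move=> /inA /el[[a aA [->]]|[b bB []]] //; exact: An.
have B'n y : y \in B' -> (y : nat) <= n.
  by move=> /inB /el[[a aA []]|[b bB [->]]] //; exact: Bn.
have xs : x <= spread l.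
  rewrite /x -(size_sums_vals pp A'n B'n np); apply: leq_size_sums => v;
    rewrite mem_sort => /mapP[y]; rewrite mem_enum => yA ->; rewrite mem_side; [exact: inA|exact: inB].
have t100 : 100 <= t by apply: leq_trans tD; rewrite leq_pmulr.
have kx : k <= 2 * x by move: low t100; clear; nia.
have t4 : t ^ 4 = t * t * (t * t) by rewrite !expnS expn0 muln1 mulnA.
have k0 : 0 < k by apply: leq_trans hk; rewrite !expn_gt0; lia.
exists r, l; split.
  move=> f /el[[a aA ->]|[b bB ->]]; rewrite mem_tag /=; [move: aA|move: bB]; by rewrite inE.
have tt0 : 0 < t * t by rewrite muln_gt0; lia.
have et : 16 * e <= t by apply: leq_trans te; rewrite -mulnA leq_mul2l leq_pmull.
have De : 16 * (D * e) <= t by rewrite mulnA.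
have szk : size l <= k.
  rewrite -(leq_pmul2l tt0) -(leq_pmul2l tt0) mulnA -t4; apply: leq_trans sz _.
  rewrite mulnA -t4 leq_mul2r; apply/orP; right; rewrite t4.
  apply: leq_trans (_ : t <= _); first by move: et; clear; lia.
  by rewrite -mulnA leq_pmulr // !muln_gt0; move: t100; clear; lia.
split => //.
- by apply: leq_trans hr _; rewrite leq_mul2l xs orbT.
- apply: (@code_cost D (size l) e); first exact: leq_ltn_trans szk ke.
  apply: leq_trans xs; rewrite -(leq_pmul2l tt0) -(leq_pmul2l tt0).
  have h1 : (3 * e + 2) * (D * size l) <= 5 * (D * e) * size l by move: e0; clear; nia.
  apply: leq_trans (_ : t * t * (t * t * (5 * (D * e) * size l)) <= _).
    by rewrite !leq_mul2l h1 !orbT.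
  have -> : t * t * (t * t * (5 * (D * e) * size l)) = 5 * (D * e) * (t ^ 4 * size l) by rewrite t4; lia.
  apply: leq_trans (_ : 5 * (D * e) * (11 * e * k) <= _); first by rewrite leq_mul2l sz orbT.
  apply: leq_trans (_ : 110 * (D * e) * e * x <= _).
    have -> : 110 * (D * e) * e * x = 5 * (D * e) * (11 * e * (2 * x)) by lia.
    by rewrite !leq_mul2l kx !orbT.
  rewrite [X in _ <= X]mulnA leq_mul2r; apply/orP; right.
  have et' : e <= t by move: et; clear; lia.
  have h2 : 110 * (D * e) <= t * t by move: De t100; move: (D * e) => z; clear; nia.
  by apply: leq_mul => //; apply: leq_trans et' _; rewrite leq_pmulr //; move: t100; clear; lia.
- by apply: leq_trans kx _; rewrite leq_mul2l xs orbT.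
Qed.

Lemma sq_le_exp2 n : 4 <= n -> n * n <= 2 ^ n.
Proof.
elim: n => [//|n IH]; rewrite leq_eqVlt => /orP[/eqP <- //|hn].
have := IH hn; rewrite expnS; nia.
Qed.

Theorem encoding D : 0 < D -> exists k0, forall k, k0 <= k -> forall A B : seq nat,
  uniq A -> uniq B -> size A = k -> size B = k ->
  exists r l, {subset l <= tag A B} /\ encodable D k l r.
Proof.
(* With s the binary logarithm of t rounded down, e below is at most 102 s, so 16 D e <= c s <= s^2
   <= 2^s <= t as soon as 2 c <= s. *)
move=> D0; pose c := 16 * D * 102; pose t0 := maxn (100 * D) (2 ^ (2 * c)).
exists (t0 ^ 100) => k hk A B uA uB sA sB.
have ex0 : exists t, t ^ 100 <= k by exists 0; rewrite exp0n.
have bnd t : t ^ 100 <= k -> t <= k.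
  case: t => [//|t]; apply: leq_trans; rewrite -{1}[t.+1]expn1; exact: leq_pexp2l.
case: (ex_maxnP ex0 bnd) => t tk tmax.
have tt0 : t0 <= t by exact: tmax.
have k_lt : k < t.+1 ^ 100 by rewrite ltnNge; apply/negP => /tmax; rewrite ltnn.
have tD : 100 * D <= t by apply: leq_trans tt0; exact: leq_maxl.
have tc : 2 ^ (2 * c) <= t by apply: leq_trans tt0; exact: leq_maxr.
have t1 : 0 < t by apply: leq_trans tc; rewrite expn_gt0.
pose s := trunc_log 2 t.
have /andP[s1 s2] : 2 ^ s <= t < 2 ^ s.+1 by exact: trunc_log_bounds.
have sc : 2 * c <= s by rewrite -ltnS -(ltn_exp2l _ _ (isT : 1 < 2)); exact: leq_ltn_trans s2.
pose e := (s.+1 * 100).+1.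
have ke : 2 * k < 2 ^ e.
  rewrite expnS ltn_pmul2l // expnM; apply: leq_trans k_lt _; exact: leq_exp2r_weak.
have ke' : k < 2 ^ e by apply: leq_ltn_trans ke; rewrite leq_pmull.
have te : 16 * D * e <= t.
  apply: leq_trans s1; have c51 : 51 <= s.
    by apply: leq_trans sc; rewrite /c; move: D0; clear; lia.
  apply: leq_trans (sq_le_exp2 (leq_trans (isT : 4 <= 51) c51)).
  apply: leq_trans (_ : c * s <= _).
    by rewrite /c -[leqRHS]mulnA leq_mul2l /e; apply/orP; right; move: c51; clear; lia.
  by rewrite leq_mul2r; apply/orP; right; apply: leq_trans sc; rewrite leq_pmull.
have k0 : 0 < k by apply: leq_trans tk; rewrite expn_gt0 t1.
case: (leqP (size (sums A B)) (t * k)) => hL.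
  by apply: (@small_spread D t e) => //; rewrite -expnM.
exact: (@large_spread D t e).
Qed.

(** * Sets avoiding all codes *)

(** Each factor (m - i) / (n - i) is at most m / n. The quotient of falling factorials is the
    probability that a random m-subset contains L given points. *)
Lemma ffact_ratio n m L : m <= n -> m ^_ L * n ^ L <= n ^_ L * m ^ L.
Proof.
move=> mn; elim: L => [//|L IH].
rewrite !ffactnSr !expnSr mulnACA [leqRHS]mulnACA; apply: leq_mul => //.
by rewrite !mulnBl mulnC leq_sub2l // leq_mul2l mn orbT.
Qed.

Lemma card_supersets (T : finType) (C : {set T}) m : m <= #|T| ->
  #|[set S : {set T} | C \subset S & #|S| == m]| * #|T| ^ #|C| <= 'C(#|T|, m) * m ^ #|C|.
Proof.
move=> mT; set n := #|T|; set L := #|C|; set X := [set S | _ & _].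
have Ln : L <= n by exact: max_card.
have [Lm|mL] := leqP L m; last first.
  rewrite (_ : X = set0) ?cards0 //; apply/setP => S; rewrite !inE; apply/negbTE/negP.
  by case/andP => /subset_leq_card h /eqP sm; move: h; rewrite sm leqNgt mL.
have hX : #|X| <= 'C(n - L, m - L).
  have -> : n - L = #|~: C| by rewrite cardsCs setCK.
  rewrite -cards_draws.
  have inj : {in X &, injective (fun S : {set T} => S :\: C)}.
    move=> S S'; rewrite !inE => /andP[CS _] /andP[CS' _] e.
    by rewrite -(setID S C) e -{2}(setID S' C) (setIidPr CS) (setIidPr CS').
  rewrite -(card_in_imset inj); apply: subset_leq_card; apply/subsetP => _ /imsetP[S hS ->].
  by move: hS; rewrite !inE => /andP[CS /eqP sm]; rewrite subsetDr cardsDS // sm eqxx.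
have bin_eq : 'C(n - L, m - L) * n ^_ L = 'C(n, m) * m ^_ L.
  apply/eqP; rewrite -(eqn_pmul2r (_ : 0 < (m - L)`! * (n - m)`!)) ?muln_gt0 ?fact_gt0 //.
  have nm : n - m = n - L - (m - L) by rewrite subnBA // subnK.
  apply/eqP; transitivity n`!.
    by rewrite mulnAC nm bin_fact ?leq_sub2r // mulnC ffact_fact.
  by rewrite -mulnA [m ^_ L * _]mulnA ffact_fact // bin_fact.
rewrite -(leq_pmul2l (_ : 0 < n ^_ L)) ?ffact_gt0 //.
apply: leq_trans (_ : 'C(n, m) * (m ^_ L * n ^ L) <= _); last first.
  by rewrite [leqRHS]mulnCA leq_mul2l ffact_ratio ?orbT.
by rewrite [leqRHS]mulnA -bin_eq [leqRHS]mulnAC [leqRHS]mulnC leq_mul2l leq_mul2r hX !orbT.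
Qed.

Lemma exists_avoiding (R : realFieldType) (T : finType) m (F : seq {set T}) :
  0 < #|T| -> m <= #|T| -> (\sum_(C <- F) (m%:R / #|T|%:R : R) ^+ #|C| < 1)%R ->
  exists S : {set T}, #|S| = m /\ forall C, C \in F -> ~~ (C \subset S).
Proof.
move=> T0 mT sF; set n := #|T| in T0 mT sF *; pose X := [set S : {set T} | #|S| == m].
have cX : #|X| = 'C(n, m) by rewrite card_draws.
have X0 : 0 < #|X| by rewrite cX bin_gt0.
have n0 : (0 < n%:R :> R)%R by rewrite ltr0n.
pose bad (C : {set T}) := [set S : {set T} | C \subset S & #|S| == m].
have hbad (C : {set T}) : (#|bad C|%:R <= #|X|%:R * (m%:R / n%:R : R) ^+ #|C|)%R.
  rewrite expr_div_n mulrA ler_pdivlMr ?exprn_gt0 // cX -!natrX -!natrM ler_nat.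
  exact: card_supersets.
suff [S SX hS] : exists2 S, S \in X & forall C, C \in F -> S \notin bad C.
  exists S; split; first by move: SX; rewrite inE => /eqP.
  by move=> C /hS; rewrite !inE; move: SX; rewrite inE => ->; rewrite andbT.
apply: contrapT => nS.
have cover : #|X| <= \sum_(C <- F) #|bad C|.
  have sub : X \subset [set S | has (fun C => S \in bad C) F].
    apply/subsetP => S SX; rewrite inE; apply: contrapT => h; apply: nS; exists S => // C CF.
    by apply/negP => SC; apply/h/hasP; exists C.
  apply: leq_trans (subset_leq_card sub) _; elim: (F) => [|C s IH].
    by rewrite big_nil leqn0 cards_eq0; apply/eqP/setP => S; rewrite !inE.
  rewrite big_cons; apply: leq_trans (leq_add (leqnn #|bad C|) IH).
  apply: leq_trans (leq_card_setU _ _); apply: subset_leq_card; apply/subsetP => S.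
  by rewrite inE /= => /orP[h|h]; apply/setUP; [left|right; rewrite inE].
have : (#|X|%:R <= #|X|%:R * \sum_(C <- F) (m%:R / n%:R : R) ^+ #|C|)%R.
  apply: le_trans (_ : (\sum_(C <- F) #|bad C|%:R <= _)%R); first by rewrite -natr_sum ler_nat.
  by rewrite mulr_sumr; apply: ler_sum => C _; exact: hbad.
by rewrite -ler_pdivrMl ?ltr0n // mulVf ?pnatr_eq0 -?lt0n // leNgt sF.
Qed.

(** * Enumeration of codes and the union bound over them *)

Section Codes.
Variable n : nat.

Definition both (s : seq nat) : seq tagged := [seq (b, v) | b <- [:: true; false], v <- s].

Definition derived (s : seq nat) : seq nat :=
  [seq p.1 + p.2 - y | p <- [seq (x, z) | x <- s, z <- s], y <- s].

(** An enumeration with excess: truncated differences also contribute 0 where x + z < y, and derived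
    values are not confined to [n]. Only an upper bound on the number of codes is wanted. *)
Fixpoint codes r E : seq (seq tagged) :=
  if E is E'.+1 then
    (if r is r'.+1 then [seq e :: l | l <- codes r' E', e <- both (iota 1 n)] else [::])
    ++ [seq e :: l | l <- codes r E', e <- both (derived [seq e.2 | e <- l])]
  else if r is 0 then [:: [::]] else [::].

Lemma mem_both s e : (e \in both s) = (e.2 \in s).
Proof.
by case: e => -[] v; rewrite /both /= cats0 mem_cat !mem_map //=; try (by move=> ? ? []); 
  case: mapP => [[? _ []]//|_]; rewrite ?orbF.
Qed.

Lemma mem_codes r l : gen r l -> all (fun e => 0 < e.2 <= n) l -> l \in codes r (size l).
Proof.
elim=> {r l} [//|r l [b v] g IH|r l [b v] g IH [x [y [z [hx hy hz /= e]]]]] /= /andP[vn al].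
  rewrite mem_cat; apply/orP; left; apply/allpairsPdep; exists l, (b, v).
  by rewrite IH // mem_both mem_iota add1n ltnS.
rewrite mem_cat; apply/orP; right; apply/allpairsPdep; exists l, (b, v).
rewrite IH // mem_both; split=> //; apply/allpairsP; exists ((x, z), y); split=> //=.
  by apply/allpairsP; exists (x, z).
by rewrite -e addnK.
Qed.

Lemma size_codes_mem r E l : l \in codes r E -> size l = E.
Proof.
elim: E r l => [|E IH] [|r] l //=; rewrite ?inE; first by move/eqP => ->.
  by move=> /allpairsPdep[l' [e [/IH h _ ->]]] /=; rewrite h.
by rewrite mem_cat => /orP[] /allpairsPdep[l' [e [/IH h _ ->]]] /=; rewrite h.
Qed.

Lemma size_codes r E E0 : E <= E0 -> size (codes r E) <= n ^ r * (2 + 2 * E0 ^ 3) ^ E.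
Proof.
elim: E r => [|E IH] r hE; first by case: r => [|r] //; rewrite !expn0.
have derE : size [seq e :: l | l <- codes r E, e <- both (derived [seq e.2 | e <- l])]
    <= size (codes r E) * (2 * E0 ^ 3).
  rewrite size_allpairs_dep sumnE big_map.
  apply: leq_trans (_ : \sum_(l <- codes r E) 2 * E0 ^ 3 <= _).
    rewrite big_seq [leqRHS]big_seq; apply: leq_sum => l lE.
    rewrite /both size_allpairs /= leq_mul2l /derived !size_allpairs size_map.
    by rewrite (size_codes_mem lE) !expnS expn0 muln1 mulnA !leq_mul ?(ltnW hE).
  by rewrite big_const_seq count_predT iter_addn_0 mulnC.
have IH' := leq_mul (IH r (ltnW hE)) (leqnn (2 * E0 ^ 3)).
rewrite /= size_cat [_ ^ E.+1]expnSr mulnA mulnDr.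
apply: leq_add; last exact: leq_trans derE IH'.
case: r {derE IH'} => [|r]; first by [].
rewrite size_allpairs_dep sumnE big_map.
have -> : \sum_(l <- codes r E) size (both (iota 1 n)) = size (codes r E) * (2 * n).
  by rewrite big_const_seq count_predT iter_addn_0 /both size_allpairs size_iota [RHS]mulnC.
apply: leq_trans (leq_mul (IH r (ltnW hE)) (leqnn _)) _.
by rewrite [n ^ r.+1]expnS; move: (n ^ r) (_ ^ E) => u v; clear; lia.
Qed.

End Codes.

Lemma gen_size r l : gen r l -> r <= size l.
Proof. by elim=> // {}r {}l e _ /leqW. Qed.

Lemma hitting_codes (R : realFieldType) D k n m K (eps : R) : 0 < n -> m <= n -> (0 <= eps)%R ->
  (forall l r, encodable D k l r ->
    (n ^ r * (2 + 2 * size l ^ 3) ^ size l)%:R * (m%:R / n%:R) ^+ spread l <= eps)%R ->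
  ((K.+1 ^ 2)%:R * eps < 1)%R ->
  exists S : {set 'I_n}, #|S| = m /\ forall l r, encodable D k l r -> size l <= K ->
    all (fun e => 0 < e.2 <= n) l ->
    exists2 s, s \in sums (side true l) (side false l) & forall i : 'I_n, i \in S -> i.+1 <> s.
Proof.
move=> n0 mn eps0 heps hK; set q := (m%:R / n%:R : R)%R in heps.
have q0 : (0 <= q)%R by rewrite divr_ge0 // ler0n.
pose ss (l : seq tagged) := sums (side true l) (side false l).
pose X (l : seq tagged) := [set i : 'I_n | i.+1 \in ss l].
(* The index i stands for the integer [i.+1]. Codes with all sums in [n] determine exactly
   [spread l] points; any other code has a sum outside S whatever S is. *)
pose ok r (l : seq tagged) := `[<encodable D k l r>] && all (fun v => 0 < v <= n) (ss l).
pose F := [seq X l | p <- [seq (r, E) | r <- iota 0 K.+1, E <- iota 0 K.+1],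
                     l <- [seq l <- codes n p.1 p.2 | ok p.1 l]].
have cX r l : ok r l -> #|X l| = spread l.
  case/andP => _ /allP al; rewrite /spread -/(ss l) cardE -(size_map (fun i : 'I_n => i.+1)).
  apply/perm_size/uniq_perm; rewrite ?undup_uniq //.
    by rewrite map_inj_uniq ?enum_uniq // => i j [] /val_inj.
  move=> v; apply/mapP/idP => [[i]|vl]; first by rewrite mem_enum inE => h ->.
  have /andP[v0 vn] := al _ vl; have vi : v.-1 < n by rewrite prednK.
  by exists (Ordinal vi); rewrite ?mem_enum ?inE /= prednK.
have [S [cS hS]] : exists S : {set 'I_n}, #|S| = m /\ forall C, C \in F -> ~~ (C \subset S).
  apply: (@exists_avoiding R); rewrite ?card_ord // -/q.
  apply: le_lt_trans hK; rewrite big_allpairs_dep.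
  apply: le_trans (_ : (\sum_(p <- [seq (r, E) | r <- iota 0 K.+1, E <- iota 0 K.+1]) eps <= _)%R).
    apply: ler_sum => -[r E] _ /=.
    set M := n ^ r * (2 + 2 * E ^ 3) ^ E.
    have M0 : (0 < M%:R :> R)%R by rewrite ltr0n muln_gt0 !expn_gt0 n0.
    rewrite big_filter; apply: le_trans (_ : (\sum_(l <- codes n r E) eps / M%:R <= _)%R).
      rewrite big_mkcond big_seq [leRHS]big_seq; apply: ler_sum => l lE.
      case: ifP => [okl|_]; last by rewrite divr_ge0 ?ler0n.
      rewrite (cX r) // ler_pdivlMr // mulrC.
      by case/andP: okl => /asboolP /heps; rewrite (size_codes_mem lE).
    rewrite big_const_seq count_predT iter_addr_0 -mulrnAr -[leRHS]mulr1 ler_wpM2l //.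
    by rewrite -mulr_natl ler_pdivrMr // mul1r ler_nat size_codes.
  by rewrite big_const_seq count_predT iter_addr_0 size_allpairs !size_iota mulnn mulr_natl.
exists S; split=> // l r enc sl al; apply: contrapT => ns.
have gl : gen r l by case: enc.
have sub s : s \in ss l -> exists2 i : 'I_n, i \in S & i.+1 = s.
  move=> sl'; apply: contrapT => h; apply: ns; exists s => // i iS e; apply: h; by exists i.
have okl : ok r l.
  apply/andP; split; first exact/asboolP.
  by apply/allP => v /sub[i _ <-]; rewrite /= ltn_ord.
have : X l \in F.
  apply/allpairsPdep; exists (r, size l), l; split=> //; last first.
    by rewrite mem_filter okl /= mem_codes.
  apply/allpairsP; exists (r, size l); split=> //; rewrite mem_iota add0n /= ltnS //.
  exact: leq_trans (gen_size gl) sl.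
move=> /hS /negP; apply; apply/subsetP => i; rewrite inE => /sub[j jS [e]].
by rewrite (_ : i = j) //; apply: val_inj.
Qed.

(** * Real estimates *)

Local Open Scope classical_set_scope.
Local Open Scope ring_scope.

(** In logarithms: N = log n, l = log (1 / delta), a = 1 / D, x is the spread, y the cost of derived
    entries and rho = log (m / n). Since r N is at most (3 + a) x l / (3 + g), a positive multiple
    of x l g is left, which outweighs the errors 2 a x because 32 a <= l g. Finally x >= k / 2 turns
    x l into a multiple of N. *)
Lemma exponent_bound (F : realFieldType) (g l N a x k r y rho : F) :
  0 <= g <= 1 -> 0 <= N -> 0 <= r -> 0 <= x -> 0 <= l -> 0 < k ->
  a <= g / 2 -> 32 * a <= l * g -> (3 + g) * N <= k * l ->
  r * k <= (3 + a) * x -> y <= a * x -> k <= 2 * x -> rho <= - l + a ->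
  r * N + y + x * rho <= - (g / 16 * N).
Proof.
move=> /andP[g0 g1] N0 r0 x0 l0 k0 a1 a2 hN hr hy hk hrho.
have g3 : 0 < 3 + g by lra.
have rN : r * N * (3 + g) <= (3 + a) * x * l.
  rewrite -(ler_pM2r k0); apply: le_trans (_ : r * k * (k * l) <= _).
    have -> : r * N * (3 + g) * k = r * k * ((3 + g) * N) by ring.
    by rewrite ler_wpM2l // mulr_ge0 // ltW.
  have -> : (3 + a) * x * l * k = (3 + a) * x * (k * l) by ring.
  by rewrite ler_wpM2r // mulr_ge0 // ltW.
have xr : x * rho <= x * (- l + a) by rewrite ler_wpM2l.
have main : (3 + g) * (r * N + y + x * rho) <= - (x * (l * g / 4)).
  have yx : (3 + g) * (y + x * rho) <= (3 + g) * (a * x + x * (- l + a)).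
    by rewrite ler_wpM2l ?(ltW g3) // lerD.
  have xa : x * l * a <= x * l * (g / 2) by rewrite ler_wpM2l // mulr_ge0.
  have xa' : x * (32 * a) <= x * (l * g) by rewrite ler_wpM2l.
  have xg : g * (x * (32 * a)) <= g * (x * (l * g)) by rewrite ler_wpM2l.
  have xlg : g * (x * (l * g)) <= 1 * (x * (l * g)).
    by rewrite ler_wpM2r // !mulr_ge0.
  nra.
rewrite -(ler_pM2l g3); apply: le_trans main _.
have : g * ((3 + g) * N) <= g * (2 * x * l).
  by rewrite ler_wpM2l //; apply: le_trans hN _; rewrite ler_wpM2r.
have : 0 <= x * (l * g) by rewrite !mulr_ge0.
lra.
Qed.

Section Weight.
Variable R : realType.

Lemma exprn_ln (x : R) n : 0 < x -> x ^+ n = expR (n%:R * ln x).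
Proof. by move=> x0; rewrite expRM_natl lnK. Qed.

Lemma ln2_le1 : ln (2 : R) <= 1.
Proof. by have -> : (2 : R) = 1 + 1 by []; apply: le_ln1Dx; lra. Qed.

Lemma code_weight D k n m l r (g lam : R) : (0 < D)%N -> (0 < k)%N -> (0 < n)%N -> (0 < m)%N ->
  0 <= g <= 1 -> 0 <= lam -> 2 <= g * D%:R -> 32 <= lam * g * D%:R ->
  (3 + g) * ln n%:R <= k%:R * lam -> ln (m%:R / n%:R : R) <= - lam + D%:R^-1 ->
  encodable D k l r ->
  (n ^ r * (2 + 2 * size l ^ 3) ^ size l)%:R * (m%:R / n%:R) ^+ spread l
    <= expR (- (g / 16 * ln n%:R)).
Proof.
move=> D0 k0 n0 m0 g01 lam0 gD lD hk hq [_ hr hW hL].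
set W := (2 + 2 * size l ^ 3)%N in hW *; set q := m%:R / n%:R in hq *.
have W0 : 0 < W%:R :> R by rewrite ltr0n /W.
have n0' : 0 < n%:R :> R by rewrite ltr0n.
have D0' : 0 < D%:R :> R by rewrite ltr0n.
have k0' : 0 < k%:R :> R by rewrite ltr0n.
have q0 : 0 < q by rewrite divr_gt0 // ltr0n.
rewrite natrM !natrX !exprn_ln // -!expRD ler_expR.
have DV : D%:R * D%:R^-1 = 1 :> R by rewrite mulfV // gt_eqF.
apply: (@exponent_bound _ g lam _ D%:R^-1 _ k%:R) => //.
- by apply: ln_ge0; rewrite ler1n.
- by rewrite -[D%:R^-1]mul1r ler_pdivrMr //; lra.
- by rewrite ler_pdivrMr.
- rewrite -(ler_pM2l D0') mulrA [D%:R * r%:R]mulrC -mulrA [D%:R * k%:R]mulrC.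
  have -> : D%:R * ((3 + D%:R^-1) * (spread l)%:R) = (3 * D%:R + 1) * (spread l)%:R :> R.
    by move: DV; move: (D%:R : R) (D%:R^-1 : R) (_%:R : R) => d e x de; rewrite mulrA mulrDr de; ring.
  by move: hr; rewrite -(ler_nat R) !natrM natrD natrM.
- rewrite -(ler_pM2l D0') [leRHS]mulrA DV mul1r mulrA -natrM -[leLHS]expRK.
  rewrite -exprn_ln // -natrX.
  have : ln (W ^ (D * size l))%:R <= ln (2 ^ spread l)%:R :> R.
    by rewrite ler_ln ?posrE ?ltr0n ?expn_gt0 // ler_nat.
  move/le_trans; apply; rewrite natrX exprn_ln ?ltr0n // expRK.
  by rewrite -[leRHS]mulr1 ler_wpM2l // ln2_le1.
- by move: hL; rewrite -(ler_nat R) natrM.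
Qed.

End Weight.

Lemma counting_seq (R : realType) (T : choiceType) (s : seq T) : uniq s ->
  counting [set` s] = (size s)%:R%:E :> \bar R.
Proof.
move=> us; have fs : finite_set [set` s] by exact: finite_seq.
rewrite /counting asboolT //; congr (_%:R%:E).
apply/perm_size/uniq_perm => // x.
by rewrite in_fset_set // mem_setE.
Qed.

(** Working with exactly k elements covers infinite sets as well. The hypothesis k < x + 1 fits k
    the ceiling of x: a finite set of at least x elements has more than k - 1. *)
Lemma counting_ge (R : realType) (T : choiceType) (A : set T) (x : R) k :
  (x%:E <= counting A)%E -> ((k%:R : R) < x + 1) ->
  exists s : seq T, [/\ uniq s, size s = k & forall v, v \in s -> A v].
Proof.
move=> xA kx; suff [s [us ks hs]] : exists s : seq T,
    [/\ uniq s, (k <= size s)%N & forall v, v \in s -> A v].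
  exists (take k s); split; [exact: take_uniq|exact: size_takel|].
  by move=> v /mem_take /hs.
have [fA|iA] := pselect (finite_set A); last first.
  have [B BA kB] := infinite_set_fset k iA.
  by exists (finmap.enum_fset B); split=> //; exact: finmap.fset_uniq.
exists (finmap.enum_fset (fset_set A)); split; first exact: finmap.fset_uniq.
  move: xA; rewrite /counting asboolT // lee_fin => xA.
  by rewrite -ltnS -(ltr_nat R) -natr1; apply: lt_le_trans kx _; rewrite lerD2r.
by move=> v; rewrite in_fset_set // => /set_mem.
Qed.

(** The term of degree five of the exponential series beats 4 k^4; the constant 480 is 4 * 5!. *)
Lemma polylog_small (R : realType) (g c N k : R) : 0 < g -> 0 < c -> 0 < N ->
  480 * (5 / c) ^+ 4 * (16 / g) ^+ 5 <= N -> 1 <= k -> k <= 5 / c * N ->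
  (k ^+ 2 + 1) ^+ 2 * expR (- (g / 16 * N)) < 1.
Proof.
move=> g0 c0 N0 hN k1 kN; rewrite expRN ltr_pdivrMr ?expR_gt0 // mul1r.
have gN : 0 <= g / 16 * N by rewrite mulr_ge0 // ltW // divr_gt0.
apply: lt_le_trans (expR_ge1Dxn 4 gN).
have k2 : 1 <= k ^+ 2 by rewrite exprn_ege1.
apply: le_lt_trans (_ : (2 * k ^+ 2) ^+ 2 < _); first by rewrite lerXn2r ?nnegrE; lra.
have -> : (2 * k ^+ 2) ^+ 2 = 4 * k ^+ 4 by ring.
apply: le_lt_trans (_ : 4 * (5 / c * N) ^+ 4 < _).
  by rewrite ler_wpM2l // lerXn2r ?nnegrE //; lra.
apply: le_lt_trans (_ : (g / 16 * N) ^+ 5 / 5`!%:R < _); last by rewrite ltrDr.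
have -> : (5`!%:R : R) = 120 by [].
rewrite ler_pdivlMr // [(g / 16 * N) ^+ 5]exprMn.
apply: le_trans (_ : (g / 16) ^+ 5 * (480 * (5 / c) ^+ 4 * (16 / g) ^+ 5) * N ^+ 4 <= _).
  rewrite le_eqVlt; apply/orP; left; apply/eqP; field.
  by rewrite gt_eqF // gt_eqF.
have g16 : 0 <= (g / 16) ^+ 5 by rewrite exprn_ge0 // divr_ge0 // ltW.
by rewrite -[leLHS]mulrA ler_wpM2l // [N ^+ 5]exprS ler_wpM2r // exprn_ge0 // ltW.
Qed.

(** Rounding d n up to the integer m multiplies the density by at most 1 + 1 / D. *)
Lemma ln_ratio (R : realType) (d n m D : R) : 0 < d -> 0 < n -> 0 < m -> 0 < D ->
  m <= d * n + 1 -> D <= d * n -> ln (m / n) <= ln d + D^-1.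
Proof.
move=> d0 n0 m0 D0 mn Dn.
have DV : 0 < D^-1 by rewrite invr_gt0.
apply: le_trans (_ : ln (d * (1 + D^-1)) <= _).
  rewrite ler_ln ?posrE ?divr_gt0 ?mulr_gt0 //; last lra.
  rewrite ler_pdivrMr // mulrAC mulrDr mulr1; apply: le_trans mn _.
  by rewrite lerD2l ler_pdivlMr // mul1r.
rewrite lnM ?posrE //; last lra.
by rewrite lerD2l le_ln1Dx //; lra.
Qed.

Lemma size_encodable D k l r : (0 < D)%N -> encodable D k l r -> (size l <= spread l)%N.
Proof.
move=> D0 [_ _ h _]; rewrite -(leq_exp2l _ _ (isT : (1 < 2)%N)); apply: leq_trans h.
apply: leq_trans (_ : 2 ^ (D * size l) <= _)%N; first by rewrite leq_pexp2l // leq_pmull.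
exact: leq_exp2r_weak (leq_addr _ _).
Qed.

(** * Choice of the parameters and of the set [S] *)

Theorem theorem1p1 (R : realType) (gamma c : R)
    (hgamma0 : 0 < gamma) (hgamma1 : gamma <= 1) (hc : 0 < c) :
  exists2 alpha : R, 0 < alpha &
    exists N : nat, forall n : nat, (N <= n)%N ->
      forall delta : R, n%:R `^ (- alpha) < delta -> delta <= 1 - c ->
        exists S : set nat,
          [/\ S `<=` upto n,
              ((delta * n%:R)%:E <= counting S)%E
            & forall A B : set nat, A `<=` posnat -> B `<=` posnat ->
                (((3 + gamma) * ln n%:R / ln (1 / delta))%:E
                   <= Order.min (counting A) (counting B))%E ->
                ~ (sumset A B `<=` S)].
Proof.
(* The two summands provide 1 / D <= gamma / 2 and 32 / D <= c gamma, as [exponent_bound] requires;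
   c is a lower bound for log (1 / delta). *)
pose D := ((Num.truncn (2 / gamma)).+1 + (Num.truncn (32 / (c * gamma))).+1)%N.
have gD : 2 <= gamma * D%:R.
  rewrite mulrC -ler_pdivrMr //; apply/ltW/(lt_le_trans (truncnS_gt _)).
  by rewrite ler_nat leq_addr.
have cD : 32 <= c * gamma * D%:R.
  rewrite mulrC -ler_pdivrMr ?mulr_gt0 //; apply/ltW/(lt_le_trans (truncnS_gt _)).
  by rewrite ler_nat leq_addl.
have D0 : (0 < D)%N by [].
have D0' : 0 < D%:R :> R by rewrite ltr0n.
have [k0 enc] := encoding D0.
(* It gives log (1 / delta) < log n / (k0 + 2), which forces k >= k0. The extra 2 also keeps delta n
   at least the square root of n. *)
pose alpha : R := k0.+2%:R^-1.
have alpha0 : 0 < alpha by rewrite invr_gt0 ltr0n.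
exists alpha => //.
pose growth : R := 480 * (5 / c) ^+ 4 * (16 / gamma) ^+ 5.
have growth0 : 0 < growth.
  have c5 : 0 < (5 / c) ^+ 4 by rewrite exprn_gt0 // divr_gt0.
  have g5 : 0 < (16 / gamma) ^+ 5 by rewrite exprn_gt0 // divr_gt0.
  by apply: mulr_gt0 g5; apply: mulr_gt0 c5; rewrite ltr0n.
(* For log n > B0: c makes rounding k up harmless in k <= (5 / c) log n, 2 D gives D <= delta n, and
   [growth] is the threshold of [polylog_small]. *)
pose B0 := c + 2 * D%:R + growth.
exists (Num.truncn (expR B0)).+1 => n hn delta hd1 hd2.
have nB : expR B0 < n%:R by apply: lt_le_trans (truncnS_gt _) _; rewrite ler_nat.
have n0' : 0 < n%:R :> R by apply: lt_trans nB; exact: expR_gt0.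
have n0 : (0 < n)%N by rewrite -(ltr0n R).
pose N : R := ln n%:R.
have BN : B0 < N by rewrite -[B0]expRK ltr_ln ?posrE ?expR_gt0.
have N0 : 0 < N by apply: lt_trans BN; rewrite /B0; lra.
have d0 : 0 < delta by apply: le_lt_trans hd1; exact: powR_ge0.
pose lam := - ln delta.
have lam_lt : k0.+2%:R * lam < N.
  have : ln (n%:R `^ (- alpha)) < ln delta by rewrite ltr_ln ?posrE ?powR_gt0.
  rewrite ln_powR -/N mulNr ltrNl -/lam /alpha => h.
  by rewrite mulrC -ltr_pdivlMr ?ltr0n // mulrC.
have lamc : c <= lam.
  have := @le_ln1Dx R (delta - 1); rewrite [1 + _]addrC subrK /lam => h.
  by have : ln delta <= delta - 1 by [apply: h; lra]; lra.
have lam0 : 0 < lam by exact: lt_le_trans lamc.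
have -> : ln (1 / delta) = lam by rewrite div1r lnV ?posrE.
set x := (3 + gamma) * ln n%:R / lam; pose k := `|Num.ceil x|%N.
have x0 : 0 < x by rewrite divr_gt0 // mulr_gt0 //; lra.
have /andP[k_lt k_ge] : (k%:R < x + 1) && (x <= k%:R).
  have := ceil_itv x; rewrite rmorphB /= ltrBlDr.
  by rewrite /k natr_absz ger0_norm // ceil_ge0; lra.
have k1 : (0 < k)%N by rewrite -(ltr0n R); exact: lt_le_trans k_ge.
have k0k : (k0 <= k)%N.
  rewrite -(ler_nat R); apply: le_trans k_ge.
  rewrite ler_pdivlMr // -/N; move: lam_lt; rewrite -addn2 natrD => h.
  nra.
have kN : k%:R <= 5 / c * N.
  have h1 : x <= 4 / c * N.
    rewrite ler_pdivrMr // -/N; apply: le_trans (_ : 4 * N <= _).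
      by rewrite ler_wpM2r ?(ltW N0) //; lra.
    by rewrite mulrAC ler_wpM2r ?(ltW N0) // mulrAC ler_pdivlMr // ler_wpM2l.
  have h2 : 1 <= N / c by rewrite ler_pdivlMr // mul1r; move: BN D0' growth0; rewrite /B0; lra.
  have h3 : 5 / c * N = 4 / c * N + N / c by ring.
  by move: k_lt; rewrite h3; lra.
pose m := (Num.truncn (delta * n%:R)).+1.
have dn0 : 0 <= delta * n%:R by rewrite mulr_ge0 // ltW.
have mn : (m <= n)%N by rewrite truncn_lt_nat // -[ltRHS]mul1r ltr_pM2r //; lra.
have m_ge : delta * n%:R <= m%:R by exact/ltW/truncnS_gt.
have m_le : m%:R <= delta * n%:R + 1.
  by have /andP[h _] := truncn_itv dn0; rewrite /m -natr1 lerD2r.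
have Dn : D%:R <= delta * n%:R.
  have -> : delta * n%:R = expR (N - lam).
    by rewrite expRD opprK !lnK ?posrE // mulrC.
  apply: le_trans (expR_ge1Dx _).
  have : 2 * lam <= N.
    apply: le_trans (ltW lam_lt); rewrite ler_wpM2r ?(ltW lam0) // ler_nat //.
  by move: BN hc growth0; rewrite /B0; lra.
have hq := ln_ratio d0 n0' (_ : 0 < m%:R) D0' m_le Dn.
(* A code inside two k-element sets is no longer than its spread, hence has at most k^2 entries. *)
have [||S [cS hS]] := @hitting_codes R D k n m (k ^ 2) (expR (- (gamma / 16 * N))) n0 mn (expR_ge0 _).
- move=> l r; apply: (@code_weight R D k n m l r gamma lam) => //; first lra.
  + exact: ltW.
  + by apply: le_trans cD _; rewrite ler_wpM2r ?ler0n // ler_wpM2r // ltW.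
  + by rewrite -ler_pdivrMr.
  + by rewrite opprK; apply: hq; rewrite ltr0n.
- rewrite natrX -natr1 natrX; apply: (@polylog_small _ _ c) => //.
  + by move: BN hc D0'; rewrite /B0 /growth; lra.
  + by rewrite ler1n.
pose S' := [seq i.+1 | i : 'I_n <- enum S].
have uS : uniq S' by rewrite map_inj_uniq ?enum_uniq // => i j [] /val_inj.
exists [set` S']; split.
- by move=> v /mapP[i _ ->]; rewrite /upto /= ltn_ord.
- by rewrite counting_seq // size_map -cardE cS lee_fin.
move=> A B Apos Bpos; rewrite le_min => /andP[hA hB] AB.
have [sA [uA zA memA]] := counting_ge hA k_lt.
have [sB [uB zB memB]] := counting_ge hB k_lt.
have [r [l [sub el]]] := enc k k0k sA sB uA uB zA zB.
have subA v : v \in side true l -> v \in sA by rewrite mem_side => /sub; rewrite mem_tag.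
have subB v : v \in side false l -> v \in sB by rewrite mem_side => /sub; rewrite mem_tag.
have inS v w : v \in sA -> w \in sB -> (v + w)%N \in S'.
  by move=> vA wB; apply: AB; exists v; [exact: memA|exists w; [exact: memB|]].
have leS v : v \in S' -> (v <= n)%N by move=> /mapP[i _ ->]; exact: ltn_ord.
have [||s] := hS l r el.
- apply: leq_trans (size_encodable D0 el) _.
  apply: leq_trans (leq_size_sums subA subB) _.
  by rewrite (leq_trans (size_undup _)) // size_allpairs zA zB mulnn.
(* An entry is positive, and adding any element of the other side gives a sum in [n], so the entry
   itself is at most n. *)
- have [a aA] : exists a, a \in sA.
    by move: k1; rewrite -zA; case: (sA) => // a s _; exists a; rewrite mem_head.
  have [b bB] : exists b, b \in sB.
    by move: k1; rewrite -zB; case: (sB) => // b s _; exists b; rewrite mem_head.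
  apply/allP => -[[] v] /sub; rewrite mem_tag /= => hv.
    rewrite (Apos _ (memA _ hv)) /=; exact: leq_trans (leq_addr b _) (leS _ (inS _ _ hv bB)).
  rewrite (Bpos _ (memB _ hv)) /=; exact: leq_trans (leq_addl a _) (leS _ (inS _ _ aA hv)).
case/mem_sums => v [w [/subA vA /subB wB ->]] no.
have /mapP[i iS e] := inS _ _ vA wB.
by apply: (no i); rewrite -?e // -mem_enum.
Qed.
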